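(* Let $\phi(\xi_1,\xi_2)=\xi_1\xi_2$, so that $\mathcal{M}_\phi=\{(\xi_1,\xi_2,\xi_1\xi_2):\xi_1,\xi_2\in[0,1]\}$ is the hyperbolic paraboloid. Fix $0<\epsilon<\frac1{100}$ and $A\ge1$. Then the following statement is false: there is a constant $C_{\epsilon,A}$ such that for every $0<\delta<1$ there exists a family $\mathcal{S}_\delta$ of rectangles $S\subset\mathbb{R}^2$ such that (1) the interiors of distinct rectangles are disjoint: $\mathrm{int}(S_1)\cap\mathrm{int}(S_2)=\emptyset$ for all distinct $S_1,S_2\in\mathcal{S}_\delta$; (2) every $S\in\mathcal{S}_\delta$ is $(\phi,A\delta)$-flat; (3) for all $f:\mathbb{R}^3\to\mathbb{C}$ whose Fourier support is in $N_\delta(\mathcal{M}_\phi)$, $$\|f\|_{L^4}\le C_{\epsilon,A}\,\delta^{-\epsilon}\Big(\sum_{S\in\mathcal{S}_\delta}\|f_S\|_{L^4}^2\Big)^{1/2}.$$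
   Context: $N_\delta(\mathcal{M}_\phi)$ is the $\delta$-neighborhood of $\mathcal{M}_\phi$ in $\mathbb{R}^3$. A set $S\subset\mathbb{R}^2$ is $(\phi,\delta)$-flat if $\sup_{u,v\in S}|\phi(u)-\phi(v)-\nabla\phi(u)\cdot(u-v)|\le\delta$. For each rectangle $S\subset\mathbb{R}^2$ a smooth function $\Xi_S$ on $\mathbb{R}^2$ is fixed such that (i) $\widehat{\Xi_S}$ is supported in $2S$ (dilate by factor $2$ about the center); (ii) $0\le\widehat{\Xi_S}\le1$; (iii) $\widehat{\Xi_S}>1/10$ on $S$; (iv) $\|\Xi_S\|_{L^1}\le1000$. Then $f_S(x_1,x_2,x_3):=\int_{\mathbb{R}^2}f(x_1-y_1,x_2-y_2,x_3)\,\Xi_S(y_1,y_2)\,dy_1dy_2$. *)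

(* Defs.v *)
From HB Require Import structures.
From mathcomp Require Import all_boot all_order all_algebra.
From mathcomp Require Import complex.
From mathcomp Require Import all_classical all_reals all_analysis.
Import Order.TTheory GRing.Theory Num.Theory numFieldNormedType.Exports.

Set Implicit Arguments.
Unset Strict Implicit.
Unset Printing Implicit Defensive.

Local Open Scope classical_set_scope.
Local Open Scope ring_scope.

(* The plane is [R * R] and three-space is [R * R * R], i.e. [(R * R) * R]: a
   point of R^3 is [(x', x3)] with x' in the plane.  The library norm on
   products is the sup norm, hence the explicit Euclidean expressions below. *)
Definition leb2 (R : realType) :
    {measure set (measurableTypeR R * measurableTypeR R) -> \bar R} :=
  (@lebesgue_measure R \x @lebesgue_measure R)%E.
Definition leb3 (R : realType) :
    {measure set (measurableTypeR R * measurableTypeR R * measurableTypeR R)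
      -> \bar R} :=
  (@leb2 R \x @lebesgue_measure R)%E.

Definition dot2 (R : realType) (x y : R * R) : R := x.1 * y.1 + x.2 * y.2.
Definition dot3 (R : realType) (x y : R * R * R) : R :=
  dot2 x.1 y.1 + x.2 * y.2.

Section complex_valued.
Context {R : realType} {d : measure_display} {T : measurableType d}.
Variable mu : {measure set T -> \bar R}.

Definition Cintegrable (f : T -> R[i]) : Prop :=
  mu.-integrable setT (fun x => (complex.Re (f x))%:E) /\
  mu.-integrable setT (fun x => (complex.Im (f x))%:E).

Definition Cintegral (f : T -> R[i]) : R[i] :=
  Complex (\int[mu]_x (complex.Re (f x)))%R (\int[mu]_x (complex.Im (f x)))%R.

Definition CLnorm (p : R) (f : T -> R[i]) : \bar R :=
  (Lnorm mu p%:E (fun x => (complex.Re `|f x|)%R%:E))%E.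

End complex_valued.

(* [expi t] is e^(i t). *)
Definition expi (R : realType) (t : R) : R[i] := Complex (cos t) (sin t).

Definition fourier2 (R : realType) (g : R * R -> R[i]) (xi : R * R) : R[i] :=
  Cintegral (@leb2 R) (fun x => g x * expi (- (2 * pi * dot2 x xi))).
Definition fourier3 (R : realType) (f : R * R * R -> R[i]) (xi : R * R * R) :
    R[i] :=
  Cintegral (@leb3 R) (fun x => f x * expi (- (2 * pi * dot3 x xi))).

Definition support_of (R : realType) (T : topologicalType) (g : T -> R[i]) :
    set T :=
  closure [set x | g x != 0].

(* All iterated directional derivatives exist and are differentiable. *)
Definition smooth (R : realType) (V : normedModType R) (g : V -> R) : Prop :=
  forall (vs : seq V) (x : V),
    differentiable (foldr (fun v h => 'D_v h) g vs) x.
Definition Csmooth (R : realType) (V : normedModType R) (g : V -> R[i]) :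
    Prop :=
  smooth (fun x => complex.Re (g x)) /\ smooth (fun x => complex.Im (g x)).

(* The closed rectangle with centre c, half-side a along the unit vector u and
   half-side b along u rotated by a right angle. *)
Definition rectangle (R : realType) (c u : R * R) (a b : R) : set (R * R) :=
  [set x | `|dot2 (x - c) u| <= a /\ `|dot2 (x - c) (- u.2, u.1)| <= b].

(* Nondegeneracy 0 < a, 0 < b is forced by [adapted] below: a continuous
   function supported in a null set vanishes. *)
Definition rectangle_params (R : realType) (u : R * R) (a b : R) : Prop :=
  [/\ dot2 u u = 1, 0 < a & 0 < b].

Definition is_rectangle (R : realType) (S : set (R * R)) : Prop :=
  exists (c u : R * R) (a b : R),
    rectangle_params u a b /\ S = rectangle c u a b.

Definition dilate (R : realType) (c : R * R) (r : R) (S : set (R * R)) :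
    set (R * R) :=
  [set c + r *: (x - c) | x in S].

(* The conditions on Xi_S, where c is the centre of S.  The order on R[i] only
   compares numbers with equal imaginary parts, so the inequalities also say
   that the Fourier transform is real-valued. *)
Definition adapted (R : realType) (c : R * R) (S : set (R * R))
    (XiS : R * R -> R[i]) : Prop :=
  [/\ Csmooth XiS,
      support_of (fourier2 XiS) `<=` dilate c 2 S,
      forall xi, 0 <= fourier2 XiS xi <= 1,
      forall xi, S xi -> 10^-1 < fourier2 XiS xi
    & (CLnorm (@leb2 R) 1 XiS <= 1000%:E)%E].

(* f_S, as a function of f and Xi_S. *)
Definition rect_proj (R : realType) (XiS : R * R -> R[i]) (f : R * R * R -> R[i])
    (x : R * R * R) : R[i] :=
  Cintegral (@leb2 R) (fun y => f (x.1 - y, x.2) * XiS y).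

Definition grad (R : realType) (phi : R * R -> R) (u : R * R) : R * R :=
  ('D_((1, 0) : R * R) phi u, 'D_((0, 1) : R * R) phi u).

Definition flat (R : realType) (phi : R * R -> R) (delta : R)
    (S : set (R * R)) : Prop :=
  (ereal_sup [set `|phi u - phi v - dot2 (grad phi u) (u - v)|%:E
             | u in S & v in S] <= delta%:E)%E.

Definition graph01 (R : realType) (phi : R * R -> R) : set (R * R * R) :=
  [set ((xi, phi xi) : R * R * R)
  | xi in [set xi : R * R | 0 <= xi.1 <= 1 /\ 0 <= xi.2 <= 1]].

Definition neighborhood (R : realType) (delta : R) (M : set (R * R * R)) :
    set (R * R * R) :=
  [set x | exists2 p, M p & Num.sqrt (dot3 (x - p) (x - p)) < delta].

(* The functions f range over L^1, where the Fourier transform is given by the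
   integral.  K multiplies the whole right-hand side, and the sum over the
   possibly infinite family SS takes values in [0, +oo]. *)
Definition l2L4_decoupling (R : realType) (Xi : set (R * R) -> R * R -> R[i])
    (phi : R * R -> R) (delta K : R) (SS : set (set (R * R))) : Prop :=
  forall f : R * R * R -> R[i],
    Cintegrable (@leb3 R) f ->
    support_of (fourier3 f) `<=` neighborhood delta (graph01 phi) ->
    (CLnorm (@leb3 R) 4 f <= K%:E *
      sqrte (\esum_(S in SS) CLnorm (@leb3 R) 4 (rect_proj (Xi S) f) ^+ 2))%E.

Definition hyperbolic (R : realType) (xi : R * R) : R := xi.1 * xi.2.

(* Main.v *)
Require Import Defs.
From HB Require Import structures.
From mathcomp Require Import all_boot all_order all_algebra.
From mathcomp Require Import complex.
From mathcomp Require Import all_classical all_reals all_analysis.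
From mathcomp Require Import measurable_realfun.
From mathcomp Require finmap.
From mathcomp Require Import ring lra zify.
Import Order.TTheory GRing.Theory Num.Theory numFieldNormedType.Exports.
Local Open Scope classical_set_scope.
Local Open Scope ring_scope.
Set Implicit Arguments.
Unset Strict Implicit.
Unset Printing Implicit Defensive.

(** The idea is to test the inequality on a sum of wave packets with frequencies in a
    small axis-parallel box, of sides [a] and [b] with [a * b = delta]. Over such a
    box the hyperbolic paraboloid is within [delta] of an affine plane in suitable
    coordinates, because its defect from a tangent plane is a product of coordinate
    differences. Hence packets of equal phase above the box add up without
    cancellation on the whole dual region ([wave_lower]), and the norm of the sum
    is as large as possible. Decoupling can only hold if the box is essentially
    contained in few rectangles of the family. But the boxes come in many different shapes
    [a] x [b], and one family of essentially disjoint rectangles cannot serve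
    all of them.

    In detail, a flat rectangle has extents (half-sides of its bounding box) of product
    at most a constant times [delta] ([ext_flat]). Call it heavy for a box if its
    double fills more than a fraction [eta] of the box; its extents are then
    comparable to [a] and [b] up to powers of [eta], so for shapes that differ by more
    than this the heavy rectangles are distinct rectangles. Take five such shapes, and tile
    the unit square by the boxes of each shape. If for every box of every shape 95
    percent of it were covered by doubles of heavy rectangles, the total area
    of the doubles would be at least 4.75, while it is at most (a little more than) four
    times the area of the unit square because the rectangles have disjoint interiors.
    Hence some box has five percent of its area outside the doubles of its
    heavy rectangles; this is [selection], where the set is discretized into
    small cells and the interiors are replaced by smaller concentric rectangles.

    Place one packet in each such cell. The projections to heavy rectangles are zero, as
    the transform of [Xi S] lives on the double of [S]. For the other rectangles let [m]
    be the area of the double inside the box; a supremum bound and a Bessel inequality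
    ([bessel], [rect_proj_L4]) show that the fourth power of the norm of the
    projection is at most a constant times [(delta * m) ^+ 3]. Since all the [m] are at most
    [eta * delta], the sum of the [m ^ (3 / 2)] gains a factor [eta ^ (1 / 4)] over what
    an honest partition of the box would give ([sum_area_sqrt]); convergence of
    the sum over rectangles much longer than the box comes from a packing argument
    ([area_translates]).

    With [N = M ^ 25], [delta = N ^- 48] and [eta = N ^- 4], the gain [N ^- 1] in the sum
    beats the square of the loss [delta ^ (- eps)], which is at most [M ^+ 24], and letting
    [M] grow contradicts a constant independent of [delta]. *)

(** * Complex-valued functions and their integrals *)

Section cabs.
Context {R : realType}.
Implicit Types z w : R[i].

(** The norm of [R[i]] takes values in [R[i]]; this is its real part, a function
    into [R] to which measure theory applies. *)
Definition cabs z : R := complex.Re `|z|.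

Lemma cabsE z : cabs z = Num.sqrt (complex.Re z ^+ 2 + complex.Im z ^+ 2).
Proof. by case: z. Qed.

Lemma normcE z : `|z| = (cabs z)%:C%C.
Proof. by case: z. Qed.

Lemma cabs_ge0 z : 0 <= cabs z.
Proof. by rewrite cabsE sqrtr_ge0. Qed.

Lemma cabs_sqr z : cabs z ^+ 2 = complex.Re z ^+ 2 + complex.Im z ^+ 2.
Proof. by rewrite cabsE sqr_sqrtr// addr_ge0// sqr_ge0. Qed.

Lemma cabsM z w : cabs (z * w) = cabs z * cabs w.
Proof. by rewrite /cabs normrM !normcE /= mulr0 subr0. Qed.

Lemma cabsD z w : cabs (z + w) <= cabs z + cabs w.
Proof. by have := ler_normD z w; rewrite !normcE -rmorphD /= lecR. Qed.

Lemma cabs0 : cabs 0 = 0.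
Proof. by rewrite /cabs normr0. Qed.

Lemma cabs_real (r : R) : cabs r%:C%C = `|r|.
Proof. by rewrite cabsE /= expr0n addr0 sqrtr_sqr. Qed.

Lemma cabs_sum (I : Type) (s : seq I) (P : pred I) (F : I -> R[i]) :
  cabs (\sum_(i <- s | P i) F i) <= \sum_(i <- s | P i) cabs (F i).
Proof.
elim/big_ind2 : _ => //; first by rewrite cabs0.
by move=> a b c d ab cd; apply: (le_trans (cabsD _ _)); exact: lerD.
Qed.

Lemma cabs_Re z : `|complex.Re z| <= cabs z.
Proof. by rewrite -sqrtr_sqr cabsE ler_sqrt ?lerDl ?addr_ge0 ?sqr_ge0. Qed.

Lemma cabs_Im z : `|complex.Im z| <= cabs z.
Proof. by rewrite -sqrtr_sqr cabsE ler_sqrt ?lerDr ?addr_ge0 ?sqr_ge0. Qed.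

Lemma cabs_expi (t : R) : cabs (expi t) = 1.
Proof. by rewrite cabsE /= cos2Dsin2 sqrtr1. Qed.

Lemma expiD (s t : R) : expi (s + t) = expi s * expi t.
Proof.
apply/eqP; rewrite eq_complex /= cosD sinD eqxx /=.
by rewrite addrC eqxx.
Qed.

Lemma expi0 : expi 0 = 1 :> R[i].
Proof. by rewrite /expi cos0 sin0. Qed.

Lemma cReM z w : complex.Re (z * w) =
  complex.Re z * complex.Re w - complex.Im z * complex.Im w.
Proof. by case: z => a b; case: w. Qed.

Lemma cImM z w : complex.Im (z * w) =
  complex.Re z * complex.Im w + complex.Im z * complex.Re w.
Proof. by case: z => a b; case: w. Qed.

Lemma cReD z w : complex.Re (z + w) = complex.Re z + complex.Re w.
Proof. by case: z => a b; case: w. Qed.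

Lemma cImD z w : complex.Im (z + w) = complex.Im z + complex.Im w.
Proof. by case: z => a b; case: w. Qed.

Lemma cRe_conj z : complex.Re (z^*)%C = complex.Re z.
Proof. by case: z. Qed.

Lemma cIm_conj z : complex.Im (z^*)%C = - complex.Im z.
Proof. by case: z. Qed.

Lemma cabs_conj z : cabs (z^*)%C = cabs z.
Proof. by rewrite !cabsE cRe_conj cIm_conj sqrrN. Qed.

Lemma mul_conj z : z * (z^*)%C = (cabs z ^+ 2)%:C%C.
Proof.
apply/eqP; rewrite eq_complex cReM cImM cRe_conj cIm_conj /= cabs_sqr.
by apply/andP; split; apply/eqP; ring.
Qed.

Lemma conj_expi (t : R) : ((expi t)^*)%C = expi (- t).
Proof. by rewrite /expi cosN sinN. Qed.

Lemma Cext z w : complex.Re z = complex.Re w -> complex.Im z = complex.Im w ->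
  z = w.
Proof. by case: z => a b; case: w => c e /= -> ->. Qed.

End cabs.

Section measurable_complex.
Context {R : realType} {d : measure_display} {T : measurableType d}.
Implicit Types f g : T -> R[i].

Definition Cmeas f : Prop :=
  measurable_fun setT (fun x => complex.Re (f x)) /\
  measurable_fun setT (fun x => complex.Im (f x)).

Lemma CmeasM f g : Cmeas f -> Cmeas g -> Cmeas (fun x => f x * g x).
Proof.
move=> [f1 f2] [g1 g2]; split.
- under eq_fun do rewrite cReM.
  by apply: measurable_funB; exact: measurable_funM.
- under eq_fun do rewrite cImM.
  by apply: measurable_funD; exact: measurable_funM.
Qed.

Lemma CmeasD f g : Cmeas f -> Cmeas g -> Cmeas (fun x => f x + g x).
Proof.
move=> [f1 f2] [g1 g2]; split.
- by under eq_fun do rewrite cReD; exact: measurable_funD.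
- by under eq_fun do rewrite cImD; exact: measurable_funD.
Qed.

Lemma Cmeas_cst (z : R[i]) : Cmeas (fun=> z).
Proof. by split; exact: measurable_cst. Qed.

Lemma Cmeas_sum (I : Type) (s : seq I) (P : pred I) (F : I -> T -> R[i]) :
  (forall i, P i -> Cmeas (F i)) -> Cmeas (fun x => \sum_(i <- s | P i) F i x).
Proof.
move=> mF; elim: s => [|i s ih].
  by under eq_fun do rewrite big_nil; exact: Cmeas_cst.
case Pi : (P i); under eq_fun do rewrite big_cons Pi; last exact: ih.
by apply: CmeasD => //; exact: mF.
Qed.

Lemma Cmeas_real (f : T -> R) : measurable_fun setT f ->
  Cmeas (fun x => (f x)%:C%C).
Proof. by move=> mf; split => //=; exact: measurable_cst. Qed.

Lemma Cmeas_conj f : Cmeas f -> Cmeas (fun x => ((f x)^*)%C).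
Proof.
move=> [f1 f2]; split.
- by under eq_fun do rewrite cRe_conj.
- under eq_fun do rewrite cIm_conj.
  by apply: measurableT_comp => //; exact: measurable_oppr.
Qed.

Lemma Cmeas_expi (f : T -> R) : measurable_fun setT f ->
  Cmeas (fun x => expi (f x)).
Proof.
move=> mf; split => /=; apply: measurableT_comp mf;
  apply: continuous_measurable_fun => x.
- exact: continuous_cos.
- exact: continuous_sin.
Qed.

Lemma measurable_cabs f : Cmeas f -> measurable_fun setT (fun x => cabs (f x)).
Proof.
move=> [f1 f2]; under eq_fun do rewrite cabsE.
apply: measurableT_comp.
  by apply: continuous_measurable_fun => x; exact: sqrt_continuous.
by apply: measurable_funD; exact: measurable_funX.
Qed.

End measurable_complex.

Lemma Cmeas_comp (R : realType) d d' (T : measurableType d)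
  (T' : measurableType d') (f : T -> R[i]) (h : T' -> T) :
  Cmeas f -> measurable_fun setT h -> Cmeas (fun x => f (h x)).
Proof.
by move=> [f1 f2] mh; split; [exact: (measurableT_comp f1)|
  exact: (measurableT_comp f2)].
Qed.

Lemma integrable_scale (R : realType) d (T : measurableType d)
  (mu : {measure set T -> \bar R}) (f : T -> R) (a : R) :
  mu.-integrable setT (fun x => (f x)%:E) ->
  mu.-integrable setT (fun x => (a * f x)%:E).
Proof. by move=> fi; under eq_fun do rewrite EFinM; exact: integrableZl. Qed.

Section integration_complex.
Context {R : realType} {d : measure_display} {T : measurableType d}.
Variable mu : {measure set T -> \bar R}.
Implicit Types f g : T -> R[i].

Lemma CI_meas f : Cintegrable mu f -> Cmeas f.
Proof.
by move=> [/measurable_int/measurable_EFinP f1 /measurable_int/measurable_EFinP f2].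
Qed.

Lemma CI_le f (g : T -> R) : Cmeas f ->
  mu.-integrable setT (fun x => (g x)%:E) -> (forall x, cabs (f x) <= g x) ->
  Cintegrable mu f.
Proof.
move=> [f1 f2] ig fg; split.
- apply: (@le_integrable _ _ _ mu setT measurableT _ _ _ _ ig).
    exact/measurable_EFinP.
  move=> x _ /=; rewrite lee_fin (le_trans (cabs_Re _))// (le_trans (fg x))//.
  exact: ler_norm.
- apply: (@le_integrable _ _ _ mu setT measurableT _ _ _ _ ig).
    exact/measurable_EFinP.
  move=> x _ /=; rewrite lee_fin (le_trans (cabs_Im _))// (le_trans (fg x))//.
  exact: ler_norm.
Qed.

Lemma CI_cabs f : Cintegrable mu f -> mu.-integrable setT (fun x => (cabs (f x))%:E).
Proof.
move=> cf; have mf := CI_meas cf; case: cf => f1 f2.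
have := integrableD measurableT (integrable_abse f1)
  (integrable_abse f2).
apply: (@le_integrable _ _ _ mu setT measurableT).
  by apply/measurable_EFinP; exact: measurable_cabs.
move=> x _ /=; rewrite lee_fin (ger0_norm (cabs_ge0 _)).
rewrite ger0_norm ?addr_ge0// -(@ler_pXn2r _ 2) ?nnegrE ?addr_ge0 ?cabs_ge0//.
rewrite cabs_sqr sqrrD !real_normK ?num_real// lerD2r lerDl.
by rewrite mulrn_wge0// mulr_ge0.
Qed.

Lemma CID f g : Cintegrable mu f -> Cintegrable mu g ->
  Cintegrable mu (fun x => f x + g x).
Proof.
move=> [f1 f2] [g1 g2]; split.
- by under eq_fun do rewrite cReD EFinD; exact: integrableD.
- by under eq_fun do rewrite cImD EFinD; exact: integrableD.
Qed.

Lemma CI0 : Cintegrable mu (fun=> 0).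
Proof. by split; exact: integrable0. Qed.

Lemma CI_sum (I : Type) (s : seq I) (P : pred I) (F : I -> T -> R[i]) :
  (forall i, P i -> Cintegrable mu (F i)) ->
  Cintegrable mu (fun x => \sum_(i <- s | P i) F i x).
Proof.
move=> mF; elim: s => [|i s ih].
  by under eq_fun do rewrite big_nil; exact: CI0.
case Pi : (P i); under eq_fun do rewrite big_cons Pi; last exact: ih.
by apply: CID => //; exact: mF.
Qed.

Lemma CI_bdM f g (B : R) : Cintegrable mu f -> Cmeas g ->
  (forall x, cabs (g x) <= B) -> Cintegrable mu (fun x => g x * f x).
Proof.
move=> cf mg gB; apply: (CI_le (g := fun x => B * cabs (f x))).
- exact: CmeasM mg (CI_meas cf).
- under eq_fun do rewrite EFinM; apply: integrableZl => //; exact: CI_cabs.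
- by move=> x; rewrite cabsM ler_wpM2r// cabs_ge0.
Qed.

Lemma CIZ f (z : R[i]) : Cintegrable mu f -> Cintegrable mu (fun x => z * f x).
Proof.
by move=> cf; apply: (CI_bdM (B := cabs z)) => //; exact: Cmeas_cst.
Qed.

Lemma CintD f g : Cintegrable mu f -> Cintegrable mu g ->
  Cintegral mu (fun x => f x + g x) = Cintegral mu f + Cintegral mu g.
Proof.
move=> [f1 f2] [g1 g2]; apply: Cext => /=.
- by under eq_Rintegral do rewrite cReD; rewrite RintegralD.
- by under eq_Rintegral do rewrite cImD; rewrite RintegralD.
Qed.

Lemma CintZ f (z : R[i]) : Cintegrable mu f ->
  Cintegral mu (fun x => z * f x) = z * Cintegral mu f.
Proof.
move=> [f1 f2]; case: z => a b; apply: Cext => /=.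
- under eq_Rintegral do rewrite cReM /=.
  rewrite RintegralB//; [by rewrite !RintegralZl| |];
    exact: integrable_scale.
- under eq_Rintegral do rewrite cImM /=.
  rewrite RintegralD//; [by rewrite !RintegralZl| |];
    exact: integrable_scale.
Qed.

Lemma Cint0 : Cintegral mu (fun=> 0) = 0.
Proof.
by apply: Cext; rewrite /= /Rintegral integral0.
Qed.

Lemma eq_Cint f g : f =1 g -> Cintegral mu f = Cintegral mu g.
Proof. by move=> /funext ->. Qed.

Lemma Cint_sum (I : Type) (s : seq I) (P : pred I) (F : I -> T -> R[i]) :
  (forall i, P i -> Cintegrable mu (F i)) ->
  Cintegral mu (fun x => \sum_(i <- s | P i) F i x) =
  \sum_(i <- s | P i) Cintegral mu (F i).
Proof.
move=> mF; elim: s => [|i s ih].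
  by under eq_fun do rewrite big_nil; rewrite big_nil Cint0.
rewrite big_cons; case Pi : (P i); under eq_fun do rewrite big_cons Pi;
  last exact: ih.
rewrite CintD ?ih//; [exact: mF|exact: CI_sum].
Qed.

Lemma Cint_le f (g : T -> R) : Cmeas f ->
  mu.-integrable setT (fun x => (g x)%:E) -> (forall x, cabs (f x) <= g x) ->
  cabs (Cintegral mu f) <= \int[mu]_x g x.
Proof.
move=> mf ig fg; have cf := CI_le mf ig fg.
set z := Cintegral mu f.
have [z0|z0] := eqVneq (cabs z) 0.
  rewrite z0; apply: Rintegral_ge0 => x _.
  exact: le_trans (cabs_ge0 _) (fg x).
have zp : 0 < cabs z by rewrite lt0r z0 cabs_ge0.
(* rotate the value of the integral onto the positive axis *)
pose w : R[i] := ((cabs z)^-1)%:C%C * (z^*)%C.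
have w1 : cabs w = 1.
  by rewrite cabsM cabs_conj cabs_real ger0_norm ?invr_ge0 ?cabs_ge0// mulVf.
have -> : cabs z = complex.Re (Cintegral mu (fun x => w * f x)).
  rewrite CintZ// -/z /w -mulrA [_ * z]mulrC mul_conj -rmorphM /=.
  by rewrite expr2 mulrA mulVf// mul1r.
apply: le_Rintegral => //.
- by case: (CIZ w cf).
- move=> x _; apply: le_trans (ler_norm _) _; apply: le_trans (cabs_Re _) _.
  by rewrite cabsM w1 mul1r.
Qed.

Lemma Cint_real (f : T -> R) :
  Cintegral mu (fun x => (f x)%:C%C) = (\int[mu]_x f x)%:C%C.
Proof. by apply: Cext => //=; rewrite /Rintegral integral0. Qed.

End integration_complex.

Lemma Cint_conj (R : realType) d (T : measurableType d)
  (mu : {measure set T -> \bar R}) (f : T -> R[i]) : Cintegrable mu f ->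
  Cintegral mu (fun x => ((f x)^*)%C) = ((Cintegral mu f)^*)%C.
Proof.
move=> [f1 f2]; apply: Cext; rewrite ?cRe_conj ?cIm_conj /=.
  by apply: eq_Rintegral => x _; exact: cRe_conj.
transitivity (\int[mu]_x (-1 * complex.Im (f x))).
  by apply: eq_Rintegral => x _; rewrite mulN1r; exact: cIm_conj.
by rewrite RintegralZl// mulN1r.
Qed.

Section fubini_complex.
Context {R : realType} {d1 d2 : measure_display}.
Context {T1 : measurableType d1} {T2 : measurableType d2}.
Variables (m1 : {sigma_finite_measure set T1 -> \bar R})
          (m2 : {sigma_finite_measure set T2 -> \bar R}).

Lemma integrable_tensor (A : T1 -> R) (B : T2 -> R) :
  m1.-integrable setT (fun x => (A x)%:E) ->
  m2.-integrable setT (fun x => (B x)%:E) ->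
  (m1 \x m2)%E.-integrable setT (fun z => (A z.1 * B z.2)%:E).
Proof.
move=> iA iB.
have mA : measurable_fun setT A by apply/measurable_EFinP; exact: measurable_int iA.
have mB : measurable_fun setT B by apply/measurable_EFinP; exact: measurable_int iB.
have mAB : @measurable_fun _ _ [the measurableType _ of (T1 * T2)%type] _ setT
    (fun z : T1 * T2 => (A z.1 * B z.2)%:E).
  apply/measurable_EFinP; apply: measurable_funM.
  - exact: (measurableT_comp mA measurable_fst).
  - exact: (measurableT_comp mB measurable_snd).
apply/(integrable12ltyP _ _ mAB) => /=.
have mA' : measurable_fun setT (fun x => `|A x|%:E).
  by apply/measurable_EFinP; exact: measurableT_comp.
have mB' : measurable_fun setT (fun x => `|B x|%:E).
  by apply/measurable_EFinP; exact: measurableT_comp.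
have E x : (\int[m2]_y `|A x * B y|%:E = `|A x|%:E * \int[m2]_y `|B y|%:E)%E.
  under eq_integral do rewrite normrM EFinM.
  by rewrite ge0_integralZl.
under eq_integral do rewrite E.
rewrite ge0_integralZr//; last by apply: integral_ge0 => y _; rewrite lee_fin.
move/integrableP : iA => [_ iA]; move/integrableP : iB => [_ iB].
apply: lte_mul_pinfty => //; first by apply: integral_ge0 => y _; rewrite lee_fin.
by rewrite ge0_fin_numE//; apply: integral_ge0 => y _; rewrite lee_fin.
Qed.

Lemma real_fubini (f : T1 * T2 -> R) (A : T1 -> R) (B : T2 -> R) :
  measurable_fun setT f -> (forall z, `|f z| <= A z.1 * B z.2) ->
  m1.-integrable setT (fun x => (A x)%:E) ->
  m2.-integrable setT (fun x => (B x)%:E) ->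
  [/\ (m1 \x m2)%E.-integrable setT (fun z => (f z)%:E),
      m1.-integrable setT (fun x => (\int[m2]_y f (x, y))%:E),
      m2.-integrable setT (fun y => (\int[m1]_x f (x, y))%:E),
      \int[m1]_x \int[m2]_y f (x, y) = \int[(m1 \x m2)%E]_z f z &
      \int[m2]_y \int[m1]_x f (x, y) = \int[(m1 \x m2)%E]_z f z].
Proof.
move=> mf fAB iA iB.
have fi : (m1 \x m2)%E.-integrable setT (fun z => (f z)%:E).
  apply: (le_integrable _ _ _ (integrable_tensor iA iB)) => //.
    exact/measurable_EFinP.
  by move=> z _ /=; rewrite lee_fin (le_trans (fAB z))// ler_norm.
have f1 x : m2.-integrable setT (fun y => (f (x, y))%:E).
  apply: (@le_integrable _ _ _ m2 setT measurableT _ _ _ _ (integrable_scale (A x) iB)) => //.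
    by apply/measurable_EFinP; exact: measurable_fun_pair2.
  by move=> y _ /=; rewrite lee_fin (le_trans (fAB _))// ler_norm.
have f2 y : m1.-integrable setT (fun x => (f (x, y))%:E).
  apply: (@le_integrable _ _ _ m1 setT measurableT _ _ _ _ (integrable_scale (B y) iA)) => //.
    by apply/measurable_EFinP; exact: measurable_fun_pair1.
  by move=> x _ /=; rewrite lee_fin (le_trans (fAB _))// mulrC ler_norm.
have E1 x : (\int[m2]_y f (x, y))%:E = (\int[m2]_y (f (x, y))%:E)%E.
  by rewrite /Rintegral fineK//; exact: integrable_fin_num.
have E2 y : (\int[m1]_x f (x, y))%:E = (\int[m1]_x (f (x, y))%:E)%E.
  by rewrite /Rintegral fineK//; exact: integrable_fin_num.
split => //.
- by under eq_fun do rewrite E1; exact: (integrable_fubini_F fi).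
- under eq_fun do rewrite E2.
  apply/integrableP; split; first exact: (measurable_fubini_G fi).
  apply: le_lt_trans ((integrable21ltyP m1 m2 (measurable_int _ fi)).1 fi).
  apply: ge0_le_integral => //.
  - by apply: measurableT_comp => //; exact: (measurable_fubini_G fi).
  - apply: (measurable_fun_fubini_tonelli_G (fun z => `|(f z)%:E|%E)) => //.
    by apply: measurableT_comp => //; exact: measurable_int fi.
  - move=> y _; apply: le_abse_integral => //; exact: measurable_int (f2 y).
- rewrite {1}/Rintegral; under eq_integral do rewrite E1.
  by rewrite (integral12_prod_meas1 fi).
- rewrite {1}/Rintegral; under eq_integral do rewrite E2.
  by rewrite (integral21_prod_meas1 fi).
Qed.

(** A dominating tensor product of integrable functions is what all the
    applications provide, and it makes every integrability condition of Fubini's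
    theorem automatic. *)
Lemma Cfubini (F : T1 * T2 -> R[i]) (A : T1 -> R) (B : T2 -> R) :
  Cmeas F -> (forall z, cabs (F z) <= A z.1 * B z.2) ->
  m1.-integrable setT (fun x => (A x)%:E) ->
  m2.-integrable setT (fun x => (B x)%:E) ->
  [/\ Cintegrable (m1 \x m2)%E F,
      Cintegrable m1 (fun x => Cintegral m2 (fun y => F (x, y))),
      Cintegrable m2 (fun y => Cintegral m1 (fun x => F (x, y))),
      Cintegral m1 (fun x => Cintegral m2 (fun y => F (x, y))) =
      Cintegral (m1 \x m2)%E F &
      Cintegral m2 (fun y => Cintegral m1 (fun x => F (x, y))) =
      Cintegral (m1 \x m2)%E F].
Proof.
move=> [mF1 mF2] FAB iA iB.
have [a1 a2 a3 a4 a5] := @real_fubini (fun z => complex.Re (F z)) A B mF1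
  (fun z => le_trans (cabs_Re (F z)) (FAB z)) iA iB.
have [b1 b2 b3 b4 b5] := @real_fubini (fun z => complex.Im (F z)) A B mF2
  (fun z => le_trans (cabs_Im (F z)) (FAB z)) iA iB.
by split => //; apply: Cext.
Qed.

Lemma Ctensor (f : T1 -> R[i]) (g : T2 -> R[i]) :
  Cintegrable m1 f -> Cintegrable m2 g ->
  Cintegrable (m1 \x m2)%E (fun z => f z.1 * g z.2) /\
  Cintegral (m1 \x m2)%E (fun z => f z.1 * g z.2) =
  Cintegral m1 f * Cintegral m2 g.
Proof.
move=> fi gi.
have mfg : Cmeas (fun z : T1 * T2 => f z.1 * g z.2).
  apply: CmeasM.
  - exact: Cmeas_comp (CI_meas fi) measurable_fst.
  - exact: Cmeas_comp (CI_meas gi) measurable_snd.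
have h z : cabs (f z.1 * g z.2) <= cabs (f z.1) * cabs (g z.2) by rewrite cabsM.
have [H1 _ _ H2 _] := Cfubini mfg h (CI_cabs fi) (CI_cabs gi).
split => //; rewrite -H2 /=.
under eq_fun do rewrite CintZ//.
by under eq_fun do rewrite mulrC; rewrite CintZ// mulrC.
Qed.

End fubini_complex.

(** Open subsets of the plane are countable unions of rational boxes, so that
    continuity implies measurability for the product sigma-algebra. *)
Lemma continuous_measurable_plane (R : realType) (f : R * R -> R) :
  continuous f ->
  measurable_fun (setT : set (measurableTypeR R * measurableTypeR R)) f.
Proof.
move=> cf; apply: (measurability _ (RGenOInfty.measurableE R)) => //.
move=> /= _ [_ [a ->] <-]; rewrite setTI.
set U := f @^-1` _.
have oU : open U by apply: open_comp => // x _; exact: cf.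
pose box (p q : rat) (n : nat) : set (R * R) :=
  [set x : R * R | `|x.1 - ratr p| < n.+1%:R^-1 /\ `|x.2 - ratr q| < n.+1%:R^-1].
have mbox p q n : measurable (box p q n : set (measurableTypeR R * measurableTypeR R)).
  rewrite (_ : box p q n = ball (ratr p : R) n.+1%:R^-1 `*` ball (ratr q : R) n.+1%:R^-1).
    by apply: measurableX; exact: measurable_ball.
  by apply/seteqP; split => x [] /=; rewrite /ball /= ![`|ratr _ - _|]distrC.
have -> : U = \bigcup_p \bigcup_q \bigcup_(n in [set n | box p q n `<=` U]) box p q n.
  apply/seteqP; split => [x Ux|x [p _] [q _] [n /= + xb]]; last exact.
  have /nbhs_ballP[e /= e0 eU] : nbhs x U by exact: open_nbhs_nbhs.
  pose n := Num.truncn (2 / e).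
  have ne : n.+1%:R^-1 < e / 2.
    rewrite -[e / 2]invrK ltf_pV2 ?posrE ?invr_gt0 ?divr_gt0//.
    by rewrite invf_div truncnS_gt// divr_ge0// ltW.
  have h (t : R) (y : R) : 0 < t -> exists p : rat, `|y - ratr p| < t.
    move=> t0; have yt : y - t < y + t by lra.
    have [p] := rat_in_itvoo yt.
    rewrite in_itv /= => /andP[p1 p2]; exists p.
    rewrite ltr_norml; apply/andP; split; lra.
  have n0 : 0 < n.+1%:R^-1 :> R by [].
  have [p xp] := h _ x.1 n0; have [q xq] := h _ x.2 n0.
  have tri (r t u v : R) : t < e / 2 -> `|u - r| < t -> `|v - r| < t -> `|u - v| < e.
    by move=> te ur vr; have := ler_distD r u v; rewrite [`|r - _|]distrC; lra.
  exists p => //; exists q => //; exists n => //= y [y1 y2]; apply: eU; split => /=;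
    rewrite /ball /=.
  - exact: (tri _ _ _ _ ne xp y1).
  - exact: (tri _ _ _ _ ne xq y2).
apply: bigcupT_measurable_rat => p; apply: bigcupT_measurable_rat => q.
by apply: bigcup_measurable => n _; exact: mbox.
Qed.

(** * The tent function and its Fourier transform *)

Section tent.
Context {R : realType}.
Local Notation leb := (@lebesgue_measure R).

Lemma FTC_global (f F : R -> R) (a b : R) : a < b ->
  (forall x, is_derive x (1 : R) F (f x)) -> continuous f ->
  (\int[leb]_(x in `[a, b]) (f x)%:E = (F b - F a)%:E)%E.
Proof.
move=> ab dF cf.
have cF : continuous F.
  move=> x; apply: differentiable_continuous; apply/derivable1_diffP.
  by case: (dF x).
rewrite (@continuous_FTC2 _ f F) //.
- exact: continuous_subspaceT.
- split.
  + by move=> x _; case: (dF x).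
  + by apply: cvg_at_right_filter; exact: cF.
  + by apply: cvg_at_left_filter; exact: cF.
- by move=> x _; rewrite derive1E; exact: derive_val.
Qed.

(** Each half of a tent is affine, so this primitive suffices to integrate a tent
    against a cosine. *)
Lemma affcos_FTC (s w t p a b : R) : w != 0 -> a < b ->
  let F x := (1 + s * (x - p)) * sin (w * x + t) / w + s * cos (w * x + t) / w ^+ 2 in
  (\int[leb]_(x in `[a, b]) ((1 + s * (x - p)) * cos (w * x + t))%:E
   = (F b - F a)%:E)%E.
Proof.
move=> w0 ab F; apply: FTC_global => // x; last first.
  by apply: differentiable_continuous; apply/derivable1_diffP; exact: ex_derive.
apply: is_derive_eq.
rewrite !scaler0 !addr0 !add0r /GRing.scale /=.
by field.
Qed.

Definition tent (r p x : R) : R := Num.max 0 (1 - `|x - p| / r).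

(** [ghat r w] is the Fourier transform of [tent r 0] at angular frequency [w]. *)
Definition ghat (r w : R) : R :=
  if w == 0 then r else 2 * (1 - cos (w * r)) / (r * w ^+ 2).

Lemma tent_ge0 (r p x : R) : 0 <= tent r p x.
Proof. by rewrite /tent le_max lexx. Qed.

Lemma tent_le1 (r p x : R) : 0 < r -> tent r p x <= 1.
Proof. by move=> r0; rewrite /tent ge_max ler01/= lerBlDl lerDr divr_ge0// ltW. Qed.

Lemma tent_out (r p x : R) : 0 < r -> r <= `|x - p| -> tent r p x = 0.
Proof.
move=> r0 rx; rewrite /tent max_l// subr_le0 lter_pdivlMr// mul1r.
exact: rx.
Qed.

Lemma tent_l (r p x : R) : 0 < r -> p - r <= x <= p -> tent r p x = 1 + r^-1 * (x - p).
Proof.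
move=> r0 /andP[a b]; rewrite /tent ler0_norm ?subr_le0//.
rewrite mulNr opprK [_ / r]mulrC max_r// -(@ler_pM2l _ r)// mulr0 mulrDr mulr1.
by rewrite mulrA divff ?gt_eqF// mul1r; lra.
Qed.

Lemma tent_r (r p x : R) : 0 < r -> p <= x <= p + r -> tent r p x = 1 + (- r^-1) * (x - p).
Proof.
move=> r0 /andP[a b]; rewrite /tent ger0_norm ?subr_ge0//.
rewrite mulNr [_ / r]mulrC max_r// -(@ler_pM2l _ r)// mulr0 mulrBr mulr1.
by rewrite mulrA divff ?gt_eqF// mul1r; lra.
Qed.

Lemma continuous_tent r p : continuous (tent r p).
Proof.
have cg : continuous (fun x => 1 - `|x - p| / r).
  move=> x; apply: cvgB; first exact: cvg_cst.
  apply: cvgM; last exact: cvg_cst.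
  by apply: cvg_norm; apply: cvgB; [exact: cvg_id|exact: cvg_cst].
move=> x; rewrite /continuous_at /tent.
under eq_fun do rewrite maxr_absE sub0r add0r.
rewrite maxr_absE sub0r add0r; apply: cvgM; last exact: cvg_cst.
by apply: cvgD; [|apply: cvg_norm; apply: cvgN]; exact: cg.
Qed.

Lemma Rint_tent_split (h : R -> R) (r p : R) : 0 < r -> continuous h ->
  leb.-integrable setT (fun x => (tent r p x * h x)%:E) /\
  \int[leb]_x (tent r p x * h x) =
  \int[leb]_(x in `[p - r, p]) ((1 + r^-1 * (x - p)) * h x) +
  \int[leb]_(x in `[p, p + r]) ((1 + (- r^-1) * (x - p)) * h x).
Proof.
move=> r0 ch.
pose k x := tent r p x * h x.
have ck : continuous k by move=> x; apply: cvgM; [exact: continuous_tent|exact: ch].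
have pr : p - r <= p by lra.
have pr' : p <= p + r by lra.
have ik : leb.-integrable `[p - r, p + r] (EFin \o k).
  apply: continuous_compact_integrable; first exact: segment_compact.
  exact: continuous_subspaceT.
have kE : k = k \_ `[p - r, p + r].
  apply/funext => x; rewrite /patch; case: ifPn => //.
  rewrite notin_setE /= in_itv /= => /negP xr.
  rewrite /k tent_out ?mul0r// leNgt; apply: contra xr => /ltW.
  by rewrite ler_norml => /andP[]; lra.
split.
  rewrite (_ : (fun x => _) = (EFin \o k) \_ `[p - r, p + r]).
    have mI : measurable (`[p - r, p + r]%classic : set (measurableTypeR R)) by [].
    exact: ((@integrable_mkcond _ _ _ leb _ (EFin \o k) mI).1 ik).
  by apply/funext => x; rewrite restrict_EFin -kE.
rewrite -/k.
transitivity (\int[leb]_(x in `[p - r, p + r]) k x).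
  by rewrite [RHS]Rintegral_mkcond -kE.
have itvE : (`[p - r, p + r] = `[p - r, p[ `|` `[p, p + r])%classic.
  by rewrite -itv_bndbnd_setU// bnd_simp.
rewrite itvE Rintegral_setU//; last 2 first.
- by rewrite -itvE.
- apply/disj_set2P; rewrite -subset0 => x [] /=; rewrite !in_itv /=; lra.
rewrite Rintegral_itv_bndo_bndc; last first.
  by apply: integrableS ik => //; apply: subset_itvl; rewrite bnd_simp; lra.
congr (_ + _); apply: eq_Rintegral => x; rewrite inE /= in_itv /= => xp; rewrite /k.
- by rewrite tent_l.
- by rewrite tent_r.
Qed.

Lemma tent_cos (r p w t : R) : 0 < r ->
  \int[leb]_x (tent r p x * cos (w * x + t)) = cos (w * p + t) * ghat r w.
Proof.
move=> r0; have ch : continuous (fun x => cos (w * x + t)).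
  by move=> x; apply: differentiable_continuous; apply/derivable1_diffP; exact: ex_derive.
rewrite (Rint_tent_split p r0 ch).2 /ghat /Rintegral.
have [->|w0] := eqVneq w 0.
  have E s a b : a < b -> (\int[leb]_(x in `[a, b]) ((1 + s * (x - p)) * cos (0 * x + t))%:E =
    (((b - p) + s * (b - p) ^+ 2 / 2) * cos t - ((a - p) + s * (a - p) ^+ 2 / 2) * cos t)%:E)%E.
    move=> ab; pose F x := ((x - p) + s * (x - p) ^+ 2 / 2) * cos t.
    rewrite -[(_ - _)%R]/(F b - F a); apply: FTC_global => // x.
      apply: is_derive_eq.
      rewrite ?scaler0 ?addr0 ?add0r /GRing.scale /= ?mul0r ?add0r.
      by field.
    by apply: differentiable_continuous; apply/derivable1_diffP; exact: ex_derive.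
  rewrite !E ?ltrDl ?ltrBlDr// ?ltrDl//= mul0r add0r.
  have alg (c : R) : r != 0 -> (p - p + r^-1 * (p - p) ^+ 2 / 2) * c -
    (p - r - p + r^-1 * (p - r - p) ^+ 2 / 2) * c +
    ((p + r - p + - r^-1 * (p + r - p) ^+ 2 / 2) * c -
    (p - p + - r^-1 * (p - p) ^+ 2 / 2) * c) = c * r by move=> rn0; field.
  by apply: alg; exact: lt0r_neq0.
rewrite !affcos_FTC// ?ltrDl ?ltrBlDr ?ltrDl//=.
have -> : w * (p - r) + t = (w * p + t) - w * r by ring.
have -> : w * (p + r) + t = (w * p + t) + w * r by ring.
set u := w * p + t; set v := w * r.
rewrite (cosB u v) (cosD u v) (sinB u v) (sinD u v); field.
by rewrite w0 lt0r_neq0.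
Qed.

End tent.

Section kernel1D.
Context {R : realType}.
Local Notation leb := (@lebesgue_measure R).
Local Notation mR := (measurableTypeR R).
Implicit Types r p w t : R.

Lemma cos_ge_half (y : R) : `|y| <= 2^-1 -> 2^-1 <= cos y.
Proof.
move=> y2; have pi1 := @pihalf_ge1 R.
have /andP[y1 y3] : - 2^-1 <= y <= 2^-1 by rewrite -ler_norml.
have c0 : 0 <= cos y by apply: cos_ge0_pihalf; lra.
have : 0 <= cos (y *+ 2) by apply: cos_ge0_pihalf; rewrite (mulr2n y); lra.
rewrite cos_mulr2n (mulr2n (cos y ^+ 2)) => c2; nra.
Qed.

Lemma integrable_tent r p : 0 < r -> leb.-integrable setT (fun x => (tent r p x)%:E).
Proof.
move=> r0; have := (@Rint_tent_split R (fun=> 1) r p r0 (@cst_continuous _ _ _)).1.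
rewrite [X in _.-integrable _ X -> _](_ : _ = (fun x => (tent r p x)%:E))//.
by apply/funext => x; rewrite mulr1.
Qed.

Lemma Rint_tent r p : 0 < r -> \int[leb]_x tent r p x = r.
Proof.
move=> r0; have := @tent_cos R r p 0 0 r0.
rewrite mul0r add0r cos0 mul1r /ghat eqxx => {2}<-.
by apply: eq_Rintegral => x _; rewrite mul0r add0r cos0 mulr1.
Qed.

Lemma measurable_tent r p : measurable_fun (setT : set mR) (tent r p).
Proof. by apply: continuous_measurable_fun; exact: continuous_tent. Qed.

Lemma ghat_int r w : 0 < r -> ghat r w = \int[leb]_x (tent r 0 x * cos (w * x)).
Proof.
move=> r0; have := @tent_cos R r 0 w 0 r0; rewrite mulr0 addr0 cos0 mul1r => <-.
by apply: eq_Rintegral => x _; rewrite addr0.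
Qed.

Lemma integrable_tentcos r w : 0 < r ->
  leb.-integrable setT (fun x => (tent r 0 x * cos (w * x))%:E).
Proof.
move=> r0; apply: (@Rint_tent_split R (fun x => cos (w * x)) r 0 r0 _).1.
by move=> x; apply: differentiable_continuous; apply/derivable1_diffP; exact: ex_derive.
Qed.

Lemma ghat_le r w : 0 < r -> ghat r w <= r.
Proof.
move=> r0; rewrite ghat_int// -[leRHS](Rint_tent 0 r0); apply: le_Rintegral => //.
- exact: integrable_tentcos.
- exact: integrable_tent.
- by move=> x _; rewrite -[leRHS]mulr1 ler_wpM2l ?tent_ge0// cos_le1.
Qed.

Lemma ghat_ge_half r w : 0 < r -> `|w| * r <= 2^-1 -> r / 2 <= ghat r w.
Proof.
move=> r0 wr; rewrite ghat_int// -{1}(Rint_tent 0 r0) -RintegralZr//; last first.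
  exact: integrable_tent.
apply: le_Rintegral => //.
- under eq_fun do rewrite mulrC; apply: integrable_scale; exact: integrable_tent.
- exact: integrable_tentcos.
- move=> x _; have [rx|xr] := leP r `|x|.
    by rewrite tent_out ?subr0// !mul0r.
  rewrite ler_wpM2l ?tent_ge0// cos_ge_half// normrM.
  by apply: le_trans wr; rewrite ler_wpM2l// ltW.
Qed.

Lemma ghat_ge0 r w : 0 < r -> 0 <= ghat r w.
Proof.
move=> r0; rewrite /ghat; case: ifPn => [_|w0]; first exact: ltW.
apply: divr_ge0; apply: mulr_ge0; rewrite ?subr_ge0 ?cos_le1 ?sqr_ge0 ?(ltW r0)//.
Qed.

Lemma ghat_scale r w : 0 < r -> ghat r w = r * ghat 1 (r * w).
Proof.
move=> r0; rewrite /ghat mulf_eq0 (gt_eqF r0) /=.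
have [E|w0] := eqVneq w 0; first by rewrite mulr1.
rewrite mulr1 [w * r]mulrC; field.
by rewrite w0 gt_eqF.
Qed.

(** The tent is continuous and piecewise affine, hence its transform decays
    quadratically; this is what makes [ghat r] integrable. *)
Lemma ghat_bound r w : 0 < r -> ghat r w <= (r + 4 / r) * (1 + w ^+ 2)^-1.
Proof.
move=> r0; have w1 : 0 < 1 + w ^+ 2 by rewrite ltr_pwDl// sqr_ge0.
rewrite ler_pdivlMr// mulrDr mulr1; apply: lerD; first exact: ghat_le.
rewrite /ghat; case: ifPn => [/eqP ->|w0].
  by rewrite expr0n mulr0 divr_ge0// ltW.
have -> : 2 * (1 - cos (w * r)) / (r * w ^+ 2) * w ^+ 2 = 2 * (1 - cos (w * r)) / r.
  by field; rewrite w0 gt_eqF.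
rewrite ler_pM2r ?invr_gt0//; have := cos_geN1 (w * r); lra.
Qed.

Lemma measurable_ghat r : 0 < r -> measurable_fun (setT : set mR) (ghat r).
Proof.
move=> r0; rewrite /ghat; apply: measurable_fun_ifT => //.
- by apply: measurable_fun_eqr.
- apply: measurable_funM.
    apply: measurable_funM => //; apply: measurable_funB => //.
    apply: (@continuous_measurable_fun R (fun w => cos (w * r))).
    by move=> x; apply: differentiable_continuous; apply/derivable1_diffP; exact: ex_derive.
  have -> : (fun x : mR => (r * x ^+ 2)^-1) = (fun x => (r * x ^+ 2) `^ (-1)).
    by apply/funext => x; rewrite powR_inv1// mulr_ge0 ?sqr_ge0// ltW.
  apply: (@measurableT_comp _ _ _ mR R R (fun y : R => y `^ (-1)) setT (fun x : mR => r * x ^+ 2)).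
    exact: measurable_powR.
  by apply: measurable_funM => //; exact: measurable_funX.
Qed.

(** [gfun r] is the Fourier transform of [tent r 0] in the normalization with
    [2 * pi] in the exponent. *)
Definition gfun r (z : R) : R := ghat r (2 * pi * z).

Lemma integrable_oneDsqrV : leb.-integrable setT (fun x : mR => ((1 + x ^+ 2)^-1)%:E).
Proof.
have c : continuous (fun x : R => (1 + x ^+ 2)^-1) by exact: continuous_oneDsqrV.
have p0 (x : R) : 0 <= (1 + x ^+ 2)^-1 by rewrite invr_ge0 addr_ge0 ?sqr_ge0.
apply/integrableP; split.
  by apply/measurable_EFinP; exact: continuous_measurable_fun.
under eq_integral do rewrite /= ger0_norm//.
rewrite (ge0_symfun_integralT (f := fun x => (1 + x ^+ 2)^-1))//; last first.
  by move=> x /=; rewrite sqrrN.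
rewrite -set_itvcy.
have := @integral0y_oneDsqr R; rewrite /oneDsqr /= => ->.
by rewrite -EFinM ltry.
Qed.

End kernel1D.

Section affine.
Context {R : realType}.
Local Notation leb := (@lebesgue_measure R).
Local Notation mR := (measurableTypeR R).

Definition aff (a b : R) : mR -> mR := fun x => a * x + b.

Lemma measurable_affine (a b : R) : measurable_fun setT (aff a b).
Proof.
apply: (@measurable_funD _ mR R setT (fun x => a * x) (fun=> b)).
- exact: measurable_funM.
- exact: measurable_cst.
Qed.

Lemma leb_affine_set (a b : R) (A : set mR) : 0 < a -> measurable A ->
  leb A = (a%:E * leb (aff a b @^-1` A))%E.
Proof.
move=> a0 mA.
pose f := aff a b.
have mf : measurable_fun setT f := measurable_affine a b.
pose m : {measure set mR -> \bar R} := mscale (NngNum (ltW a0))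
  (measure_function_pushforward__canonical__measure_function_Measure leb mf).
suff -> : leb A = m A by [].
apply: (lebesgue_measure_unique (mu := m)) => // X [[u v] /= _ <-].
rewrite /m /mscale /= /pushforward.
have -> : (f @^-1` `]u, v]%classic = `](u - b) / a, (v - b) / a]%classic).
  apply/seteqP; split => x /=; rewrite !in_itv /= /f /aff ltr_pdivrMr// ler_pdivlMr//.
    by move=> /andP[h1 h2]; apply/andP; split; lra.
  by move=> /andP[h1 h2]; apply/andP; split; lra.
rewrite !lebesgue_measure_itv /= !lte_fin ltr_pM2r ?invr_gt0// ltrD2r.
case: ifPn => _; last by rewrite mule0.
rewrite -!EFinB -EFinM; congr EFin; field; exact: lt0r_neq0.
Qed.

Lemma ge0_int_affine (a b : R) (F : mR -> \bar R) : 0 < a ->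
  measurable_fun setT F -> (forall x, 0 <= F x)%E ->
  (\int[leb]_x F x = a%:E * \int[leb]_x F (aff a b x))%E.
Proof.
move=> a0 mF F0.
pose f := aff a b.
have mf : measurable_fun setT f := measurable_affine a b.
pose m : {measure set mR -> \bar R} := mscale (NngNum (ltW a0))
  (measure_function_pushforward__canonical__measure_function_Measure leb mf).
rewrite (eq_measure_integral m); last first.
  move=> A mA _; rewrite /m /mscale /= /pushforward /=.
  exact: leb_affine_set.
rewrite ge0_integral_mscale//= ge0_integral_pushforward//.
Qed.

End affine.

Section inversion.
Context {R : realType}.
Local Notation leb := (@lebesgue_measure R).
Local Notation mR := (measurableTypeR R).
Implicit Types r k t : R.

Lemma gfun_ge0 r (z : R) : 0 < r -> 0 <= gfun r z.
Proof. by move=> r0; exact: ghat_ge0. Qed.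

Lemma gfun_le r (z : R) : 0 < r -> gfun r z <= r.
Proof. by move=> r0; exact: ghat_le. Qed.

Lemma gfun_bound r (z : R) : 0 < r -> gfun r z <= (r + 4 / r) * (1 + z ^+ 2)^-1.
Proof.
move=> r0; apply: le_trans (ghat_bound _ r0) _.
have pi2 := @pi_ge2 R.
rewrite ler_wpM2l//; first by rewrite addr_ge0 ?divr_ge0 ?(ltW r0).
have z0 := sqr_ge0 z.
rewrite lef_pV2 ?posrE ?ltr_pwDl ?sqr_ge0//.
rewrite exprMn lerD2l ler_peMl//; nra.
Qed.

Lemma measurable_gfun r : 0 < r -> measurable_fun (setT : set mR) (gfun r).
Proof.
move=> r0; apply: (@measurableT_comp _ _ _ mR mR R (ghat r) setT (fun z : mR => 2 * pi * z)).
  exact: measurable_ghat.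
exact: measurable_funM.
Qed.

Lemma integrable_gfun r : 0 < r -> leb.-integrable setT (fun x : mR => (gfun r x)%:E).
Proof.
move=> r0.
apply: (@le_integrable _ _ _ leb setT measurableT _ _ _ _
  (integrable_scale (r + 4 / r) (@integrable_oneDsqrV R))).
  by apply/measurable_EFinP; exact: measurable_gfun.
move=> x _ /=; rewrite lee_fin ger0_norm ?gfun_ge0//.
by apply: le_trans (gfun_bound _ r0) _; exact: ler_norm.
Qed.

(** The constant of the inversion formula [gfun_cos]. *)
Definition gconst : R := \int[leb]_x gfun 1 x.

Lemma tent_gfun r (p z t : R) : 0 < r ->
  \int[leb]_x (tent r p x * cos (2 * pi * z * x + t)) = cos (2 * pi * z * p + t) * gfun r z.
Proof. by move=> r0; exact: tent_cos. Qed.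

Lemma measurable_cos2 d (T : measurableType d) (f : T -> R) :
  measurable_fun setT f -> measurable_fun setT (fun x => cos (f x)).
Proof.
move=> mf; apply: (measurableT_comp (f := @cos R)) => //.
by apply: continuous_measurable_fun => x; exact: continuous_cos.
Qed.

(** The swap behind the inversion: a Cesaro mean of the integral of [gfun] against a
    character is an average of the tent against an approximate identity. *)
Lemma cesaro_gfun r k t (n : nat) : 0 < r ->
  \int[leb]_x (tent n.+1%:R 0 x * (gfun r x * cos (2 * pi * k * x + t))) =
  cos t * \int[leb]_s (tent r 0 (s / n.+1%:R - k) * gfun 1 s).
Proof.
move=> r0; set N : R := n.+1%:R; have N0 : 0 < N by [].
pose h (z : mR * mR) : R := tent N 0 z.1 * (tent r 0 z.2 * cos (2 * pi * z.1 * (z.2 + k) + t)).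
have mh : measurable_fun setT h.
  apply: measurable_funM; first exact: (measurableT_comp (measurable_tent _ _) measurable_fst).
  apply: measurable_funM; first exact: (measurableT_comp (measurable_tent _ _) measurable_snd).
  apply: measurable_cos2; apply: measurable_funD => //; apply: measurable_funM.
    by apply: measurable_funM => //; exact: measurable_fst.
  by apply: measurable_funD => //; exact: measurable_snd.
have hAB z : `|h z| <= tent N 0 z.1 * tent r 0 z.2.
  rewrite !normrM (ger0_norm (tent_ge0 _ _ _)) ler_wpM2l ?tent_ge0//.
  rewrite (ger0_norm (tent_ge0 _ _ _)) -[leRHS]mulr1 ler_wpM2l ?tent_ge0//.
  exact: cos_max.
have [_ _ _ h1 h2] := real_fubini mh hAB (integrable_tent 0 N0) (integrable_tent 0 r0).
transitivity (\int[leb]_x \int[leb]_y h (x, y)).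
  apply: eq_Rintegral => x _; rewrite /h /=.
  rewrite RintegralZl//; last first.
    apply: (Rint_tent_split _ r0 _).1 => y; apply: differentiable_continuous.
    by apply/derivable1_diffP; exact: ex_derive.
  congr (_ * _).
  transitivity (\int[leb]_y (tent r 0 y * cos (2 * pi * x * y + (2 * pi * k * x + t)))).
    by rewrite tent_gfun// mulr0 add0r mulrC.
  by apply: eq_Rintegral => y _; congr (_ * cos _); ring.
rewrite h1 -h2.
transitivity (\int[leb]_y (cos t * (tent r 0 y * gfun N (y + k)))).
  apply: eq_Rintegral => y _; rewrite /h /=.
  transitivity (\int[leb]_x (tent r 0 y * (tent N 0 x * cos (2 * pi * (y + k) * x + t)))).
    by apply: eq_Rintegral => x _; rewrite mulrCA; congr (_ * (_ * cos _)); ring.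
  rewrite RintegralZl ?tent_gfun//; last first.
    apply: (Rint_tent_split _ N0 _).1 => x; apply: differentiable_continuous.
    by apply/derivable1_diffP; exact: ex_derive.
  by rewrite mulr0 add0r; ring.
have mg : measurable_fun (setT : set mR) (fun y : mR => gfun N (y + k)).
  apply: (@measurableT_comp _ _ _ mR mR R (gfun N) setT (fun y : mR => y + k)).
    exact: measurable_gfun.
  exact: measurable_funD.
rewrite RintegralZl//; last first.
  apply: (@le_integrable _ _ _ leb setT measurableT _ _ _ _
    (integrable_scale N (integrable_tent 0 r0))).
    apply/measurable_EFinP; apply: measurable_funM => //.
    exact: measurable_tent.
  move=> y _ /=; rewrite lee_fin normrM mulrC normrM ler_wpM2r//.
  by rewrite ger0_norm ?gfun_ge0// (le_trans (gfun_le _ _))// ler_norm.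
congr (_ * _); rewrite /Rintegral; congr fine.
rewrite [RHS](ge0_int_affine (N * k) N0).
- rewrite -ge0_integralZl_EFin//.
  + apply: eq_integral => y _; rewrite /aff -EFinM; congr EFin.
    have -> : (N * y + N * k) / N - k = y by field; exact: lt0r_neq0.
    rewrite mulrCA; congr (_ * _); rewrite /gfun (ghat_scale _ N0); congr (_ * ghat _ _).
    by ring.
  + by move=> y _; rewrite lee_fin mulr_ge0 ?tent_ge0 ?gfun_ge0.
  + apply/measurable_EFinP; apply: measurable_funM.
      apply: (@measurableT_comp _ _ _ mR mR R (tent r 0) setT (fun y : mR => aff N (N * k) y / N - k)).
        exact: measurable_tent.
      apply: measurable_funB => //; apply: measurable_funM => //.
      exact: measurable_affine.
    apply: (@measurableT_comp _ _ _ mR mR R (gfun 1) setT (aff N (N * k))).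
      exact: measurable_gfun.
    exact: measurable_affine.
- apply/measurable_EFinP; apply: measurable_funM; last exact: measurable_gfun.
  apply: (@measurableT_comp _ _ _ mR mR R (tent r 0) setT (fun y : mR => y / N - k)).
    exact: measurable_tent.
  by apply: measurable_funB => //; exact: measurable_funM.
- by move=> y; rewrite lee_fin mulr_ge0 ?tent_ge0 ?gfun_ge0.
Qed.

Lemma tent_cvg1 (x : R) : tent n.+1%:R 0 x @[n --> \oo] --> (1 : R).
Proof.
have c : continuous (fun y : R => (1 - `|x - 0| * y + `|1 - `|x - 0| * y|) / 2).
  have cg : continuous (fun y : R => 1 - `|x - 0| * y).
    move=> y; apply: cvgB; first exact: cvg_cst.
    by apply: cvgM; [exact: cvg_cst|exact: cvg_id].
  move=> y; apply: cvgM; last exact: cvg_cst.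
  by apply: cvgD; [|apply: cvg_norm]; exact: cg.
have -> : (fun n => tent n.+1%:R 0 x) =
    (fun y : R => (1 - `|x - 0| * y + `|1 - `|x - 0| * y|) / 2) \o (@harmonic R).
  by apply/funext => n; rewrite /tent /= maxr_absE sub0r add0r normrN.
rewrite [X in _ --> X](_ : 1 = (1 - `|x - 0| * 0 + `|1 - `|x - 0| * 0|) / 2 :> R); last first.
  by rewrite mulr0 subr0 normr1; field.
apply: cvg_comp; first exact: cvg_harmonic.
exact: (c 0).
Qed.

Lemma tent_shift_cvg r k (s : R) :
  tent r 0 (s / n.+1%:R - k) @[n --> \oo] --> tent r 0 k.
Proof.
have -> : tent r 0 k = tent r 0 (s * 0 - k) by rewrite mulr0 sub0r /tent !subr0 normrN.
apply: continuous_cvg; first exact: continuous_tent.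
apply: cvgB; last exact: cvg_cst.
by apply: cvgM; [exact: cvg_cst|exact: cvg_harmonic].
Qed.

(** Fourier inversion for the tent: in [cesaro_gfun] let [n] tend to infinity on both
    sides, by dominated convergence. *)
Lemma gfun_cos r k t : 0 < r ->
  \int[leb]_x (gfun r x * cos (2 * pi * k * x + t)) = cos t * (gconst * tent r 0 k).
Proof.
move=> r0.
have mc : measurable_fun (setT : set mR) (fun x : mR => cos (2 * pi * k * x + t)).
  by apply: measurable_cos2; apply: measurable_funD => //; exact: measurable_funM.
have mgc : measurable_fun (setT : set mR) (fun x : mR => gfun r x * cos (2 * pi * k * x + t)).
  by apply: measurable_funM => //; exact: measurable_gfun.
have ig : leb.-integrable setT (fun x : mR => (gfun r x * cos (2 * pi * k * x + t))%:E).
  apply: (@le_integrable _ _ _ leb setT measurableT _ _ _ _ (integrable_gfun r0)).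
    exact/measurable_EFinP.
  by move=> x _ /=; rewrite lee_fin normrM -[leRHS]mulr1 ler_wpM2l// cos_max.
have c1 : (\int[leb]_x (tent n.+1%:R 0 x * (gfun r x * cos (2 * pi * k * x + t)))%:E)%E
    @[n --> \oo] --> (\int[leb]_x (gfun r x * cos (2 * pi * k * x + t))%:E)%E.
  apply: (@dominated_cvg _ _ _ leb setT measurableT _ _ (fun x : mR => (gfun r x)%:E)).
  - move=> n; apply/measurable_EFinP; apply: measurable_funM => //.
    exact: measurable_tent.
  - move=> x _; apply: cvg_EFin; first exact: nearW.
    rewrite -[X in _ --> X]mul1r; apply: cvgM; last exact: cvg_cst.
    exact: tent_cvg1.
  - by [].
  - exact: integrable_gfun.
  - move=> n x _; rewrite /= lee_fin !normrM (ger0_norm (tent_ge0 _ _ _)).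
    rewrite (ger0_norm (gfun_ge0 _ r0)) mulrA -[leRHS]mulr1 ler_pM//.
    + by rewrite mulr_ge0 ?tent_ge0 ?gfun_ge0.
    + by rewrite -[leRHS]mul1r ler_wpM2r ?gfun_ge0 ?tent_le1.
    + exact: cos_max.
have c2 : (\int[leb]_s (tent r 0 (s / n.+1%:R - k) * gfun 1 s)%:E)%E
    @[n --> \oo] --> (\int[leb]_s (tent r 0 k * gfun 1 s)%:E)%E.
  apply: (@dominated_cvg _ _ _ leb setT measurableT _ _ (fun x : mR => (gfun 1 x)%:E)).
  - move=> n; apply/measurable_EFinP; apply: measurable_funM; last exact: measurable_gfun.
    apply: (@measurableT_comp _ _ _ mR mR R (tent r 0) setT (fun y : mR => y / n.+1%:R - k)).
      exact: measurable_tent.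
    by apply: measurable_funB => //; exact: measurable_funM.
  - move=> x _; apply: cvg_EFin; first exact: nearW.
    by apply: cvgM; [exact: tent_shift_cvg|exact: cvg_cst].
  - by [].
  - exact: integrable_gfun.
  - move=> n x _; rewrite /= lee_fin normrM (ger0_norm (tent_ge0 _ _ _)).
    by rewrite ger0_norm ?gfun_ge0// -[leRHS]mul1r ler_wpM2r ?gfun_ge0 ?tent_le1.
have fi : leb.-integrable setT (fun s : mR => (tent r 0 k * gfun 1 s)%:E).
  by apply: integrable_scale; exact: integrable_gfun.
rewrite -[X in _ --> X]fineK in c1; last exact: integrable_fin_num.
rewrite -[X in _ --> X]fineK in c2; last exact: integrable_fin_num.
move/fine_cvg : c1 => c1.
move/fine_cvg : c2 => c2.
have c3 : (cos t * fine (\int[leb]_s (tent r 0 (s / n.+1%:R - k) * gfun 1 s)%:E)%E)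
    @[n --> \oo] --> cos t * fine (\int[leb]_s (tent r 0 k * gfun 1 s)%:E)%E.
  by apply: cvgM => //; exact: cvg_cst.
have e : (fun n => fine (\int[leb]_x (tent n.+1%:R 0 x * (gfun r x * cos (2 * pi * k * x + t)))%:E)%E)
   = (fun n => cos t * fine (\int[leb]_s (tent r 0 (s / n.+1%:R - k) * gfun 1 s)%:E)%E).
  by apply/funext => n; exact: cesaro_gfun.
rewrite -e in c3.
transitivity (cos t * fine (\int[leb]_s (tent r 0 k * gfun 1 s)%:E)%E).
  exact: (cvg_unique _ c1 c3).
congr (_ * _).
rewrite -[LHS]/(\int[leb]_s (tent r 0 k * gfun 1 s)) RintegralZl//; first by rewrite mulrC.
exact: integrable_gfun.
Qed.

End inversion.
Arguments gconst R : clear implicits.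

(** * Tents in the plane *)

Section plane.
Context {R : realType}.
Local Notation leb := (@lebesgue_measure R).
Local Notation mR := (measurableTypeR R).

(** A name for planar Lebesgue measure that carries its own structure of
    sigma-finite measure, as Fubini's theorem requires. *)
Definition lebp : set (mR * mR)%type -> \bar R := (leb \x leb)%E.

HB.instance Definition _ := Measure.copy lebp (leb \x leb)%E.

Lemma sigma_finite_lebp : sigma_finite setT lebp.
Proof.
have /sigma_finiteP[F [TF ndF Foo]] := sigma_finiteT leb.
exists (fun n => F n `*` F n).
  rewrite -setXTT TF predeqE => -[x y]; split.
    move=> [/= [n _ Fnx] [k _ Gky]]; exists (maxn n k) => //; split.
    - by move: x Fnx; exact/subsetPset/ndF/leq_maxl.
    - by move: y Gky; exact/subsetPset/ndF/leq_maxr.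
  by move=> [n _ []/= ? ?]; split; exists n.
move=> k; have [? ?] := Foo k.
split; first exact: measurableX.
by rewrite /lebp product_measure1E// lte_mul_pinfty// ge0_fin_numE.
Qed.

HB.instance Definition _ := Measure_isSigmaFinite.Build _ _ _ lebp sigma_finite_lebp.

Definition e2pi (t : R) : R[i] := expi (2 * pi * t).

Lemma e2piD (s t : R) : e2pi (s + t) = e2pi s * e2pi t.
Proof. by rewrite /e2pi mulrDr expiD. Qed.

Lemma cabs_e2pi (t : R) : cabs (e2pi t) = 1.
Proof. exact: cabs_expi. Qed.

Lemma Cmeas_e2pi d (T : measurableType d) (f : T -> R) : measurable_fun setT f ->
  Cmeas (fun x => e2pi (f x)).
Proof. by move=> mf; apply: Cmeas_expi; exact: measurable_funM. Qed.

Lemma e2piN (t : R) : ((e2pi t)^*)%C = e2pi (- t).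
Proof. by rewrite /e2pi conj_expi mulrN. Qed.

Lemma CI_tent (r p z : R) : 0 < r ->
  Cintegrable leb (fun s : mR => (tent r p s)%:C%C * e2pi (s * z)).
Proof.
move=> r0; apply: (@CI_le _ _ _ leb _ (tent r p)); last 2 first.
- exact: integrable_tent.
- by move=> s; rewrite cabsM cabs_e2pi mulr1 cabs_real ger0_norm ?tent_ge0.
apply: CmeasM; first by apply: Cmeas_real; exact: measurable_tent.
by apply: Cmeas_e2pi; exact: measurable_funM.
Qed.

Lemma Cint_tent (r p z : R) : 0 < r ->
  Cintegral leb (fun s : mR => (tent r p s)%:C%C * e2pi (s * z)) =
  e2pi (p * z) * (gfun r z)%:C%C.
Proof.
move=> r0; apply: Cext.
- rewrite cReM /= mulr0 subr0 -[2 * pi * (p * z)]addr0.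
  rewrite (_ : 2 * pi * (p * z) + 0 = 2 * pi * z * p + 0); last by ring.
  rewrite -tent_gfun//; apply: eq_Rintegral => s _.
  by rewrite /= mul0r subr0; congr (_ * cos _); ring.
- rewrite cImM /= mulr0 add0r -cosBpihalf.
  rewrite (_ : 2 * pi * (p * z) - pi / 2 = 2 * pi * z * p + (- (pi / 2))); last by ring.
  rewrite -tent_gfun//; apply: eq_Rintegral => s _.
  by rewrite /= mul0r addr0 -cosBpihalf; congr (_ * cos _); ring.
Qed.

Lemma CI_gfun (r k : R) : 0 < r ->
  Cintegrable leb (fun x : mR => (gfun r x)%:C%C * e2pi (k * x)).
Proof.
move=> r0; apply: (@CI_le _ _ _ leb _ (gfun r)); last 2 first.
- exact: integrable_gfun.
- by move=> s; rewrite cabsM cabs_e2pi mulr1 cabs_real ger0_norm ?gfun_ge0.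
apply: CmeasM; first by apply: Cmeas_real; exact: measurable_gfun.
by apply: Cmeas_e2pi; exact: measurable_funM.
Qed.

Lemma Cint_gfun (r k : R) : 0 < r ->
  Cintegral leb (fun x : mR => (gfun r x)%:C%C * e2pi (k * x)) =
  (gconst R * tent r 0 k)%:C%C.
Proof.
move=> r0; apply: Cext => /=.
- transitivity (cos 0 * (gconst R * tent r 0 k)); last by rewrite cos0 mul1r.
  rewrite -gfun_cos//; apply: eq_Rintegral => s _.
  by rewrite /= mul0r subr0 addr0; congr (_ * cos _); ring.
- transitivity (cos (- (pi / 2)) * (gconst R * tent r 0 k)); last first.
    by rewrite cosN cos_pihalf mul0r.
  rewrite -gfun_cos//; apply: eq_Rintegral => s _.
  by rewrite /= mul0r addr0 -cosBpihalf; congr (_ * cos _); ring.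
Qed.

Lemma gconst_ge0 : 0 <= gconst R.
Proof. by apply: Rintegral_ge0 => x _; exact: gfun_ge0. Qed.

Definition tent2 (r p x : R * R) : R := tent r.1 p.1 x.1 * tent r.2 p.2 x.2.
Definition gfun2 (r x : R * R) : R := gfun r.1 x.1 * gfun r.2 x.2.

Lemma tent2_ge0 r p x : 0 <= tent2 r p x.
Proof. by rewrite mulr_ge0 ?tent_ge0. Qed.

Lemma tent2E (r p z s : R * R) : (tent2 r p s)%:C%C * e2pi (dot2 s z) =
  ((tent r.1 p.1 s.1)%:C%C * e2pi (s.1 * z.1)) *
  ((tent r.2 p.2 s.2)%:C%C * e2pi (s.2 * z.2)).
Proof. by rewrite /tent2 /dot2 e2piD rmorphM /=; ring. Qed.

Lemma CI_tent2 (r p z : R * R) : 0 < r.1 -> 0 < r.2 ->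
  Cintegrable lebp (fun s : mR * mR => (tent2 r p s)%:C%C * e2pi (dot2 s z)).
Proof.
move=> r1 r2; under eq_fun do rewrite tent2E.
exact: (Ctensor (CI_tent p.1 z.1 r1) (CI_tent p.2 z.2 r2)).1.
Qed.

Lemma Cint_tent2 (r p z : R * R) : 0 < r.1 -> 0 < r.2 ->
  Cintegral lebp (fun s : mR * mR => (tent2 r p s)%:C%C * e2pi (dot2 s z)) =
  e2pi (dot2 p z) * (gfun2 r z)%:C%C.
Proof.
move=> r1 r2; under eq_fun do rewrite tent2E.
rewrite (Ctensor (CI_tent p.1 z.1 r1) (CI_tent p.2 z.2 r2)).2 !Cint_tent//.
by rewrite /gfun2 /dot2 e2piD rmorphM /=; ring.
Qed.

Lemma gfun2E (r k x : R * R) : (gfun2 r x)%:C%C * e2pi (dot2 k x) =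
  ((gfun r.1 x.1)%:C%C * e2pi (k.1 * x.1)) *
  ((gfun r.2 x.2)%:C%C * e2pi (k.2 * x.2)).
Proof. by rewrite /gfun2 /dot2 e2piD rmorphM /=; ring. Qed.

Lemma CI_gfun2 (r k : R * R) : 0 < r.1 -> 0 < r.2 ->
  Cintegrable lebp (fun x : mR * mR => (gfun2 r x)%:C%C * e2pi (dot2 k x)).
Proof.
move=> r1 r2; under eq_fun do rewrite gfun2E.
exact: (Ctensor (CI_gfun k.1 r1) (CI_gfun k.2 r2)).1.
Qed.

Lemma Cint_gfun2 (r k : R * R) : 0 < r.1 -> 0 < r.2 ->
  Cintegral lebp (fun x : mR * mR => (gfun2 r x)%:C%C * e2pi (dot2 k x)) =
  (gconst R ^+ 2 * tent2 r (0, 0) k)%:C%C.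
Proof.
move=> r1 r2; under eq_fun do rewrite gfun2E.
rewrite (Ctensor (CI_gfun k.1 r1) (CI_gfun k.2 r2)).2 !Cint_gfun//.
by rewrite /tent2 expr2 !rmorphM /=; ring.
Qed.

End plane.

(** * A Bessel inequality *)

Lemma conjCM (R : realType) (z w : R[i]) : ((z * w)^*)%C = (z^*)%C * (w^*)%C.
Proof.
by apply: Cext; rewrite ?cRe_conj ?cIm_conj ?cReM ?cImM ?cRe_conj ?cIm_conj; ring.
Qed.

Section bessel.
Context {R : realType}.
Local Notation leb := (@lebesgue_measure R).
Local Notation mR := (measurableTypeR R).
Local Notation lebp := (@lebp R).

Lemma measurable_dot2 d (T : measurableType d) (f g : T -> mR * mR) :
  measurable_fun setT f -> measurable_fun setT g ->
  measurable_fun setT (fun t => dot2 (f t) (g t)).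
Proof.
move=> mf mg; apply: measurable_funD; apply: measurable_funM.
- exact: (measurableT_comp measurable_fst mf).
- exact: (measurableT_comp measurable_fst mg).
- exact: (measurableT_comp measurable_snd mf).
- exact: (measurableT_comp measurable_snd mg).
Qed.

(** The inverse Fourier transform in the plane. *)
Definition cft (u : mR * mR -> R[i]) (x : mR * mR) : R[i] :=
  Cintegral lebp (fun s => u s * e2pi (dot2 s x)).

Variables (u : mR * mR -> R[i]) (chi : mR * mR -> R).
Hypotheses (mu : Cmeas u) (uchi : forall s, cabs (u s) <= chi s)
  (ichi : lebp.-integrable setT (fun s => (chi s)%:E)).

Let chi_ge0 s : 0 <= chi s := le_trans (cabs_ge0 _) (uchi s).

Let mker d (T : measurableType d) (f : T -> mR * mR) (x : T -> mR * mR) :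
  measurable_fun setT f -> measurable_fun setT x ->
  Cmeas (fun t => u (f t) * e2pi (dot2 (f t) (x t))).
Proof.
move=> mf mx; apply: CmeasM; first exact: Cmeas_comp mu mf.
by apply: Cmeas_e2pi; exact: measurable_dot2.
Qed.

Lemma cabs_cft x : cabs (cft u x) <= \int[lebp]_s chi s.
Proof.
apply: Cint_le => //.
- by apply: mker => //; exact: measurable_id.
- by move=> s; rewrite cabsM cabs_e2pi mulr1.
Qed.

Lemma CI_cft x : Cintegrable lebp (fun s => u s * e2pi (dot2 s x)).
Proof.
apply: (CI_le _ ichi); last by move=> s; rewrite cabsM cabs_e2pi mulr1.
by apply: mker => //; exact: measurable_id.
Qed.

Lemma Cmeas_cft : Cmeas (cft u).
Proof.
pose w (x : mR * mR) : R := (1 + x.1 ^+ 2)^-1 * (1 + x.2 ^+ 2)^-1.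
have iw : lebp.-integrable setT (fun x => (w x)%:E).
  exact: (integrable_tensor (@integrable_oneDsqrV R) (@integrable_oneDsqrV R)).
have mw : measurable_fun setT w by apply/measurable_EFinP; exact: measurable_int iw.
have p0 (y : R) : 0 < 1 + y ^+ 2 by rewrite ltr_pwDl// sqr_ge0.
have w0 x : 0 < w x by rewrite mulr_gt0 ?invr_gt0.
pose F (z : (mR * mR) * (mR * mR)) : R[i] :=
  (w z.1)%:C%C * (u z.2 * e2pi (dot2 z.2 z.1)).
have mF : Cmeas F.
  apply: CmeasM; last by apply: mker; [exact: measurable_snd|exact: measurable_fst].
  by apply: Cmeas_real; exact: (measurableT_comp mw measurable_fst).
have FAB z : cabs (F z) <= w z.1 * chi z.2.
  by rewrite !cabsM cabs_e2pi mulr1 cabs_real ger0_norm ?(ltW (w0 _))// ler_wpM2l ?(ltW (w0 _)).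
have [_ /CI_meas H _ _ _] := Cfubini mF FAB iw ichi.
have -> : cft u = (fun x => ((1 + x.1 ^+ 2) * (1 + x.2 ^+ 2))%:C%C *
    Cintegral lebp (fun y => F (x, y))).
  apply/funext => x; rewrite /F /= CintZ; last exact: CI_cft.
  rewrite mulrA -rmorphM /= /w mulrACA !divff ?gt_eqF//.
  by rewrite mulr1 mul1r.
apply: CmeasM => //; apply: Cmeas_real; apply: measurable_funM;
  apply: measurable_funD => //; apply: measurable_funX.
- exact: measurable_fst.
- exact: measurable_snd.
Qed.

Section weighted.
Variable t : R.
Hypothesis t0 : 0 < t.
Hypothesis chi1 : forall s, chi s <= 1.
Let W (x : mR * mR) : R := gfun2 (t, t) x.
Let X : R := \int[lebp]_s chi s.

Let W0 x : 0 <= W x.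
Proof. by rewrite mulr_ge0 ?gfun_ge0. Qed.

Let iW : lebp.-integrable setT (fun x => (W x)%:E).
Proof. exact: (integrable_tensor (integrable_gfun t0) (integrable_gfun t0)). Qed.

Let mW : measurable_fun setT W.
Proof. by apply/measurable_EFinP; exact: measurable_int iW. Qed.

Let X0 : 0 <= X. Proof. by apply: Rintegral_ge0. Qed.

Let Rint_tent2 (s : mR * mR) : \int[lebp]_y tent2 (t, t) s y = t ^+ 2.
Proof.
pose f (p : R) (y : mR) : R[i] := (tent t p y)%:C%C.
have fi p : Cintegrable leb (f p).
  by split => /=; [exact: integrable_tent|exact: integrable0].
have [_ ] := Ctensor (fi s.1) (fi s.2).
rewrite /f; under eq_Cint do rewrite -rmorphM.
rewrite !Cint_real !Rint_tent// -rmorphM => /complexI.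
by rewrite expr2.
Qed.

Let inner (s : mR * mR) : R[i] :=
  Cintegral lebp (fun x => (W x)%:C%C * ((cft u x)^*)%C * e2pi (dot2 s x)).

Let cabs_inner s : cabs (inner s) <= gconst R ^+ 2 * t ^+ 2.
Proof.
pose F (z : (mR * mR) * (mR * mR)) : R[i] :=
  (W z.1)%:C%C * e2pi (dot2 s z.1) * ((u z.2 * e2pi (dot2 z.2 z.1))^*)%C.
have mF : Cmeas F.
  apply: CmeasM; last first.
    by apply: Cmeas_conj; apply: mker; [exact: measurable_snd|exact: measurable_fst].
  apply: CmeasM.
    by apply: Cmeas_real; exact: (measurableT_comp mW measurable_fst).
  apply: Cmeas_e2pi; apply: measurable_dot2; first exact: measurable_cst.
  exact: measurable_fst.
have FAB z : cabs (F z) <= W z.1 * chi z.2.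
  by rewrite !cabsM cabs_conj cabsM !cabs_e2pi !mulr1 cabs_real ger0_norm// ler_wpM2l.
have [_ _ _ h1 h2] := Cfubini mF FAB iW ichi.
have -> : inner s = Cintegral lebp (fun x => Cintegral lebp (fun y => F (x, y))).
  apply: eq_Cint => x; rewrite /F /= CintZ.
    by rewrite Cint_conj; [rewrite -/(cft u x) mulrAC|exact: CI_cft].
  have mc : Cmeas (fun y => (u y * e2pi (dot2 y x))^*%C).
    by apply: Cmeas_conj; exact: CI_meas (CI_cft x).
  apply: (CI_le mc ichi) => y.
  by rewrite cabs_conj cabsM cabs_e2pi mulr1.
rewrite h1 -h2.
have -> : (fun y => Cintegral lebp (fun x => F (x, y))) =
    (fun y => ((u y)^*)%C * (gconst R ^+ 2 * tent2 (t, t) s y)%:C%C).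
  apply/funext => y.
  transitivity (Cintegral lebp (fun x => ((u y)^*)%C * ((W x)%:C%C * e2pi (dot2 (s - y) x)))).
    apply: eq_Cint => x; rewrite /F /= conjCM e2piN.
    have -> : dot2 (s - y) x = dot2 s x + - dot2 y x by rewrite /dot2 /=; ring.
    by rewrite e2piD; ring.
  rewrite CintZ; last exact: CI_gfun2.
  rewrite Cint_gfun2//; congr (_ * (_ * _)%:C%C).
  by rewrite /tent2 /tent /= !subr0 (distrC s.1) (distrC s.2).
have it2 : lebp.-integrable setT (fun y => (tent2 (t, t) s y)%:E).
  exact: (integrable_tensor (integrable_tent s.1 t0) (integrable_tent s.2 t0)).
have mt2 : measurable_fun setT (tent2 (t, t) s).
  by apply/measurable_EFinP; exact: measurable_int it2.
have mG : Cmeas (fun y => ((u y)^*)%C * (gconst R ^+ 2 * tent2 (t, t) s y)%:C%C).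
  apply: CmeasM; first exact: Cmeas_conj.
  by apply: Cmeas_real; exact: measurable_funM.
have Gle y : cabs (((u y)^*)%C * (gconst R ^+ 2 * tent2 (t, t) s y)%:C%C) <=
    gconst R ^+ 2 * tent2 (t, t) s y.
  rewrite cabsM cabs_conj cabs_real ger0_norm; last first.
    by rewrite mulr_ge0 ?sqr_ge0 ?tent2_ge0.
  rewrite -[leRHS]mul1r ler_wpM2r//; first by rewrite mulr_ge0 ?sqr_ge0 ?tent2_ge0.
  exact: le_trans (uchi _) (chi1 _).
rewrite -(Rint_tent2 s) -RintegralZl//.
exact: Cint_le mG (integrable_scale _ it2) Gle.
Qed.

(** Expand the square and integrate in [x] first: the weight [W] turns the
    kernel into a tent of width [t], so that the pairing of [u] with the
    resulting average of [u] is at most a constant times [t ^+ 2 * X]. *)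
Lemma weighted_bessel :
  lebp.-integrable setT (fun x => (W x * cabs (cft u x) ^+ 2)%:E) /\
  \int[lebp]_x (W x * cabs (cft u x) ^+ 2) <= gconst R ^+ 2 * t ^+ 2 * X.
Proof.
pose F (z : (mR * mR) * (mR * mR)) : R[i] :=
  (W z.1)%:C%C * ((cft u z.1)^*)%C * (u z.2 * e2pi (dot2 z.2 z.1)).
have mWc : Cmeas (fun x => (W x)%:C%C * ((cft u x)^*)%C).
  apply: CmeasM; first exact: Cmeas_real.
  by apply: Cmeas_conj; exact: Cmeas_cft.
have mF : Cmeas F.
  apply: CmeasM; last by apply: mker; [exact: measurable_snd|exact: measurable_fst].
  exact: (Cmeas_comp mWc measurable_fst).
have FAB z : cabs (F z) <= (X * W z.1) * chi z.2.
  rewrite !cabsM cabs_conj cabs_e2pi mulr1 cabs_real ger0_norm//.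
  apply: ler_pM => //; [by rewrite mulr_ge0 ?cabs_ge0|exact: cabs_ge0|].
  by rewrite mulrC ler_wpM2r// cabs_cft.
have iXW := integrable_scale X iW.
have [_ ci _ h1 h2] := Cfubini mF FAB iXW ichi.
have FE x : Cintegral lebp (fun y => F (x, y)) = (W x * cabs (cft u x) ^+ 2)%:C%C.
  rewrite /F /= CintZ; last exact: CI_cft.
  by rewrite -/(cft u x) -mulrA (mulrC _ (cft u x)) mul_conj -rmorphM.
split.
  by case: ci => + _; under eq_fun do rewrite FE /=.
move: h1; under eq_Cint do rewrite FE.
rewrite Cint_real -h2 => h1.
apply: le_trans (ler_norm _) _; rewrite -cabs_real h1.
have -> : (fun y => Cintegral lebp (fun x => F (x, y))) = (fun y => u y * inner y).
  apply/funext => y; rewrite /inner -CintZ.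
    by apply: eq_Cint => x; rewrite /F /=; ring.
  apply: (CI_le _ iXW).
    apply: CmeasM => //; apply: Cmeas_e2pi; apply: measurable_dot2.
      exact: measurable_cst.
    exact: measurable_id.
  move=> x; rewrite !cabsM cabs_e2pi cabs_conj mulr1 cabs_real ger0_norm// mulrC.
  by rewrite ler_wpM2r// cabs_cft.
have mi : Cmeas (fun y => u y * inner y).
  have : Cmeas (fun y => Cintegral lebp (fun x => F (x, y))).
    by have [_ _ /CI_meas ? _ _] := Cfubini mF FAB iXW ichi.
  congr Cmeas; apply/funext => y; rewrite /inner -CintZ.
    by apply: eq_Cint => x; rewrite /F /=; ring.
  apply: (CI_le _ iXW).
    apply: CmeasM => //; apply: Cmeas_e2pi; apply: measurable_dot2.
      exact: measurable_cst.
    exact: measurable_id.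
  move=> x; rewrite !cabsM cabs_e2pi cabs_conj mulr1 cabs_real ger0_norm// mulrC.
  by rewrite ler_wpM2r// cabs_cft.
have Gle y : cabs (u y * inner y) <= gconst R ^+ 2 * t ^+ 2 * chi y.
  by rewrite cabsM mulrC ler_pM ?cabs_ge0.
rewrite -RintegralZl//.
exact: Cint_le mi (integrable_scale _ ichi) Gle.
Qed.

End weighted.
End bessel.

Section bessel_ineq.
Context {R : realType}.
Local Notation mR := (measurableTypeR R).
Local Notation lebp := (@lebp R).

(** Plancherel's inequality up to a constant. Dividing [weighted_bessel] by
    [t ^+ 2] and letting [t] tend to zero, the weight tends to one; on a bounded
    box it is already bounded below for small [t]. *)
Lemma bessel (u : mR * mR -> R[i]) (chi : mR * mR -> R) :
  Cmeas u -> (forall s, cabs (u s) <= chi s) -> (forall s, chi s <= 1) ->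
  lebp.-integrable setT (fun s => (chi s)%:E) ->
  (\int[lebp]_x (cabs (cft u x) ^+ 2)%:E <=
    (4 * gconst R ^+ 2 * \int[lebp]_s chi s)%R%:E)%E.
Proof.
move=> mu uchi chi1 ichi; set X := (\int[lebp]_s chi s)%R.
have mc : measurable_fun setT (fun x => (cabs (cft u x) ^+ 2)%:E).
  apply/measurable_EFinP; apply: measurable_funX; apply: measurable_cabs.
  exact: Cmeas_cft ichi.
pose D (n : nat) : set (mR * mR) := [set x | `|x.1| <= n%:R /\ `|x.2| <= n%:R].
have mD n : measurable (D n).
  have -> : D n = (`[- n%:R, n%:R] `*` `[- n%:R, n%:R])%classic.
    by apply/seteqP; split => x; rewrite /D /= !in_itv /= !ler_norml.
  exact: measurableX.
have nD : nondecreasing_seq D.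
  move=> m n mn; apply/subsetPset => x [x1 x2].
  by split; [apply: le_trans x1 _|apply: le_trans x2 _]; rewrite ler_nat.
have DT : \bigcup_n D n = setT.
  apply/seteqP; split => // x _; exists (Num.truncn (Num.max `|x.1| `|x.2|)).+1 => //.
  split; apply: ltW; apply: le_lt_trans (truncnS_gt _); rewrite le_max lexx ?orbT//.
have H : (\int[lebp]_(x in D n) (cabs (cft u x) ^+ 2)%:E)%E @[n --> \oo] -->
    (\int[lebp]_x (cabs (cft u x) ^+ 2)%:E)%E.
  rewrite -DT; apply: ge0_nondecreasing_set_cvg_integral => //.
  - by move=> n; exact: measurable_funTS.
  - by move=> n x _; rewrite lee_fin sqr_ge0.
apply: (cvge_le _ H); apply: nearW => n.
(* small enough for [gfun t] to exceed [t / 2] on the coordinates of [D n] *)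
pose t : R := (16 * n.+1%:R)^-1.
have t0 : 0 < t by rewrite invr_gt0 mulr_gt0.
have [iw bw] := weighted_bessel mu uchi ichi t0 chi1.
have c0 : 0 <= 4 / t ^+ 2 by rewrite divr_ge0 ?sqr_ge0.
have W0 x : 0 <= gfun2 (t, t) x * cabs (cft u x) ^+ 2.
  by rewrite mulr_ge0 ?sqr_ge0// mulr_ge0 ?gfun_ge0.
have mW : measurable_fun setT (fun x => (4 / t ^+ 2 * (gfun2 (t, t) x * cabs (cft u x) ^+ 2))%:E).
  by apply: measurable_int (integrable_scale _ iw).
have gh (y : R) : `|y| <= n%:R -> t / 2 <= gfun t y.
  move=> yn; apply: ghat_ge_half => //.
  have p2 := @pihalf_lt2 R; have p0 := @pi_ge0 R.
  rewrite normrM ger0_norm; last by rewrite mulr_ge0.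
  rewrite /t ler_pdivrMr ?mulr_gt0//.
  have n0 : (0 : R) <= n%:R by [].
  have -> : n.+1%:R = n%:R + 1 :> R by rewrite -natr1.
  have : 2 * pi * `|y| <= 8 * n%:R by apply: ler_pM; rewrite ?mulr_ge0//; lra.
  lra.
apply: (@le_trans _ _ (\int[lebp]_(x in D n) (4 / t ^+ 2 * (gfun2 (t, t) x * cabs (cft u x) ^+ 2))%:E)%E).
  apply: ge0_le_integral => //.
  - by move=> x _; rewrite lee_fin sqr_ge0.
  - exact: measurable_funTS.
  - exact: measurable_funTS.
  - move=> x [x1 x2]; rewrite lee_fin mulrA -[leLHS]mul1r ler_wpM2r ?sqr_ge0//.
    have := ler_pM _ _ (gh _ x1) (gh _ x2); rewrite !divr_ge0 ?(ltW t0)// => /(_ isT isT).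
    rewrite -/(gfun2 (t, t) x) => /(ler_wpM2l c0); apply: le_trans.
    by rewrite le_eqVlt; apply/orP; left; apply/eqP; field; rewrite gt_eqF.
apply: (@le_trans _ _ (\int[lebp]_x (4 / t ^+ 2 * (gfun2 (t, t) x * cabs (cft u x) ^+ 2))%:E)%E).
  apply: ge0_subset_integral => //.
  by move=> x _; rewrite lee_fin mulr_ge0.
have -> : (\int[lebp]_x (4 / t ^+ 2 * (gfun2 (t, t) x * cabs (cft u x) ^+ 2))%:E)%E =
    (4 / t ^+ 2 * \int[lebp]_x (gfun2 (t, t) x * cabs (cft u x) ^+ 2))%:E.
  rewrite -RintegralZl// /Rintegral fineK//.
  by apply: integrable_fin_num => //; exact: integrable_scale.
rewrite lee_fin; apply: le_trans (ler_wpM2l c0 bw) _.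
by rewrite -/X le_eqVlt; apply/orP; left; apply/eqP; field; rewrite gt_eqF.
Qed.

End bessel_ineq.

(** * Wave packets and their rectangle projections *)

Section wave.
Context {R : realType}.
Local Notation mR := (measurableTypeR R).
Local Notation leb3 := (@leb3 R).

(** A sum of wave packets, one for each frequency [p], with the phase that puts the
    frequency at the point of the hyperbolic paraboloid above [p]. Its Fourier
    transform is a sum of tents with half-widths [r.1], [r.2], [r3]. *)
Definition wave (P : seq (R * R)) (r : R * R) (r3 : R) (x : R * R * R) : R[i] :=
  \sum_(p <- P) e2pi (dot2 p x.1 + p.1 * p.2 * x.2) * (gfun2 r x.1 * gfun r3 x.2)%:C%C.

Variables (P : seq (R * R)) (r : R * R) (r3 : R).
Hypotheses (r1_gt0 : 0 < r.1) (r2_gt0 : 0 < r.2) (r3_gt0 : 0 < r3).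

Lemma gfun2_ge0 x : 0 <= gfun2 r x.
Proof. by rewrite mulr_ge0 ?gfun_ge0. Qed.

Lemma waveE p (x : R * R * R) (xi : R * R * R) :
  e2pi (dot2 p x.1 + p.1 * p.2 * x.2) * (gfun2 r x.1 * gfun r3 x.2)%:C%C *
    expi (- (2 * pi * dot3 x xi)) =
  ((gfun2 r x.1)%:C%C * e2pi (dot2 (p - xi.1) x.1)) *
  ((gfun r3 x.2)%:C%C * e2pi ((p.1 * p.2 - xi.2) * x.2)).
Proof.
have -> : expi (- (2 * pi * dot3 x xi)) = e2pi (- dot3 x xi) by rewrite /e2pi mulrN.
have : e2pi (dot2 p x.1 + p.1 * p.2 * x.2) * e2pi (- dot3 x xi) =
    e2pi (dot2 (p - xi.1) x.1) * e2pi ((p.1 * p.2 - xi.2) * x.2).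
  by rewrite -!e2piD; congr e2pi; rewrite /dot3 /dot2 /=; ring.
move=> H; rewrite mulrAC H rmorphM /=; ring.
Qed.

Let term p xi (x : mR * mR * mR) : R[i] :=
  ((gfun2 r x.1)%:C%C * e2pi (dot2 (p - xi.1) x.1)) *
  ((gfun r3 x.2)%:C%C * e2pi ((p.1 * p.2 - xi.2) * x.2)).

Let CI_term p (xi : R * R * R) : Cintegrable leb3 (term p xi).
Proof.
exact: (Ctensor (CI_gfun2 (p - xi.1) r1_gt0 r2_gt0) (CI_gfun (p.1 * p.2 - xi.2) r3_gt0)).1.
Qed.

Lemma CI_wave : Cintegrable leb3 (wave P r r3).
Proof.
apply: CI_sum => p _; have := CI_term p 0.
congr Cintegrable; apply/funext => x; rewrite /term -waveE.
have -> : dot3 x 0 = 0 by rewrite /dot3 /dot2 /= !mulr0 !addr0.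
by rewrite mulr0 oppr0 expi0 mulr1.
Qed.

Lemma fourier_wave xi : fourier3 (wave P r r3) xi =
  \sum_(p <- P) (gconst R ^+ 2 * tent2 r (0, 0) (p - xi.1))%:C%C *
    (gconst R * tent r3 0 (p.1 * p.2 - xi.2))%:C%C.
Proof.
rewrite /fourier3.
transitivity (Cintegral leb3 (fun x => \sum_(p <- P) term p xi x)).
  apply: eq_Cint => x; rewrite /wave mulr_suml; apply: eq_bigr => p _.
  exact: waveE.
rewrite Cint_sum; last by move=> p _; exact: CI_term.
apply: eq_bigr => p _.
have := (Ctensor (CI_gfun2 (p - xi.1) r1_gt0 r2_gt0) (CI_gfun (p.1 * p.2 - xi.2) r3_gt0)).2.
by rewrite Cint_gfun2// Cint_gfun.
Qed.

Lemma fourier_wave_out xi :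
  (forall p, p \in P -> [\/ r.1 <= `|xi.1.1 - p.1|, r.2 <= `|xi.1.2 - p.2| |
    r3 <= `|xi.2 - p.1 * p.2|]) ->
  fourier3 (wave P r r3) xi = 0.
Proof.
move=> h; rewrite fourier_wave big_seq big1// => p /h[h1|h1|h1].
- by rewrite /tent2 /= tent_out ?subr0 1?distrC// mul0r mulr0 mul0r.
- by rewrite /tent2 /= [tent r.2 _ _]tent_out ?subr0 1?distrC// mulr0 mulr0 mul0r.
- by rewrite [tent r3 _ _]tent_out ?subr0 1?distrC// !mulr0.
Qed.

(** Each tent lives in a closed box around a point of the surface, and the
    half-diagonal of that box is less than [delta]. *)
Lemma support_wave (phi := @hyperbolic R) (delta : R) :
  (forall p, p \in P -> 0 <= p.1 <= 1 /\ 0 <= p.2 <= 1) ->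
  r.1 ^+ 2 + r.2 ^+ 2 + r3 ^+ 2 < delta ^+ 2 -> 0 < delta ->
  support_of (fourier3 (wave P r r3)) `<=` neighborhood delta (graph01 phi).
Proof.
move=> P01 rd d0.
pose C p : set (R * R * R) := [set x | [/\ `|x.1.1 - p.1| <= r.1,
   `|x.1.2 - p.2| <= r.2 & `|x.2 - p.1 * p.2| <= r3]].
have cC p : closed (C p).
  have cl (g : R * R * R -> R) c rr : continuous g ->
      closed [set x | `|g x - c| <= rr].
    move=> cg; apply: (@closed_comp _ _ (fun x => `|g x - c|) [set y | y <= rr]).
      move=> x _; apply: cvg_norm; apply: cvgB; [exact: cg|exact: cvg_cst].
    exact: closed_le.
  have -> : C p = [set x | `|x.1.1 - p.1| <= r.1] `&` [set x | `|x.1.2 - p.2| <= r.2]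
      `&` [set x | `|x.2 - p.1 * p.2| <= r3].
    by apply/seteqP; split => [x [? ? ?]|x [[? ?] ?]].
  apply: closedI; first apply: closedI; apply: cl => x.
  - by apply: cvg_comp; exact: cvg_fst.
  - by apply: cvg_comp; [exact: cvg_fst|exact: cvg_snd].
  - exact: cvg_snd.
have cU : closed (\bigcup_(p in [set` P]) C p).
  by apply: closed_bigcup => [|p _]; [exact: finite_seq|exact: cC].
apply: (@subset_trans _ (\bigcup_(p in [set` P]) C p)).
  rewrite /support_of [X in _ `<=` X]((closure_id _).1 cU); apply: closure_subset.
  move=> xi /= /eqP xi0; apply: contrapT => nU; apply: xi0.
  apply: fourier_wave_out => p pP; have [h1|h1] := leP r.1 `|xi.1.1 - p.1|; first exact: Or31.
  have [h2|h2] := leP r.2 `|xi.1.2 - p.2|; first exact: Or32.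
  have [h3|h3] := leP r3 `|xi.2 - p.1 * p.2|; first exact: Or33.
  by exfalso; apply: nU; exists p => //; split; exact: ltW.
move=> x [p /= pP [x1 x2 x3]]; exists (p, phi p).
  by exists p => //; exact: P01.
rewrite -(ger0_norm (ltW d0)) -sqrtr_sqr ltr_sqrt ?exprn_gt0//.
apply: le_lt_trans rd; rewrite /dot3 /dot2 /= -!expr2.
have sq (a b : R) : `|a| <= b -> a ^+ 2 <= b ^+ 2.
  by move=> ab; rewrite -(real_normK (num_real a)) lerXn2r ?nnegrE ?(le_trans _ ab).
by rewrite !lerD ?sq.
Qed.

End wave.

Section projection.
Context {R : realType}.
Local Notation leb := (@lebesgue_measure R).
Local Notation mR := (measurableTypeR R).
Local Notation lebp := (@lebp R).
Local Notation leb3 := (@leb3 R).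

Variables (P : seq (R * R)) (r : R * R) (r3 : R).
Hypotheses (r1_gt0 : 0 < r.1) (r2_gt0 : 0 < r.2) (r3_gt0 : 0 < r3).
Variable Xi : mR * mR -> R[i].
Hypothesis iXi : Cintegrable lebp Xi.

Lemma Rint_gfun (t : R) : 0 < t -> \int[leb]_x gfun t x = gconst R.
Proof.
move=> t0; have := @gfun_cos R t 0 0 t0; rewrite cos0 mul1r.
rewrite /tent subr0 normr0 mul0r subr0 max_r// mulr1 => <-.
by apply: eq_Rintegral => x _; rewrite mulr0 mul0r addr0 cos0 mulr1.
Qed.

Lemma measurable_opp2 : measurable_fun setT (fun s : mR * mR => - s : mR * mR).
Proof.
apply/measurable_fun_pairP; split => /=.
- apply: (measurableT_comp (f := -%R : mR -> mR)); last exact: measurable_fst.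
  exact: oppr_measurable.
- apply: (measurableT_comp (f := -%R : mR -> mR)); last exact: measurable_snd.
  exact: oppr_measurable.
Qed.

Lemma fourier2E s : fourier2 Xi s = cft Xi (- s).
Proof.
apply: eq_Cint => y; rewrite /e2pi; congr (_ * expi _).
by rewrite /dot2 /=; ring.
Qed.

Lemma Cmeas_fourier2 : Cmeas (fun s : mR * mR => fourier2 Xi s).
Proof.
have -> : (fun s => fourier2 Xi s) = (fun s => cft Xi (- s)).
  by apply/funext => s; exact: fourier2E.
apply: Cmeas_comp measurable_opp2.
exact: Cmeas_cft (CI_meas iXi) (fun s => lexx _) (CI_cabs iXi).
Qed.

Definition piece (p s : R * R) : R[i] := (tent2 r p s)%:C%C * fourier2 Xi s.

Lemma integrable_tent2 (p : R * R) :
  lebp.-integrable setT (fun s => (tent2 r p s)%:E).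
Proof. exact: (integrable_tensor (integrable_tent p.1 r1_gt0) (integrable_tent p.2 r2_gt0)). Qed.

Lemma measurable_tent2 (p : R * R) : measurable_fun (setT : set (mR * mR)) (tent2 r p).
Proof. by apply/measurable_EFinP; exact: measurable_int (integrable_tent2 p). Qed.

Lemma Cmeas_piece p : Cmeas (piece p : mR * mR -> R[i]).
Proof.
apply: CmeasM; last exact: Cmeas_fourier2.
by apply: Cmeas_real; exact: measurable_tent2.
Qed.

(** Convolution with [Xi] multiplies the tent around [p] by the Fourier transform
    of [Xi]. *)
Lemma proj_packet p (x : R * R) :
  Cintegral lebp (fun y => e2pi (dot2 p (x - y)) * (gfun2 r (x - y))%:C%C * Xi y) =
  cft (piece p) x.
Proof.
pose F (z : (mR * mR) * (mR * mR)) : R[i] :=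
  Xi z.1 * ((tent2 r p z.2)%:C%C * e2pi (dot2 z.2 (x - z.1))).
have mF : Cmeas F.
  apply: CmeasM; first exact: Cmeas_comp (CI_meas iXi) measurable_fst.
  apply: CmeasM.
    by apply: Cmeas_real; exact: (measurableT_comp (measurable_tent2 p) measurable_snd).
  apply: Cmeas_e2pi.
  have -> : (fun z : (mR * mR) * (mR * mR) => dot2 z.2 (x - z.1)) =
      (fun z => dot2 z.2 x - dot2 z.2 z.1).
    by apply/funext => z; rewrite /dot2 /=; ring.
  apply: measurable_funB.
    by apply: measurable_dot2; [exact: measurable_snd|exact: measurable_cst].
  by apply: measurable_dot2; [exact: measurable_snd|exact: measurable_fst].
have FAB z : cabs (F z) <= cabs (Xi z.1) * tent2 r p z.2.
  by rewrite !cabsM cabs_e2pi mulr1 cabs_real ger0_norm ?tent2_ge0.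
have [_ _ _ h1 h2] := Cfubini mF FAB (CI_cabs iXi) (integrable_tent2 p).
transitivity (Cintegral lebp (fun y => Cintegral lebp (fun s => F (y, s)))).
  apply: eq_Cint => y; rewrite /F /= CintZ; last exact: CI_tent2.
  by rewrite Cint_tent2// mulrC.
rewrite h1 -h2; apply: eq_Cint => s.
transitivity (Cintegral lebp (fun y => (tent2 r p s)%:C%C * e2pi (dot2 s x) *
   (Xi y * expi (- (2 * pi * dot2 y s))))).
  apply: eq_Cint => y; rewrite /F /=.
  have -> : dot2 s (x - y) = dot2 s x + - dot2 y s by rewrite /dot2 /=; ring.
  have -> : expi (- (2 * pi * dot2 y s)) = e2pi (- dot2 y s) by rewrite /e2pi mulrN.
  by rewrite e2piD; ring.
rewrite CintZ; first by rewrite -/(fourier2 Xi s) /piece; ring.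
have := @CI_cft R Xi _ (CI_meas iXi) (fun s => lexx _) (CI_cabs iXi) (- s).
congr Cintegrable; apply/funext => y; rewrite /e2pi; congr (_ * expi _).
by rewrite /dot2 /=; ring.
Qed.

Lemma CI_packet p (x : R * R) :
  Cintegrable lebp (fun y => e2pi (dot2 p (x - y)) * (gfun2 r (x - y))%:C%C * Xi y).
Proof.
have m1 : measurable_fun setT (fun y : mR * mR => (x - y).1 : mR).
  by apply: measurable_funB => //; exact: measurable_fst.
have m2 : measurable_fun setT (fun y : mR * mR => (x - y).2 : mR).
  by apply: measurable_funB => //; exact: measurable_snd.
apply: (CI_bdM (B := r.1 * r.2)) => //.
- apply: CmeasM.
    apply: Cmeas_e2pi; rewrite /dot2.
    by apply: measurable_funD; apply: measurable_funM.
  apply: Cmeas_real; apply: measurable_funM.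
  + exact: (measurableT_comp (measurable_gfun r1_gt0) m1).
  + exact: (measurableT_comp (measurable_gfun r2_gt0) m2).
- move=> y; rewrite cabsM cabs_e2pi mul1r cabs_real ger0_norm ?gfun2_ge0//.
  by apply: ler_pM; rewrite ?gfun_ge0 ?gfun_le.
Qed.

Lemma rect_proj_wave (x : R * R * R) : rect_proj Xi (wave P r r3) x =
  (gfun r3 x.2)%:C%C * \sum_(p <- P) e2pi (p.1 * p.2 * x.2) * cft (piece p) x.1.
Proof.
rewrite /rect_proj.
transitivity (Cintegral lebp (fun y => \sum_(p <- P)
   ((gfun r3 x.2)%:C%C * e2pi (p.1 * p.2 * x.2)) *
   (e2pi (dot2 p (x.1 - y)) * (gfun2 r (x.1 - y))%:C%C * Xi y))).
  apply: eq_Cint => y; rewrite /wave mulr_suml; apply: eq_bigr => p _ /=.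
  by rewrite e2piD rmorphM /=; ring.
rewrite Cint_sum; last by move=> p _; apply: CIZ; exact: CI_packet.
rewrite mulr_sumr; apply: eq_bigr => p _.
by rewrite CintZ ?proj_packet ?mulrA//; exact: CI_packet.
Qed.

(** The frequency profile of the projected wave at height [t]: by [cft_slice], the
    projection is [gfun r3 t] times the inverse transform of the profile. *)
Definition slice (t : R) (s : R * R) : R[i] :=
  \sum_(p <- P) e2pi (p.1 * p.2 * t) * piece p s.

Hypothesis Xi1 : forall s, cabs (fourier2 Xi s) <= 1.

Lemma cft_slice t (x : R * R) :
  cft (slice t) x = \sum_(p <- P) e2pi (p.1 * p.2 * t) * cft (piece p) x.
Proof.
have ci p : Cintegrable lebp (fun s => piece p s * e2pi (dot2 s x)).
  apply: (CI_cft (chi := tent2 r p)).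
  - exact: Cmeas_piece.
  - move=> s; rewrite cabsM cabs_real ger0_norm ?tent2_ge0// -[leRHS]mulr1.
    by rewrite ler_wpM2l ?tent2_ge0.
  - exact: integrable_tent2.
rewrite /cft -(eq_bigr _ (fun p _ => CintZ _ (ci p))) -Cint_sum.
  by apply: eq_Cint => s; rewrite /slice mulr_suml; apply: eq_bigr => p _; rewrite mulrA.
by move=> p _; exact: CIZ.
Qed.

Lemma Cmeas_slice t : Cmeas (slice t : mR * mR -> R[i]).
Proof.
apply: Cmeas_sum => p _; apply: CmeasM; [exact: Cmeas_cst|exact: Cmeas_piece].
Qed.

Lemma Cmeas_rect_proj : Cmeas (rect_proj Xi (wave P r r3) : mR * mR * mR -> R[i]).
Proof.
have -> : rect_proj Xi (wave P r r3) = fun x : mR * mR * mR =>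
    (gfun r3 x.2)%:C%C * \sum_(p <- P) e2pi (p.1 * p.2 * x.2) * cft (piece p) x.1.
  by apply/funext => x; exact: rect_proj_wave.
apply: CmeasM.
  apply: Cmeas_real.
  exact: (measurableT_comp (measurable_gfun r3_gt0) measurable_snd).
apply: Cmeas_sum => p _; apply: CmeasM.
  by apply: Cmeas_e2pi; apply: measurable_funM => //; exact: measurable_snd.
apply: (Cmeas_comp _ measurable_fst).
apply: (Cmeas_cft (chi := tent2 r p)).
- exact: Cmeas_piece.
- move=> s; rewrite cabsM cabs_real ger0_norm ?tent2_ge0// -[leRHS]mulr1.
  by rewrite ler_wpM2l ?tent2_ge0.
- exact: integrable_tent2.
Qed.

(** Two of the four factors are estimated by the supremum of the inverse
    transform of the slice, the other two by [bessel]. *)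
Lemma rect_proj_L4 (chi : mR * mR -> R) :
  (forall t s, cabs (slice t s) <= chi s) -> (forall s, chi s <= 1) ->
  lebp.-integrable setT (fun s => (chi s)%:E) ->
  (\int[leb3]_x (cabs (rect_proj Xi (wave P r r3) x) ^+ 4)%:E <=
   (4 * gconst R ^+ 3 * (r3 * \int[lebp]_s chi s) ^+ 3)%R%:E)%E.
Proof.
move=> uchi chi1 ichi; set X := (\int[lebp]_s chi s)%R.
have chi0 s : 0 <= chi s := le_trans (cabs_ge0 _) (uchi 0 s).
have X0 : 0 <= X by exact: Rintegral_ge0.
have g0 := @gconst_ge0 R.
pose H (x : mR * mR * mR) : R := cabs (rect_proj Xi (wave P r r3) x).
have HE x : H x = gfun r3 x.2 * cabs (cft (slice x.2) x.1).
  by rewrite /H rect_proj_wave cabsM cabs_real ger0_norm ?gfun_ge0// cft_slice.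
have mH : measurable_fun setT H by apply: measurable_cabs; exact: Cmeas_rect_proj.
have mH4 : measurable_fun setT (fun x => (H x ^+ 4)%:E).
  by apply/measurable_EFinP; exact: measurable_funX.
have -> : (\int[leb3]_x (H x ^+ 4)%:E = \int[leb]_t \int[lebp]_x (H (x, t) ^+ 4)%:E)%E.
  by apply: (fubini_tonelli2 (m1 := lebp) (m2 := leb)) => // x; rewrite lee_fin exprn_ge0 ?cabs_ge0.
pose c : R := r3 ^+ 3 * X ^+ 2 * (4 * gconst R ^+ 2 * X).
have c0 : 0 <= c by rewrite !mulr_ge0 ?exprn_ge0// ltW.
apply: (@le_trans _ _ (\int[leb]_t (c * gfun r3 t)%:E)%E); last first.
  under eq_integral do rewrite EFinM.
  rewrite ge0_integralZl_EFin//; last 2 first.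
  - by move=> x _; rewrite lee_fin gfun_ge0.
  - by apply/measurable_EFinP; exact: measurable_gfun.
  have -> : (\int[leb]_t (gfun r3 t)%:E)%E = (gconst R)%:E.
    rewrite -(Rint_gfun r3_gt0) /Rintegral fineK//.
    by apply: integrable_fin_num => //; exact: integrable_gfun.
  rewrite -EFinM lee_fin /c le_eqVlt; apply/orP; left; apply/eqP; ring.
apply: ge0_le_integral => //.
- by move=> t _; apply: integral_ge0 => x _; rewrite lee_fin exprn_ge0 ?cabs_ge0.
- apply: (measurable_fun_fubini_tonelli_G (m1 := lebp) (fun x => (H x ^+ 4)%:E)) => //.
  by move=> x; rewrite lee_fin exprn_ge0 ?cabs_ge0.
- by apply/measurable_EFinP; apply: measurable_funM => //; exact: measurable_gfun.
move=> t _.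
have b := bessel (Cmeas_slice t) (uchi t) chi1 ichi.
have mc : measurable_fun setT (fun x : mR * mR => cabs (cft (slice t) x) ^+ 2).
  apply: measurable_funX; apply: measurable_cabs.
  exact: (Cmeas_cft (Cmeas_slice t) (uchi t) ichi).
pose e : R := r3 ^+ 3 * X ^+ 2 * gfun r3 t.
have e0 : 0 <= e by rewrite !mulr_ge0 ?exprn_ge0 ?gfun_ge0// ltW.
apply: (@le_trans _ _ (e%:E * \int[lebp]_x (cabs (cft (slice t) x) ^+ 2)%:E)%E); last first.
  apply: le_trans (lee_wpmul2l _ b) _; first by rewrite lee_fin.
  rewrite -EFinM lee_fin -/X /e /c le_eqVlt; apply/orP; left; apply/eqP; ring.
rewrite -ge0_integralZl_EFin//; last 2 first.
- by move=> x _; rewrite lee_fin sqr_ge0.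
- exact/measurable_EFinP.
apply: ge0_le_integral => //.
- by move=> x _; rewrite lee_fin exprn_ge0 ?cabs_ge0.
- by apply: (@measurable_fun_pair1 _ _ _ _ _ _ (fun x => (H x ^+ 4)%:E) t).
- apply/measurable_EFinP; exact: measurable_funM.
move=> x _; rewrite -EFinM lee_fin HE /=.
have gl := gfun_le t r3_gt0; have gg := gfun_ge0 t r3_gt0.
have cl := cabs_cft (Cmeas_slice t) (uchi t) ichi x; rewrite -/X in cl.
have cg := cabs_ge0 (cft (slice t) x).
set g := gfun r3 t in gl gg *; set C := cabs _ in cl cg *.
have g3 : g ^+ 3 <= r3 ^+ 3 by rewrite lerXn2r ?nnegrE// ltW.
have C2 : C ^+ 2 <= X ^+ 2 by rewrite lerXn2r ?nnegrE.
(* one factor [g] is kept for the integration in the height *)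
have -> : (g * C) ^+ 4 = g ^+ 3 * C ^+ 2 * g * C ^+ 2 by ring.
rewrite /e -/g; apply: ler_wpM2r; first exact: sqr_ge0.
apply: ler_wpM2r => //; apply: ler_pM => //; rewrite ?exprn_ge0//.
Qed.

End projection.

(** * Constructive interference of wave packets over a box *)

Section dual_region.
Context {R : realType}.
Local Notation leb := (@lebesgue_measure R).
Local Notation mR := (measurableTypeR R).
Local Notation lebp := (@lebp R).
Local Notation leb3 := (@leb3 R).

Lemma leb_itvcc (u v : R) : u <= v -> leb `[u, v]%classic = (v - u)%:E.
Proof.
move=> uv; rewrite lebesgue_measure_itv /= lte_fin.
by move: uv; rewrite le_eqVlt => /predU1P[->|->]; rewrite ?ltxx ?subrr.
Qed.

Lemma measurable_absle d (T : measurableType d) (f : T -> R) (c : R) :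
  measurable_fun setT f -> measurable [set x | `|f x| <= c].
Proof.
move=> mf; rewrite (_ : [set x | _] = f @^-1` `[- c, c]%classic).
  by rewrite -[X in measurable X]setTI; apply: mf.
by apply/seteqP; split => x /=; rewrite in_itv /= ler_norml.
Qed.

Variables (q : R * R) (a b k : R).
Hypotheses (a0 : 0 < a) (b0 : 0 < b) (k0 : 0 < k).

(** The region dual to the piece of the surface above the box at [q] with sides
    [a], [b], in coordinates adapted to the tangent plane at [q]. *)
Definition dual_region : set (mR * mR * mR) :=
  [set x | `|x.1.1 + q.2 * x.2| <= k / a] `&` [set x | `|x.1.2 + q.1 * x.2| <= k / b]
   `&` [set x | `|x.2| <= k / (a * b)].

Lemma measurable_dual_region : measurable dual_region.
Proof.
have m1 : measurable_fun setT (fun x : mR * mR * mR => x.1.1).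
  by apply: measurableT_comp measurable_fst; exact: measurable_fst.
have m2 : measurable_fun setT (fun x : mR * mR * mR => x.1.2).
  by apply: measurableT_comp measurable_fst; exact: measurable_snd.
have m3 : measurable_fun setT (fun x : mR * mR * mR => x.2).
  exact: measurable_snd.
apply: measurableI; first apply: measurableI.
- by apply: measurable_absle; apply: measurable_funD => //; exact: measurable_funM.
- by apply: measurable_absle; apply: measurable_funD => //; exact: measurable_funM.
- exact: measurable_absle.
Qed.

Lemma dual_region_measure : leb3 dual_region = (8 * k ^+ 3 / (a * b) ^+ 2)%:E.
Proof.
have ab0 : 0 < a * b by rewrite mulr_gt0.
have mB := measurable_dual_region.
rewrite -[LHS]mul1e -integral_cst// integral_mkcond.
pose J : set mR := `[- (k / (a * b)), k / (a * b)]%classic.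
have mJ : measurable J by exact: measurable_itv.
have -> : ((fun=> 1%E) \_ dual_region) = (fun x => (\1_dual_region x)%:E) :> (mR * mR * mR -> \bar R).
  by apply/funext => x; rewrite /patch indicE; case: ifP.
transitivity (\int[leb]_t \int[lebp]_x (\1_dual_region (x, t))%:E)%E.
  apply: (fubini_tonelli2 (m1 := lebp) (m2 := leb)) => //.
  by apply/measurable_EFinP; exact: measurable_indic.
transitivity (\int[leb]_t ((4 * k ^+ 2 / (a * b))%:E * (\1_J t)%:E))%E; last first.
  rewrite ge0_integralZl_EFin//; last 2 first.
  - by apply/measurable_EFinP; exact: measurable_indic.
  - by rewrite divr_ge0 ?mulr_ge0 ?exprn_ge0 ?(ltW k0) ?(ltW a0) ?(ltW b0).
  have lJ : leb J = (k / (a * b) - - (k / (a * b)))%:E.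
    by rewrite leb_itvcc// ge0_cp// divr_ge0 ?ltW.
  rewrite integral_indic// setIT -[X in (_ * X)%E]/(leb J) lJ.
  by rewrite -EFinM; congr EFin; field; rewrite !gt_eqF.
apply: eq_integral => t _.
pose I1 : set mR := `[- (k / a) - q.2 * t, k / a - q.2 * t]%classic.
pose I2 : set mR := `[- (k / b) - q.1 * t, k / b - q.1 * t]%classic.
have mI1 : measurable I1 by exact: measurable_itv.
have mI2 : measurable I2 by exact: measurable_itv.
transitivity (\int[lebp]_x ((\1_J t)%:E * (\1_(I1 `*` I2) x)%:E))%E.
  apply: eq_integral => x _; rewrite -EFinM !indicE -natrM mulnb; congr (nat_of_bool _)%:R%:E.
  apply/idP/andP => [/set_mem [[/= h1 h2] h3]|[/set_mem h3 /set_mem [h1 h2]]].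
    split; apply/mem_set; first by rewrite /J /= in_itv /= -ler_norml.
    by split; rewrite /I1 /I2 /= in_itv /=; move: h1 h2; rewrite !ler_norml; lra.
  apply/mem_set; move: h1 h2 h3; rewrite /I1 /I2 /J /= !in_itv /= -ler_norml => h1 h2 h3.
  by split => //; split => /=; rewrite ler_norml; lra.
rewrite ge0_integralZl_EFin//; last first.
  by apply/measurable_EFinP; apply: measurable_indic; exact: measurableX.
rewrite integral_indic ?setIT; last exact: measurableX.
rewrite muleC; congr (_ * _)%E.
transitivity (leb I1 * leb I2)%E; first exact: product_measure1E.
have -> : leb I1 = (k / a - q.2 * t - (- (k / a) - q.2 * t))%:E.
  by rewrite leb_itvcc// lerD2r ge0_cp// divr_ge0 ?ltW.
have -> : leb I2 = (k / b - q.1 * t - (- (k / b) - q.1 * t))%:E.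
  by rewrite leb_itvcc// lerD2r ge0_cp// divr_ge0 ?ltW.
by rewrite -EFinM; congr EFin; field; rewrite !gt_eqF.
all: exact: measurableT.
Qed.

End dual_region.

Section lower.
Context {R : realType}.
Local Notation mR := (measurableTypeR R).
Local Notation lebp := (@lebp R).
Local Notation leb3 := (@leb3 R).
Variables (q : R * R) (a b : R).
Hypotheses (a0 : 0 < a) (b0 : 0 < b).
(* with this constant all the phases stay within a sixteenth of a period *)
Local Notation dual := (dual_region q a b 48^-1).
Hypotheses (a1 : a <= 1) (b1 : b <= 1) (q1 : 0 <= q.1 <= 1) (q2 : 0 <= q.2 <= 1).
Variables (P : seq (R * R)) (r : R * R) (r3 : R).
Hypotheses (r1_gt0 : 0 < r.1) (r2_gt0 : 0 < r.2) (r3_gt0 : 0 < r3).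
Hypotheses (r1ab : r.1 <= a * b) (r2ab : r.2 <= a * b) (r3ab : r3 <= a * b).
Hypothesis PQ : forall p, p \in P ->
  q.1 <= p.1 <= q.1 + a /\ q.2 <= p.2 <= q.2 + b.

Let pi4 : 2 * pi <= 8 :> R.
Proof. have := @pihalf_lt2 R; lra. Qed.

Let gfun_half (t y : R) : 0 < t -> 16 * `|y| * t <= 1 -> t / 2 <= gfun t y.
Proof.
move=> t0 yt; apply: ghat_ge_half => //; rewrite normrM ger0_norm ?mulr_ge0 ?pi_ge0//.
have : 2 * pi * (`|y| * t) <= 8 * (`|y| * t) by rewrite ler_wpM2r// mulr_ge0// ltW.
rewrite -mulrA; lra.
Qed.

(** The phases of the packets differ on the dual region by less than a sixteenth of a
    period from that of the corner [q], so their sum suffers no cancellation. *)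
Lemma wave_lower_pt x : dual x ->
  (size P)%:R * (r.1 * r.2 * r3 / 16) <= cabs (wave P r r3 x).
Proof.
move=> [[x1 x2] x3].
have ab0 : 0 < a * b by rewrite mulr_gt0.
rewrite /= in x1 x2 x3.
have ab1 : a * b <= a by rewrite ler_piMr// ltW.
have ab2 : a * b <= b by rewrite ler_piMl// ltW.
have ks c : 0 < c -> a * b <= c -> 48^-1 / c <= 48^-1 / (a * b).
  by move=> c0 abc; rewrite ler_wpM2l ?invr_ge0// lef_pV2.
have big y qq c : 0 < c -> a * b <= c -> 0 <= qq <= 1 -> `|y + qq * x.2| <= 48^-1 / c ->
    `|y| <= 24^-1 / (a * b).
  move=> c0 abc /andP[qq0 qq1] h.
  have h' := le_trans h (ks c c0 abc).
  have : `|qq * x.2| <= 48^-1 / (a * b).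
    rewrite normrM ger0_norm//; apply: le_trans x3.
    by rewrite -[leRHS]mul1r ler_wpM2r.
  move=> h2; have -> : y = (y + qq * x.2) - qq * x.2 by ring.
  apply: le_trans (ler_normB _ _) _; apply: le_trans (lerD h' h2) _.
  by rewrite -mulrDl ler_wpM2r ?invr_ge0 ?(ltW ab0)//; lra.
have sm y t : 0 < t -> t <= a * b -> `|y| <= 24^-1 / (a * b) -> 16 * `|y| * t <= 1.
  move=> t0 tab yb; have : `|y| * t <= 24^-1 / (a * b) * (a * b).
    by apply: ler_pM => //; exact: ltW.
  rewrite divfK ?gt_eqF//; rewrite -mulrA; lra.
have g1 : r.1 / 2 <= gfun r.1 x.1.1.
  by apply: gfun_half => //; apply: sm => //; exact: (big _ q.2 a).
have g2 : r.2 / 2 <= gfun r.2 x.1.2.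
  by apply: gfun_half => //; apply: sm => //; exact: (big _ q.1 b).
have g3 : r3 / 2 <= gfun r3 x.2.
  apply: gfun_half => //; apply: sm => //; apply: le_trans x3 _.
  by rewrite ler_wpM2r ?invr_ge0 ?(ltW ab0)//; lra.
(* the phase relative to [q]: the first two terms are bounded by the definition of
   the dual region, and the last one because the box has area [a * b] *)
pose ph p := (p.1 - q.1) * (x.1.1 + q.2 * x.2) + (p.2 - q.2) * (x.1.2 + q.1 * x.2)
  + (p.1 - q.1) * (p.2 - q.2) * x.2.
have wE : wave P r r3 x = e2pi (dot2 q x.1 + q.1 * q.2 * x.2) *
    (gfun2 r x.1 * gfun r3 x.2)%:C%C * \sum_(p <- P) e2pi (ph p).
  rewrite mulr_sumr; apply: eq_bigr => p _; rewrite [RHS]mulrAC -e2piD.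
  by congr (e2pi _ * _); rewrite /ph /dot2; ring.
have G0 : 0 <= gfun2 r x.1 * gfun r3 x.2 by rewrite !mulr_ge0 ?gfun_ge0.
rewrite wE !cabsM cabs_e2pi mul1r cabs_real ger0_norm//.
have S : (size P)%:R / 2 <= cabs (\sum_(p <- P) e2pi (ph p)).
  apply: le_trans (cabs_Re _); apply: le_trans (ler_norm _).
  have -> : complex.Re (\sum_(p <- P) e2pi (ph p)) = \sum_(p <- P) cos (2 * pi * ph p).
    elim: P => [|p s ih]; first by rewrite !big_nil.
    by rewrite !big_cons cReD ih.
  rewrite -sum1_size natr_sum mulr_suml big_seq [leRHS]big_seq.
  apply: ler_sum => p pP; rewrite mul1r; apply: cos_ge_half.
  have [p1 p2] := PQ pP.
  have s1 : `|p.1 - q.1| <= a by rewrite ger0_norm; lra.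
  have s2 : `|p.2 - q.2| <= b by rewrite ger0_norm; lra.
  have u1 : `|(p.1 - q.1) * (x.1.1 + q.2 * x.2)| <= 48^-1.
    have -> : 48^-1 = a * (48^-1 / a) by field; rewrite gt_eqF.
    by rewrite normrM; apply: ler_pM.
  have u2 : `|(p.2 - q.2) * (x.1.2 + q.1 * x.2)| <= 48^-1.
    have -> : 48^-1 = b * (48^-1 / b) by field; rewrite gt_eqF.
    by rewrite normrM; apply: ler_pM.
  have u3 : `|(p.1 - q.1) * (p.2 - q.2) * x.2| <= 48^-1.
    have -> : 48^-1 = a * b * (48^-1 / (a * b)) by field; rewrite !gt_eqF.
    by rewrite !normrM; apply: ler_pM => //; exact: ler_pM.
  have ph16 : `|ph p| <= 16^-1.
    rewrite /ph; apply: le_trans (ler_normD _ _) _.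
    apply: le_trans (lerD (ler_normD _ _) (lexx _)) _; lra.
  rewrite normrM ger0_norm ?mulr_ge0 ?pi_ge0//.
  apply: (@le_trans _ _ (8 * 16^-1)); last by lra.
  by apply: ler_pM => //; rewrite mulr_ge0 ?pi_ge0.
have GG : r.1 * r.2 * r3 / 8 <= gfun2 r x.1 * gfun r3 x.2.
  have -> : r.1 * r.2 * r3 / 8 = r.1 / 2 * (r.2 / 2) * (r3 / 2) by field.
  by apply: ler_pM => //; [rewrite !mulr_ge0 ?divr_ge0// ltW|rewrite divr_ge0// ltW|
    apply: ler_pM => //; rewrite divr_ge0// ltW].
have -> : (size P)%:R * (r.1 * r.2 * r3 / 16) = r.1 * r.2 * r3 / 8 * ((size P)%:R / 2) by field.
by apply: ler_pM => //; rewrite ?divr_ge0// !mulr_ge0 ?(ltW r1_gt0) ?(ltW r2_gt0) ?(ltW r3_gt0).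
Qed.

Lemma wave_lower :
  ((8 * 48^-1 ^+ 3 / (a * b) ^+ 2 * ((size P)%:R * (r.1 * r.2 * r3 / 16)) ^+ 4)%R%:E <=
  \int[leb3]_x (cabs (wave P r r3 x) ^+ 4)%:E)%E.
Proof.
set m := ((size P)%:R * (r.1 * r.2 * r3 / 16))%R.
have m0 : 0 <= m by rewrite mulr_ge0 ?divr_ge0 ?mulr_ge0 ?(ltW r1_gt0) ?(ltW r2_gt0) ?(ltW r3_gt0).
have mw : measurable_fun setT (fun x => (cabs (wave P r r3 x) ^+ 4)%:E).
  apply/measurable_EFinP; apply: measurable_funX; apply: measurable_cabs.
  exact: CI_meas (CI_wave _ r1_gt0 r2_gt0 r3_gt0).
apply: (@le_trans _ _ (\int[leb3]_(x in dual) (m ^+ 4)%:E)%E).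
  have k0 : 0 < 48^-1 :> R by rewrite invr_gt0.
  rewrite integral_cst; last exact: measurable_dual_region.
  by rewrite dual_region_measure// -EFinM lee_fin mulrC.
apply: (@le_trans _ _ (\int[leb3]_(x in dual) (cabs (wave P r r3 x) ^+ 4)%:E)%E).
  apply: ge0_le_integral => //.
  - exact: measurable_dual_region.
  - by move=> x _; rewrite lee_fin exprn_ge0.
  - exact: measurable_funTS.
  - move=> x /wave_lower_pt h; rewrite lee_fin lerXn2r ?nnegrE//; exact: cabs_ge0.
apply: ge0_subset_integral => //.
- exact: measurable_dual_region.
- by move=> x _; rewrite lee_fin exprn_ge0// cabs_ge0.
Qed.

End lower.

(** * Area and packing *)

Section area.
Context {R : realType}.
Local Notation leb := (@lebesgue_measure R).
Local Notation mR := (measurableTypeR R).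
Local Notation lebp := (@lebp R).

Definition aff2 (a : R) (v : R * R) : mR * mR -> mR * mR :=
  fun x => (a * x.1 + v.1, a * x.2 + v.2).

Lemma measurable_aff2 a v : measurable_fun setT (aff2 a v).
Proof.
apply/measurable_fun_pairP; split => /=.
- exact: (measurableT_comp (measurable_affine a v.1) measurable_fst).
- exact: (measurableT_comp (measurable_affine a v.2) measurable_snd).
Qed.

Lemma lebpX (B C : set mR) : measurable B -> measurable C ->
  lebp (B `*` C) = (leb B * leb C)%E.
Proof. by move=> mB mC; exact: product_measure1E. Qed.

Lemma lebp_aff2 (a : R) (v : R * R) (A : set (mR * mR)) : 0 < a -> measurable A ->
  lebp A = ((a ^+ 2)%:E * lebp (aff2 a v @^-1` A))%E.
Proof.
move=> a0 mA.
pose m : {measure set (mR * mR) -> \bar R} := mscale (NngNum (sqr_ge0 a))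
  (measure_function_pushforward__canonical__measure_function_Measure lebp (measurable_aff2 a v)).
suff -> : lebp A = m A by [].
apply: (product_measure_unique (m' := m)) => // B C mB mC.
rewrite /m /mscale /= /pushforward.
rewrite -[LHS]/((a ^+ 2)%:E * lebp ((aff a v.1 @^-1` B) `*` (aff a v.2 @^-1` C)))%E.
rewrite lebpX; last 2 first.
- by rewrite -[X in measurable X]setTI; apply: measurable_affine.
- by rewrite -[X in measurable X]setTI; apply: measurable_affine.
by rewrite (leb_affine_set v.1 a0 mB) (leb_affine_set v.2 a0 mC) expr2 EFinM muleACA.
Qed.

Lemma lebp_translate (v : R * R) (A : set (mR * mR)) : measurable A ->
  lebp ((fun x => x + v) @^-1` A) = lebp A.
Proof.
move=> mA; rewrite (lebp_aff2 v ltr01 mA) expr1n mul1e; congr (lebp _).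
by apply/funext => x; rewrite /aff2 /preimage /= !mul1r; case: x.
Qed.

Lemma sum_disjoint (I : choiceType) (s : seq I) (F : I -> set (mR * mR)) (W : set (mR * mR)) :
  uniq s -> (forall i, i \in s -> measurable (F i)) ->
  (forall i j, i \in s -> j \in s -> i != j -> F i `&` F j = set0) ->
  (forall i, i \in s -> F i `<=` W) -> measurable W ->
  (\sum_(i <- s) lebp (F i) <= lebp W)%E.
Proof.
move=> us mF dF FW mW.
have [mU ->] : measurable (\big[setU/set0]_(i <- s) F i) /\
    (\sum_(i <- s) lebp (F i) = lebp (\big[setU/set0]_(i <- s) F i))%E.
  elim: s us mF dF {FW} => [_ _ _|i s ih /= /andP[is_ us] mF dF].
    by rewrite !big_nil measure0.
  have [||m1 e1] := ih us.
  - by move=> j js; apply: mF; rewrite inE js orbT.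
  - by move=> j k js ks; apply: dF; rewrite inE ?js ?ks orbT.
  have mi : measurable (F i) by apply: mF; rewrite inE eqxx.
  rewrite !big_cons; split; first exact: measurableU.
  rewrite e1 measureU//; rewrite -bigcup_seq; apply/seteqP; split => // x [Fix [j /= js Fjx]].
  have ij : i != j by apply: contraNneq is_ => ->.
  have : (F i `&` F j) x by [].
  by rewrite dF ?inE ?eqxx ?js ?orbT.
apply: le_measure; rewrite ?inE//.
by rewrite -bigcup_seq => x [i /= is_ /(FW i is_)].
Qed.

(** The first hypothesis on [T] makes the translates pairwise disjoint, by looking at
    the coordinate along [k]. *)
Lemma packing (T W : set (mR * mR)) (v k : R * R) (n : nat) :
  measurable T -> measurable W ->
  (forall x y, T x -> T y -> `|dot2 (x - y) k| < `|dot2 v k|) ->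
  (forall (j : nat) x, (j < n)%N -> T x -> W (x + j%:R *: v)) ->
  (n%:R%:E * lebp T <= lebp W)%E.
Proof.
move=> mT mW Tk TW.
pose F (j : nat) : set (mR * mR) := (fun x => x + (- (j%:R *: v))) @^-1` T.
have mF j : measurable (F j).
  have : measurable (aff2 1 (- (j%:R *: v)) @^-1` T).
    by rewrite -[X in measurable X]setTI; apply: measurable_aff2.
  congr measurable; apply/funext => x; rewrite /F /aff2 /preimage /= !mul1r.
  by case: x.
apply: le_trans (@sum_disjoint _ (iota 0 n) F W (iota_uniq _ _) _ _ _ mW).
- rewrite (eq_bigr (fun=> lebp T)); last by move=> j _; exact: lebp_translate.
  rewrite big_const_seq count_predT size_iota.
  elim: n {TW} => [|n ih]; first by rewrite mul0e.
  rewrite -nat1r EFinD ge0_muleDl ?lee_fin// mul1e /=.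
  exact: leeD2l.
- by [].
- move=> i j _ _ ij; apply/seteqP; split => // x [Fi Fj].
  have := Tk _ _ Fi Fj.
  have -> : dot2 (x + - (i%:R *: v) - (x + - (j%:R *: v))) k = (j%:R - i%:R) * dot2 v k.
    by rewrite /dot2 /= /GRing.scale /=; ring.
  rewrite normrM -[X in _ < X]mul1r ltNge ler_wpM2r// /=.
  have [ltij|ltji|/eqP] := ltngtP i j; last by rewrite (negbTE ij).
    by rewrite ger0_norm ?subr_ge0 ?ler_nat 1?ltnW// -natrB 1?ltnW// ler1n subn_gt0.
  by rewrite distrC ger0_norm ?subr_ge0 ?ler_nat 1?ltnW// -natrB 1?ltnW// ler1n subn_gt0.
- move=> j; rewrite mem_iota add0n => /andP[_ jn] x Fx.
  by have := TW j _ jn Fx; rewrite addrNK.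
Qed.

End area.

(** * Flat rectangles *)

Section rectangles.
Context {R : realType}.
Local Notation mR := (measurableTypeR R).
Local Notation lebp := (@lebp R).

(** A rectangle with chosen centre, axis and half-sides, so that it can be dilated
    and its sides measured. *)
Record rect_data := RectData { ctr : R * R; dir : R * R; len : R; wid : R }.

Definition valid (t : rect_data) := rectangle_params (dir t) (len t) (wid t).

Definition scaled (r : R) (t : rect_data) : set (mR * mR) :=
  rectangle (ctr t) (dir t) (r * len t) (r * wid t).

(** Half-sides of the bounding box. *)
Definition ext1 t := len t * `|(dir t).1| + wid t * `|(dir t).2|.
Definition ext2 t := len t * `|(dir t).2| + wid t * `|(dir t).1|.

Definition perp (u : R * R) : R * R := (- u.2, u.1).

Lemma measurable_scaled r t : measurable (scaled r t).
Proof.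
rewrite /scaled /rectangle.
have m (u : R * R) : measurable_fun setT (fun x : mR * mR => dot2 (x - ctr t) u).
  have -> : (fun x : mR * mR => dot2 (x - ctr t) u) = (fun x => dot2 x u - dot2 (ctr t) u).
    by apply/funext => x; rewrite /dot2 /=; ring.
  apply: measurable_funB; last exact: measurable_cst.
  by apply: measurable_dot2; [exact: measurable_id|exact: measurable_cst].
rewrite (_ : [set x : R * R | _] = [set x : mR * mR | `|dot2 (x - ctr t) (dir t)| <= r * len t]
  `&` [set x | `|dot2 (x - ctr t) (perp (dir t))| <= r * wid t]) //.
by apply: measurableI; exact: measurable_absle.
Qed.

Lemma lebp_scaled r t : 0 < r ->
  lebp (scaled r t) = ((r ^+ 2)%:E * lebp (scaled 1 t))%E.
Proof.
move=> r0; rewrite (@lebp_aff2 R r ((1 - r) * (ctr t).1, (1 - r) * (ctr t).2))//; last first.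
  exact: measurable_scaled.
congr (_ * lebp _)%E; apply/funext => x; rewrite /scaled /rectangle /aff2 /preimage /= !mul1r.
have E u : dot2 ((r * x.1 + (1 - r) * (ctr t).1, r * x.2 + (1 - r) * (ctr t).2) - ctr t) u =
    r * dot2 (x - ctr t) u by rewrite /dot2 /=; ring.
by rewrite !E !normrM (gtr0_norm r0) !ler_pM2l.
Qed.

(** The same rectangle with its two axes exchanged; the symmetry halves the
    case distinctions. *)
Definition swap_axes t := RectData (ctr t) (perp (dir t)) (wid t) (len t).

Lemma scaled_swap r t : scaled r (swap_axes t) = scaled r t.
Proof.
rewrite /scaled /rectangle; apply/seteqP; split => x /= [h1 h2]; split => //.
- move: h2; rewrite (_ : dot2 _ _ = - dot2 (x - ctr t) (dir t)) ?normrN//.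
  by rewrite /dot2 /=; ring.
- rewrite (_ : dot2 _ _ = - dot2 (x - ctr t) (dir t)) ?normrN//.
  by rewrite /dot2 /=; ring.
Qed.

Lemma valid_swap t : valid t -> valid (swap_axes t).
Proof. by move=> [u1 l0 w0]; split => //=; rewrite -u1 /dot2 /=; ring. Qed.

Lemma ext1_gt0 t : valid t -> 0 < ext1 t.
Proof.
move=> [u1 l0 w0]; rewrite /ext1.
have [z|z] := eqVneq (dir t).1 0.
  rewrite z normr0 mulr0 add0r mulr_gt0// normr_gt0; apply/eqP => z2.
  by move: u1; rewrite /dot2 z z2 !mulr0 addr0 => /eqP; rewrite eq_sym oner_eq0.
by rewrite ltr_pwDl ?mulr_gt0 ?normr_gt0// mulr_ge0// ltW.
Qed.

Lemma ext2_gt0 t : valid t -> 0 < ext2 t.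
Proof.
move=> [u1 l0 w0]; rewrite /ext2.
have [z|z] := eqVneq (dir t).1 0.
  rewrite z normr0 mulr0 addr0 mulr_gt0// normr_gt0; apply/eqP => z2.
  by move: u1; rewrite /dot2 z z2 !mulr0 addr0 => /eqP; rewrite eq_sym oner_eq0.
by rewrite ltr_wpDl ?mulr_ge0 ?(ltW l0)// mulr_gt0// normr_gt0.
Qed.

Lemma scaled_bbox r t x : valid t -> 0 <= r -> scaled r t x ->
  `|x.1 - (ctr t).1| <= r * ext1 t /\ `|x.2 - (ctr t).2| <= r * ext2 t.
Proof.
move=> [u1 l0 w0] r0 [/= h1 h2].
set s := dot2 _ _ in h1; set w := dot2 _ _ in h2.
have e1 : x.1 - (ctr t).1 = s * (dir t).1 - w * (dir t).2.
  transitivity ((x.1 - (ctr t).1) * dot2 (dir t) (dir t)); first by rewrite u1 mulr1.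
  by rewrite /s /w /dot2 /=; ring.
have e2 : x.2 - (ctr t).2 = s * (dir t).2 + w * (dir t).1.
  transitivity ((x.2 - (ctr t).2) * dot2 (dir t) (dir t)); first by rewrite u1 mulr1.
  by rewrite /s /w /dot2 /=; ring.
split.
  rewrite e1 /ext1 mulrDr; apply: le_trans (ler_normB _ _) _.
  by rewrite !normrM !mulrA; apply: lerD; rewrite ler_wpM2r.
rewrite e2 /ext2 mulrDr; apply: le_trans (ler_normD _ _) _.
by rewrite !normrM !mulrA; apply: lerD; rewrite ler_wpM2r.
Qed.

Lemma scaled_mono r s t : valid t -> r <= s -> scaled r t `<=` scaled s t.
Proof.
move=> [u1 l0 w0] rs x [h1 h2].
by split; [apply: le_trans h1 _|apply: le_trans h2 _]; rewrite ler_wpM2r// ltW.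
Qed.

Lemma derive_hyperbolic1 (u : R * R) : 'D_((1, 0) : R * R) (@hyperbolic R) u = u.2.
Proof.
rewrite /derive; apply: cvg_lim => //; apply: cvg_near_cst.
near=> h; have h0 : h != 0 by near: h; exact: nbhs_dnbhs_neq.
by rewrite /hyperbolic /= /GRing.scale /=; field.
Unshelve. all: by end_near. Qed.

Lemma derive_hyperbolic2 (u : R * R) : 'D_((0, 1) : R * R) (@hyperbolic R) u = u.1.
Proof.
rewrite /derive; apply: cvg_lim => //; apply: cvg_near_cst.
near=> h; have h0 : h != 0 by near: h; exact: nbhs_dnbhs_neq.
by rewrite /hyperbolic /= /GRing.scale /=; field.
Unshelve. all: by end_near. Qed.

(** For the hyperbolic paraboloid, the error of the tangent plane is the product of
    the coordinate differences. *)
Lemma flat_hyperbolic (d : R) (S : set (R * R)) (u v : R * R) : flat (@hyperbolic R) d S ->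
  S u -> S v -> `|u.1 - v.1| * `|u.2 - v.2| <= d.
Proof.
move=> fl Su Sv; rewrite -lee_fin; apply: le_trans fl; apply: ereal_sup_ubound.
exists u => //; exists v => //; congr (_%:E).
rewrite /grad derive_hyperbolic1 derive_hyperbolic2 -normrM -normrN; congr (`| _ |).
by rewrite /hyperbolic /dot2 /=; ring.
Qed.

Lemma scaled_point (t : rect_data) r s w : valid t -> `|s| <= r * len t -> `|w| <= r * wid t ->
  scaled r t ((ctr t).1 + s * (dir t).1 - w * (dir t).2, (ctr t).2 + s * (dir t).2 + w * (dir t).1).
Proof.
move=> [u1 l0 w0] hs hw; split.
  rewrite (_ : dot2 _ _ = s * dot2 (dir t) (dir t)); first by rewrite u1 mulr1.
  by rewrite /dot2 /=; ring.
rewrite (_ : dot2 _ _ = w * dot2 (dir t) (dir t)); first by rewrite u1 mulr1.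
by rewrite /dot2 /=; ring.
Qed.

(** The bounding box of a flat rectangle has area at most of the order of [d]. Testing
    flatness on pairs of opposite points, at the ends of the axes and at the
    corners, bounds the square of each half-side times [`|x * y|], and the product of
    the half-sides times [`|x ^+ 2 - y ^+ 2|], where [(x, y)] is the unit axis; these
    two quantities cannot both be small. *)
Lemma ext_flat (d : R) (t : rect_data) : valid t -> flat (@hyperbolic R) d (scaled 1 t) ->
  ext1 t * ext2 t <= 5 / 4 * d.
Proof.
move=> vt fl; have [u1 l0 w0] := vt.
have D s w : `|s| <= len t -> `|w| <= wid t ->
    4 * `|(s * (dir t).1 - w * (dir t).2) * (s * (dir t).2 + w * (dir t).1)| <= d.
  move=> hs hw; have p1 := @scaled_point t 1 s w vt; have p2 := @scaled_point t 1 (- s) (- w) vt.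
  rewrite !mul1r in p1 p2; rewrite !normrN in p2.
  have := flat_hyperbolic fl (p1 hs hw) (p2 hs hw).
  rewrite /= -normrM; congr (_ <= _); rewrite -[4]ger0_norm// -normrM; congr (`|_|); ring.
have a1 := D (len t) 0; have a2 := D 0 (wid t).
have a3 := D (len t) (wid t); have a4 := D (len t) (- wid t).
rewrite normrN normr0 (gtr0_norm l0) (gtr0_norm w0) in a1 a2 a3 a4.
have {}a1 := a1 (lexx _) (ltW w0); have {}a2 := a2 (ltW l0) (lexx _).
have {}a3 := a3 (lexx _) (lexx _); have {}a4 := a4 (lexx _) (lexx _).
rewrite !mul0r ?subr0 ?addr0 ?sub0r ?add0r in a1 a2.
rewrite /ext1 /ext2.
move: u1; rewrite /dot2 -!expr2.
set x := (dir t).1 in a1 a2 a3 a4 *; set y := (dir t).2 in a1 a2 a3 a4 *.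
set l := len t in l0 a1 a2 a3 a4 *; set w := wid t in w0 a1 a2 a3 a4 *; move=> u1.
have nrm (z1 z2 : R) : z1 = z2 \/ z1 = - z2 -> `|z1| = `|z2| :> R by case=> ->; rewrite ?normrN.
have {}a1 : 4 * (l ^+ 2 * `|x * y|) <= d.
  rewrite -[l ^+ 2]ger0_norm ?sqr_ge0// -normrM; apply: le_trans a1; rewrite ler_pM2l//.
  by rewrite (nrm (l ^+ 2 * (x * y)) (l * x * (l * y)))//; left; ring.
have {}a2 : 4 * (w ^+ 2 * `|x * y|) <= d.
  rewrite -[w ^+ 2]ger0_norm ?sqr_ge0// -normrM; apply: le_trans a2; rewrite ler_pM2l//.
  by rewrite (nrm (w ^+ 2 * (x * y)) (- (w * y) * (w * x)))//; right; ring.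
have {}a3 : 4 * (l * w * `|x ^+ 2 - y ^+ 2|) <= d.
  have lw : l * w = `|l * w| by rewrite ger0_norm// mulr_ge0// ltW.
  rewrite {1}lw -normrM.
  have -> : l * w * (x ^+ 2 - y ^+ 2) =
    ((l * x - w * y) * (l * y + w * x) - (l * x - - w * y) * (l * y + - w * x)) / 2 by field.
  rewrite normrM (ger0_norm (_ : 0 <= 2^-1)) ?invr_ge0//.
  have := ler_normB ((l * x - w * y) * (l * y + w * x)) ((l * x - - w * y) * (l * y + - w * x)).
  lra.
have pp : `|x| * `|y| = `|x * y| by rewrite normrM.
have q2 : `|x ^+ 2 - y ^+ 2| ^+ 2 + 4 * `|x * y| ^+ 2 = 1.
  transitivity ((x ^+ 2 + y ^+ 2) ^+ 2); last by rewrite u1 expr1n.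
  by rewrite !real_normK ?num_real//; ring.
rewrite -(real_normK (num_real x)) -(real_normK (num_real y)) in u1.
set q := `|x ^+ 2 - y ^+ 2| in a3 q2; set p := `|x * y| in a1 a2 pp q2.
set X := `|x| in u1 pp *; set Y := `|y| in u1 pp *.
have q0 : 0 <= q by exact: normr_ge0.
have p0 : 0 <= p by exact: normr_ge0.
have q1 : q <= 1 by nra.
have p1 : p <= 1 / 2 by nra.
have lw0 : 0 < l * w by exact: mulr_gt0.
have h1 : l * w <= l * w * q + 2 * (l * w) * p.
  have e0 : l * w = l * w * q ^+ 2 + l * w * (4 * p ^+ 2) by rewrite -mulrDr q2 mulr1.
  have e1 : l * w * q ^+ 2 <= l * w * q by rewrite ler_pM2l// expr2; exact: ler_piMl.
  have e2 : l * w * (4 * p ^+ 2) <= 2 * (l * w) * p.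
    rewrite (_ : _ * p = l * w * (2 * p)); last by ring.
    by rewrite ler_pM2l//; nra.
  by rewrite {1}e0; apply: lerD.
have h2 : 2 * (l * w) * p <= (l ^+ 2 + w ^+ 2) * p.
  by rewrite ler_wpM2r//; have := sqr_ge0 (l - w); nra.
have -> : (l * X + w * Y) * (l * Y + w * X) = (l ^+ 2 + w ^+ 2) * (X * Y) + l * w * (X ^+ 2 + Y ^+ 2) by ring.
rewrite u1 mulr1 pp mulrDl; rewrite mulrDl in h2; lra.
Qed.

End rectangles.

(** * The part of a doubled rectangle inside a box *)

Section slabs.
Context {R : realType}.
Local Notation mR := (measurableTypeR R).
Local Notation lebp := (@lebp R).
Local Notation rect_data := (@rect_data R).

(** Half-open, so that the boxes of a grid are disjoint. *)
Definition hbox (q : R * R) (a b : R) : set (mR * mR) :=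
  [set x | q.1 <= x.1 < q.1 + a /\ q.2 <= x.2 < q.2 + b].
Definition cbox (q : R * R) (a b : R) : set (mR * mR) :=
  [set x | q.1 <= x.1 <= q.1 + a /\ q.2 <= x.2 <= q.2 + b].

Definition area (A : set (mR * mR)) : R := fine (lebp A).

Lemma measurable_hbox q a b : measurable (hbox q a b).
Proof.
rewrite (_ : hbox q a b = `[q.1, q.1 + a[%classic `*` `[q.2, q.2 + b[%classic).
  by apply: measurableX; exact: measurable_itv.
by apply/seteqP; split => x; rewrite /hbox /= !in_itv.
Qed.

Lemma cboxE q a b : cbox q a b = `[q.1, q.1 + a]%classic `*` `[q.2, q.2 + b]%classic.
Proof. by apply/seteqP; split => x; rewrite /cbox /= !in_itv. Qed.

Lemma measurable_cbox q a b : measurable (cbox q a b).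
Proof. by rewrite cboxE; apply: measurableX; exact: measurable_itv. Qed.

Lemma hboxE q a b : hbox q a b = `[q.1, q.1 + a[%classic `*` `[q.2, q.2 + b[%classic.
Proof. by apply/seteqP; split => x; rewrite /hbox /= !in_itv. Qed.

Lemma lebp_hbox q a b : 0 <= a -> 0 <= b -> lebp (hbox q a b) = (a * b)%:E.
Proof.
move=> a0 b0; rewrite hboxE lebpX//; rewrite !lebesgue_measure_itv /= !lte_fin !ltrDl.
by move: a0 b0; rewrite !le_eqVlt => /orP[/eqP<-|->] /orP[/eqP<-|->];
  rewrite ?ltxx ?mul0e ?mule0 ?mul0r ?mulr0// -!EFinB -EFinM !(addrC (q.1)) !(addrC (q.2)) !addrK.
Qed.

Lemma lebp_cbox q a b : 0 <= a -> 0 <= b -> lebp (cbox q a b) = (a * b)%:E.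
Proof.
move=> a0 b0; rewrite cboxE lebpX//; rewrite !lebesgue_measure_itv /= !lte_fin !ltrDl.
by move: a0 b0; rewrite !le_eqVlt => /orP[/eqP<-|->] /orP[/eqP<-|->];
  rewrite ?ltxx ?mul0e ?mule0 ?mul0r ?mulr0// -!EFinB -EFinM !(addrC (q.1)) !(addrC (q.2)) !addrK.
Qed.

Lemma area_ge0 A : 0 <= area A.
Proof. exact: fine_ge0. Qed.

Lemma areaE A q a b : 0 <= a -> 0 <= b -> measurable A -> A `<=` cbox q a b ->
  lebp A = (area A)%:E.
Proof.
move=> a0 b0 mA Aq; rewrite /area fineK// ge0_fin_numE//.
apply: le_lt_trans (_ : (a * b)%:E < +oo)%E; last exact: ltry.
by rewrite -(lebp_cbox q a0 b0); apply: le_measure; rewrite ?inE//; exact: measurable_cbox.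
Qed.

Lemma area_le A q a b : 0 <= a -> 0 <= b -> measurable A -> A `<=` cbox q a b ->
  area A <= a * b.
Proof.
move=> a0 b0 mA Aq; rewrite -lee_fin -(areaE a0 b0 mA Aq) -(lebp_cbox q a0 b0).
by apply: le_measure; rewrite ?inE//; exact: measurable_cbox.
Qed.

Lemma scaled_cbox r (t : rect_data) : valid t -> 0 <= r ->
  scaled r t `<=` cbox ((ctr t).1 - r * ext1 t, (ctr t).2 - r * ext2 t)
                       (2 * (r * ext1 t)) (2 * (r * ext2 t)).
Proof.
move=> vt r0 x /(scaled_bbox vt r0)[]; rewrite !ler_norml /cbox /= => /andP[? ?] /andP[? ?].
split; lra.
Qed.

Lemma lebp_scaledE r (t : rect_data) : valid t -> 0 <= r ->
  lebp (scaled r t) = (area (scaled r t))%:E.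
Proof.
move=> vt r0; have e1 := ext1_gt0 vt; have e2 := ext2_gt0 vt.
by apply: areaE (scaled_cbox vt r0); rewrite ?mulr_ge0 ?(ltW e1) ?(ltW e2)//; exact: measurable_scaled.
Qed.

Lemma area_scaled r (t : rect_data) : valid t -> 0 < r ->
  area (scaled r t) = r ^+ 2 * area (scaled 1 t).
Proof.
move=> vt r0; apply: EFin_inj; rewrite EFinM -!lebp_scaledE// ?ltW//; exact: lebp_scaled.
Qed.

(** Along its axis a rectangle has room for many translates of a part [T] that is
    narrow in the direction [k]. The half of [T] on one side of the centre is moved
    towards the other side, hence the factor two. *)
Lemma area_translates (t : rect_data) (k : R * R) (n : nat) (T : set (mR * mR)) :
  valid t -> (0 < n)%N -> measurable T -> T `<=` scaled 2 t ->
  (forall x y, T x -> T y -> `|dot2 (x - y) k| < 2 * len t * `|dot2 (dir t) k| / n%:R) ->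
  n%:R * area T <= 2 * area (scaled 2 t).
Proof.
move=> vt n0 mT TS Tk.
have [u1 l0 w0] := vt.
have n0' : 0 < n%:R :> R by rewrite ltr0n.
pose H : set (mR * mR) := [set x | 0 <= dot2 (x - ctr t) (dir t)].
have mH : measurable H.
  rewrite (_ : H = setT `&` (fun x : mR * mR => dot2 (x - ctr t) (dir t)) @^-1` `[0, +oo[%classic); last first.
    by rewrite setTI; apply/seteqP; split => x; rewrite /H /= in_itv /= andbT.
  suff m : measurable_fun setT (fun x : mR * mR => dot2 (x - ctr t) (dir t)).
    by apply: m => //; exact: measurable_itv.
  have -> : (fun x : mR * mR => dot2 (x - ctr t) (dir t)) = (fun x => dot2 x (dir t) - dot2 (ctr t) (dir t)).
    by apply/funext => x; rewrite /dot2 /=; ring.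
  apply: measurable_funB; last exact: measurable_cst.
  by apply: measurable_dot2; [exact: measurable_id|exact: measurable_cst].
have half (s : R) (T' : set (mR * mR)) : `|s| = 1 -> measurable T' -> T' `<=` T ->
    (forall x, T' x -> s * dot2 (x - ctr t) (dir t) <= 0) ->
    (n%:R%:E * lebp T' <= lebp (scaled 2 t))%E.
  move=> s1 mT' T'T T's.
  apply: (@packing _ _ _ ((s * (2 * len t / n%:R)) *: dir t) k) => //; first exact: measurable_scaled.
    move=> x y /T'T Tx /T'T Ty; apply: lt_le_trans (Tk _ _ Tx Ty) _.
    rewrite (_ : dot2 (_ *: _) _ = s * (2 * len t / n%:R) * dot2 (dir t) k); last first.
      by rewrite /dot2 /= /GRing.scale /=; ring.
    rewrite 2!normrM s1 mul1r [`|_ / _|]ger0_norm; last by rewrite divr_ge0 ?mulr_ge0 ?ltW.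
    by rewrite mulrAC.
  move=> j x jn T'x; have [h1 h2] := TS _ (T'T _ T'x).
  have h3 := T's _ T'x.
  split.
    rewrite (_ : dot2 _ _ = dot2 (x - ctr t) (dir t) + s * (2 * len t * (j%:R / n%:R)) * dot2 (dir t) (dir t)); last first.
      by rewrite /dot2 /= /GRing.scale /=; ring.
    rewrite u1 mulr1.
    have j0 : 0 <= j%:R / n%:R :> R by rewrite divr_ge0.
    have j1 : j%:R / n%:R <= 1 :> R by rewrite ler_pdivrMr// mul1r ler_nat ltnW.
    have jl : 2 * len t * (j%:R / n%:R) <= 2 * len t by rewrite ler_piMr// mulr_ge0// ltW.
    have jl0 : 0 <= 2 * len t * (j%:R / n%:R) by rewrite mulr_ge0// mulr_ge0// ltW.
    move: h1 h3; set z := dot2 _ _; move: jl jl0; set J := _ * (_ / _) => jl jl0.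
    have [->|->] : s = 1 \/ s = -1.
      by case: (ger0P s) s1 => _ <-; [left|right; rewrite opprK].
      rewrite !ler_norml => /andP[? ?] ?; lra.
    rewrite !ler_norml => /andP[? ?] ?; lra.
  rewrite (_ : dot2 _ _ = dot2 (x - ctr t) (- (dir t).2, (dir t).1)); first exact: h2.
  by rewrite /dot2 /= /GRing.scale /=; ring.
have fin T' : T' `<=` T -> measurable T' -> lebp T' = (area T')%:E.
  move=> T'T mT'; have e1 := ext1_gt0 vt; have e2 := ext2_gt0 vt.
  have sub : T' `<=` _ := subset_trans T'T (subset_trans TS (scaled_cbox vt (ler0n _ 2))).
  by apply: areaE sub; rewrite ?mulr_ge0 ?(ltW e1) ?(ltW e2).
have mI : measurable (T `&` H) by exact: measurableI.
have mD : measurable (T `\` H) by exact: measurableD.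
have h1 := half (-1) (T `&` H) _ mI (@subIsetl _ _ _) _.
have h2 := half 1 (T `\` H) (normr1 _) mD (@subDsetl _ _ _) _.
have {}h1 : n%:R * area (T `&` H) <= area (scaled 2 t).
  rewrite -lee_fin EFinM -fin// -lebp_scaledE//; apply: h1; first by rewrite normrN normr1.
  by move=> x [_]; rewrite /H /= mulN1r oppr_le0.
have {}h2 : n%:R * area (T `\` H) <= area (scaled 2 t).
  rewrite -lee_fin EFinM -fin// -lebp_scaledE//; apply: h2.
  by move=> x [_]; rewrite /H /= mul1r => /negP; rewrite -ltNge => /ltW.
have -> : area T = area (T `&` H) + area (T `\` H).
  apply: EFin_inj; rewrite EFinD -!fin//; rewrite -measureU//.
    by rewrite setUIDK.
  by apply/seteqP; split => // x [[_ ?] []].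
by rewrite mulrDr [2 * _]mulr_natl mulr2n lerD.
Qed.

(** The concentric rectangle of ratio 24 / 25: it lies in the interior of the
    original one, so the cores of the family are pairwise disjoint. *)
Definition core (t : rect_data) := area (scaled (24 / 25) t).

Lemma area2_core t : valid t -> area (scaled 2 t) = 625 / 144 * core t.
Proof.
move=> vt; have h : (0 < 24 / 25 :> R) by lra.
by rewrite /core (area_scaled vt (ltr0n _ 2)) (area_scaled vt h); field.
Qed.

Lemma area_swap r t : area (scaled r (swap_axes t)) = area (scaled r t).
Proof. by rewrite scaled_swap. Qed.

(** By symmetry the long axis contributes at least half of the extent [e] in
    the direction [k]; the number of translates along it is about [e / a]. *)
Lemma area_strip_core (t : rect_data) (k : R * R) (a : R) (T : set (mR * mR)) :
  let e := len t * `|dot2 (dir t) k| + wid t * `|dot2 (perp (dir t)) k| in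
  valid t -> measurable T -> T `<=` scaled 2 t -> 0 < a -> a <= e ->
  (forall x y, T x -> T y -> `|dot2 (x - y) k| < a) ->
  area T <= 18 * core t * a / e.
Proof.
wlog h : t / wid t * `|dot2 (perp (dir t)) k| <= len t * `|dot2 (dir t) k|.
  move=> W e vt mT TS a0 ae Ta.
  have [h|/ltW h] := leP (wid t * `|dot2 (perp (dir t)) k|) (len t * `|dot2 (dir t) k|); first exact: W.
  have r2 : `|dot2 (perp (perp (dir t))) k| = `|dot2 (dir t) k|.
    by rewrite -normrN; congr (`|_|); rewrite /dot2 /=; ring.
  have W' := W (swap_axes t); rewrite /core area_swap /= r2 scaled_swap in W'.
  rewrite /e addrC in ae *; exact: W' h (valid_swap vt) mT TS a0 ae Ta.
move=> e vt mT TS a0 ae Ta; have [u1 l0 w0] := vt.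
have e0 : 0 < e by exact: lt_le_trans ae.
set x := 2 * len t * `|dot2 (dir t) k| / a.
have x1 : 1 <= x by rewrite ler_pdivlMr// mul1r; apply: le_trans ae _; rewrite /e; lra.
have /andP[nx xn] := truncn_itv (le_trans ler01 x1); set n := Num.truncn x in nx xn.
have n1 : (0 < n)%N by rewrite truncn_gt0.
have n0 : 0 < n%:R :> R by rewrite ltr0n.
have H := area_translates vt n1 mT TS (k := k); rewrite area2_core// in H.
have {}H : n%:R * area T <= 2 * (625 / 144 * core t).
  apply: H.
  move=> y z Ty Tz; apply: lt_le_trans (Ta _ _ Ty Tz) _.
  by rewrite ler_pdivlMr// mulrC -ler_pdivlMr.
rewrite ler_pdivlMr//.
have n2 : e / a <= 2 * n%:R.
  have : x < 2 * n%:R by apply: lt_le_trans xn _; rewrite -natrM ler_nat mul2n -addnn -addn1 leq_add2l.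
  move=> /ltW; apply: le_trans; rewrite /x ler_pM2r ?invr_gt0// /e; lra.
have c0 : 0 <= core t by exact: area_ge0.
have := ler_wpM2r (area_ge0 T) n2.
rewrite mulrAC ler_pdivrMr// => n3.
have e1 : area T * e <= 2 * (n%:R * area T) * a by rewrite mulrC (le_trans n3)// mulrA.
apply: le_trans e1 _; rewrite ler_pM2r//; lra.
Qed.

Lemma area_vertical_strip (t : rect_data) q a b T : valid t -> measurable T -> T `<=` scaled 2 t ->
  T `<=` hbox q a b -> 0 < a -> a <= ext1 t -> area T <= 18 * core t * a / ext1 t.
Proof.
move=> vt mT TS Tq a0 ae.
have E : ext1 t = len t * `|dot2 (dir t) (1, 0)| + wid t * `|dot2 (perp (dir t)) (1, 0)|.
  by rewrite /ext1 /dot2 /= !mulr1 !mulr0 !addr0 normrN.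
rewrite E in ae *; apply: area_strip_core => // x y /Tq[/andP[? ?] _] /Tq[/andP[? ?] _].
rewrite /dot2 /= mulr1 mulr0 addr0 ltr_norml; lra.
Qed.

Lemma area_horizontal_strip (t : rect_data) q a b T : valid t -> measurable T -> T `<=` scaled 2 t ->
  T `<=` hbox q a b -> 0 < b -> b <= ext2 t -> area T <= 18 * core t * b / ext2 t.
Proof.
move=> vt mT TS Tq a0 ae.
have E : ext2 t = len t * `|dot2 (dir t) (0, 1)| + wid t * `|dot2 (perp (dir t)) (0, 1)|.
  by rewrite /ext2 /dot2 /= !mulr1 !mulr0 !add0r.
rewrite E in ae *; apply: area_strip_core => // x y /Tq[_ /andP[? ?]] /Tq[_ /andP[? ?]].
rewrite /dot2 /= mulr1 mulr0 add0r ltr_norml; lra.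
Qed.

Lemma area_le_ext1 (t : rect_data) q a b T : valid t -> measurable T -> T `<=` scaled 2 t ->
  T `<=` hbox q a b -> 0 <= b -> area T <= 4 * ext1 t * b.
Proof.
move=> vt mT TS Tq b0; have e1 := ext1_gt0 vt.
rewrite (_ : 4 * _ = 2 * (2 * ext1 t)); last by ring.
apply: (area_le (q := ((ctr t).1 - 2 * ext1 t, q.2))) => //; first by rewrite !mulr_ge0 ?ltW.
move=> x Tx; have [h1 _] := scaled_cbox vt (ler0n _ 2) (TS _ Tx).
have [_ /andP[h2 /ltW h3]] := Tq _ Tx; split; first exact: h1.
by rewrite h2.
Qed.

Lemma area_le_ext2 (t : rect_data) q a b T : valid t -> measurable T -> T `<=` scaled 2 t ->
  T `<=` hbox q a b -> 0 <= a -> area T <= 4 * ext2 t * a.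
Proof.
move=> vt mT TS Tq b0; have e1 := ext2_gt0 vt.
rewrite (_ : 4 * _ * a = a * (2 * (2 * ext2 t))); last by ring.
apply: (area_le (q := (q.1, (ctr t).2 - 2 * ext2 t))) => //; first by rewrite !mulr_ge0 ?ltW.
move=> x Tx; have [_ h1] := scaled_cbox vt (ler0n _ 2) (TS _ Tx).
have [/andP[h2 /ltW h3] _] := Tq _ Tx; split; last exact: h1.
by rewrite h2.
Qed.

(** Translates of a thin rectangle across its long side: about [n] of them fit in the
    square [-1, 2] x [-1, 2], whose area is nine. *)
Lemma area_thin (t : rect_data) (n : nat) T : valid t -> measurable T -> T `<=` scaled 2 t ->
  T `<=` cbox 0 1 1 -> (0 < n)%N -> len t * (4 * n%:R) < 1 \/ wid t * (4 * n%:R) < 1 ->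
  n%:R * area T <= 9.
Proof.
move=> vt mT TS T1 n0.
have n0' : 0 < n%:R :> R by rewrite ltr0n.
wlog wn : t vt TS / wid t * (4 * n%:R) < 1.
  move=> W [h|h]; last by apply: (W t) => //; right.
  by apply: (W (swap_axes t)); rewrite ?scaled_swap//; [exact: valid_swap|right].
move=> _; have [u1 l0 w0] := vt.
have fT := areaE ler01 ler01 mT T1.
have three : (0 <= 3 :> R) by [].
have -> : 9 = 3 * 3 :> R by ring.
rewrite -lee_fin EFinM -fT -(lebp_cbox (-1, -1) three three).
have ru : dot2 (perp (dir t)) (perp (dir t)) = 1 by rewrite -u1 /dot2 /=; ring.
have r1 : `|(perp (dir t)).1| <= 1 /\ `|(perp (dir t)).2| <= 1.
  by move: ru; rewrite /dot2 => ru; rewrite !ler_norml; split; nra.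
apply: (@packing _ _ _ (n%:R^-1 *: perp (dir t)) (perp (dir t))) => //.
- exact: measurable_cbox.
- move=> x y /TS[_ hx] /TS[_ hy].
  rewrite [X in _ < `|X|](_ : _ = n%:R^-1 * dot2 (perp (dir t)) (perp (dir t))); last first.
    by rewrite /dot2 /= /GRing.scale /=; ring.
  rewrite ru mulr1 [`|n%:R^-1|]ger0_norm ?invr_ge0// -(div1r (n%:R)) ltr_pdivlMr//.
  apply: le_lt_trans wn; rewrite [wid t * _]mulrA ler_pM2r//.
  rewrite (_ : dot2 (x - y) _ = dot2 (x - ctr t) (perp (dir t)) - dot2 (y - ctr t) (perp (dir t))); last first.
    by rewrite /dot2 /=; ring.
  by apply: le_trans (ler_normB _ _) _; rewrite (_ : wid t * 4 = 2 * wid t + 2 * wid t); [exact: lerD|ring].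
- move=> j x jn /T1[/= /andP[h1 h2] /andP[h3 h4]].
  have j0 : 0 <= j%:R / n%:R :> R by rewrite divr_ge0.
  have j1 : j%:R / n%:R <= 1 :> R by rewrite ler_pdivrMr// mul1r ler_nat ltnW.
  have B (z : R) : `|z| <= 1 -> `|j%:R / n%:R * z| <= 1.
    by move=> z1; rewrite normrM (ger0_norm j0) mulr_ile1.
  move: r1 => [/B + /B]; rewrite !ler_norml /cbox /= /GRing.scale /= mulrA => /andP[? ?].
  rewrite mulrA => /andP[? ?]; split; lra.
Qed.

End slabs.

(** * Summation over the rectangles meeting a box *)

Section group_sum.
Context {R : realType} {I : choiceType}.
Local Notation mR := (measurableTypeR R).
Local Notation lebp := (@lebp R).
Local Notation rect_data := (@rect_data R).

Lemma area_mono (A B : set (mR * mR)) q a b : 0 <= a -> 0 <= b -> measurable A -> measurable B ->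
  A `<=` B -> B `<=` cbox q a b -> area A <= area B.
Proof.
move=> a0 b0 mA mB AB Bq; rewrite -lee_fin.
rewrite -(areaE a0 b0 mB Bq) -(areaE a0 b0 mA (subset_trans AB Bq)).
by apply: le_measure; rewrite ?inE.
Qed.

(** Bounds on the groups [k i = j] that decay geometrically in [j] sum up. *)
Lemma sum_geometric_groups (s : seq I) (k : I -> nat) (F : I -> R) (B : R) :
  (forall j, \sum_(i <- s | k i == j) F i <= B / 2 ^+ j) ->
  \sum_(i <- s) F i <= 2 * B.
Proof.
move=> H.
have [K Ks] : exists K, forall i, i \in s -> (k i < K)%N.
  exists (\max_(i <- s) k i).+1 => i si; rewrite ltnS.
  by rewrite (big_rem _ si) /= leq_maxl.
have -> : \sum_(i <- s) F i = \sum_(j < K) \sum_(i <- s | k i == j) F i.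
  under [RHS]eq_bigr do rewrite big_mkcond.
  rewrite exchange_big /= big_seq [RHS]big_seq; apply: eq_bigr => i si.
  rewrite (bigD1 (Ordinal (Ks i si)))//= eqxx big1 ?addr0// => j.
  by rewrite -val_eqE /= eq_sym => /negbTE ->.
have B0 : 0 <= B.
  have := H K; rewrite big_seq_cond big1 ?ler_pdivlMr ?mul0r ?exprn_gt0//.
  by move=> i /andP[/Ks + /eqP e]; rewrite e ltnn.
have G : \sum_(j < K) (B / 2 ^+ j) = 2 * B - 2 * B / 2 ^+ K.
  elim: K {Ks} => [|K ih]; first by rewrite big_ord0 expr0 divr1 subrr.
  rewrite big_ord_recr /= ih exprS; field.
  by rewrite expf_neq0.
apply: le_trans (_ : \sum_(j < K) (B / 2 ^+ j) <= _); first by apply: ler_sum => j _; exact: H.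
by rewrite G gerBl divr_ge0 ?mulr_ge0 ?exprn_ge0.
Qed.

Lemma interval_near (c e x y p a r : R) : 0 < e -> `|x - c| <= 2 * e -> `|y - c| <= 1 * e ->
  p <= x -> x < p + a -> e <= r -> a <= r -> p - 3 * r <= y <= p - 3 * r + 7 * r.
Proof.
move=> e0; rewrite !ler_norml => /andP[? ?] /andP[? ?] *; apply/andP; split; lra.
Qed.

Variables (q : R * R) (a b A' zeta : R) (s : seq I) (t : I -> rect_data).
Hypotheses (a0 : 0 < a) (b0 : 0 < b) (A1 : 1 <= A') (z0 : 0 < zeta) (us : uniq s).
Hypothesis vt : forall i, i \in s -> valid (t i).
Hypothesis et : forall i, i \in s -> ext1 (t i) * ext2 (t i) <= A' * (a * b).
Hypothesis dt : forall i j, i \in s -> j \in s -> i != j ->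
  scaled (24 / 25) (t i) `&` scaled (24 / 25) (t j) = set0.

Local Notation T i := (scaled 2 (t i) `&` hbox q a b).
Local Notation m i := (area (scaled 2 (t i) `&` hbox q a b)).
Hypothesis small : forall i, i \in s -> m i <= zeta ^+ 4 * (a * b).

Let ratio i := Num.max 1 (Num.max (ext1 (t i) / a) (ext2 (t i) / b)).
Let lev i := trunc_log 16 (Num.truncn (ratio i)).

Let ratio1 i : 1 <= ratio i.
Proof. by rewrite /ratio le_max lexx. Qed.

Let lev_le i : 16 ^+ lev i <= ratio i.
Proof.
have r0 : 0 <= ratio i := le_trans ler01 (ratio1 i).
have /andP[h _] := truncn_itv r0; apply: le_trans h.
by rewrite -natrX ler_nat trunc_logP// truncn_gt0.
Qed.

Let lev_gt i : ratio i <= 16 * 16 ^+ lev i.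
Proof.
have r0 : 0 <= ratio i := le_trans ler01 (ratio1 i).
have /andP[_ /ltW h] := truncn_itv r0; apply: le_trans h _.
by rewrite -exprS -natrX ler_nat trunc_log_ltn.
Qed.

Let mT i : measurable (T i).
Proof. by apply: measurableI; [exact: measurable_scaled|exact: measurable_hbox]. Qed.

Lemma area_core_ratio i : i \in s -> m i <= 18 * core (t i) / 16 ^+ lev i.
Proof.
move=> si; have v := vt si; have c0 : 0 <= core (t i) by exact: area_ge0.
have h : m i <= 18 * core (t i) / ratio i.
  rewrite /ratio; case: (leP 1) => [|h].
    case: (leP (ext1 (t i) / a)) => _.
      rewrite ler_pdivlMr// mul1r => h; have e0 := ext2_gt0 v.
      rewrite invf_div mulrA; apply: area_horizontal_strip h => //.
    rewrite ler_pdivlMr// mul1r => h; have e0 := ext1_gt0 v.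
    rewrite invf_div mulrA; apply: area_vertical_strip h => //.
  rewrite divr1; apply: le_trans (_ : area (scaled 2 (t i)) <= _).
    have e1 := ext1_gt0 v; have e2 := ext2_gt0 v.
    apply: (area_mono _ _ (mT i) (measurable_scaled 2 (t i)) _ (scaled_cbox v (ler0n _ 2))) => //.
    - by rewrite !mulr_ge0// ltW.
    - by rewrite !mulr_ge0// ltW.
  rewrite area2_core//; lra.
apply: le_trans h _; apply: ler_wpM2l; first by rewrite mulr_ge0.
by rewrite lef_pV2 ?posrE ?exprn_gt0//; exact: lt_le_trans (ratio1 i).
Qed.

Let ratio_le1 i : ext1 (t i) <= 16 * 16 ^+ lev i * a.
Proof.
rewrite -ler_pdivrMr//; apply: le_trans (lev_gt i).
by rewrite /ratio !le_max lexx orbT.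
Qed.

Let ratio_le2 i : ext2 (t i) <= 16 * 16 ^+ lev i * b.
Proof.
rewrite -ler_pdivrMr//; apply: le_trans (lev_gt i).
by rewrite /ratio !le_max lexx !orbT.
Qed.

Lemma area_level i : i \in s -> m i <= 4 * A' * (a * b) / 16 ^+ lev i.
Proof.
move=> si; have v := vt si; have e1 := ext1_gt0 v; have e2 := ext2_gt0 v.
have h : m i * ratio i <= 4 * A' * (a * b).
  have ee := et si.
  rewrite /ratio; case: (leP 1) => [|h].
    case: (leP (ext1 (t i) / a)) => _ _.
      have := area_le_ext1 v (mT i) (@subIsetl _ _ _) (@subIsetr _ _ _) (ltW b0).
      rewrite -(ler_pM2r (divr_gt0 e2 b0)) => /le_trans; apply.
      rewrite [X in X <= _](_ : _ = 4 * (ext1 (t i) * ext2 (t i))); last by field; rewrite gt_eqF.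
      by rewrite -mulrA ler_pM2l.
    have := area_le_ext2 v (mT i) (@subIsetl _ _ _) (@subIsetr _ _ _) (ltW a0).
    rewrite -(ler_pM2r (divr_gt0 e1 a0)) => /le_trans; apply.
    rewrite [X in X <= _](_ : _ = 4 * (ext1 (t i) * ext2 (t i))); last by field; rewrite gt_eqF.
    by rewrite -mulrA ler_pM2l.
  have ab : 0 < a * b by exact: mulr_gt0.
  rewrite mulr1; apply: le_trans (_ : a * b <= _).
    apply: (@area_le _ _ q) (mT i) _; rewrite ?ltW//.
    by move=> x [_ [/andP[h1 /ltW h2] /andP[h3 /ltW h4]]]; split; [rewrite h1 h2|rewrite h3 h4].
  by rewrite ler_peMl ?(ltW ab)//; move: A1; lra.
rewrite ler_pdivlMr ?exprn_gt0//; apply: le_trans h; apply: ler_wpM2l (lev_le i).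
exact: area_ge0.
Qed.

(** Rectangles of level [k] that meet the box are confined to the union of two
    thin crossing boxes: flatness allows only one of the two relative extents to
    exceed [A'], and that one is at most [16 * 16 ^+ k]. Disjointness of the cores
    turns the area of this region into a bound on the sum. *)
Lemma sum_core_level k :
  \sum_(i <- s | (lev i == k) && (T i != set0)) core (t i) <= 1568 * 16 ^+ k * A' * (a * b).
Proof.
rewrite -big_filter; set s' := [seq i <- s | _].
pose rho : R := 16 * 16 ^+ k.
have rho1 : 1 <= rho by rewrite /rho -exprS exprn_ege1// ler1n.
have in_s i : i \in s' -> [/\ i \in s, lev i = k & T i != set0].
  by rewrite mem_filter => /andP[/andP[/eqP ? ?] ?].
pose W1 := cbox (q.1 - 3 * (rho * a), q.2 - 3 * (A' * b)) (7 * (rho * a)) (7 * (A' * b)).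
pose W2 := cbox (q.1 - 3 * (A' * a), q.2 - 3 * (rho * b)) (7 * (A' * a)) (7 * (rho * b)).
have [A0 r0] : 0 <= A' /\ 0 <= rho by split; apply: le_trans ler01 _.
have mW1 : measurable W1 by exact: measurable_cbox.
have mW2 : measurable W2 by exact: measurable_cbox.
have sub i : i \in s' -> scaled (24 / 25) (t i) `<=` W1 `|` W2.
  move=> /in_s[si ik /eqP/eqP/set0P[x [Tx qx]]] y Sy.
  have v := vt si; have e1 := ext1_gt0 v; have e2 := ext2_gt0 v.
  have [x1 x2] := scaled_bbox v (ler0n _ 2) Tx.
  have Sy1 : scaled 1 (t i) y by apply: scaled_mono Sy => //; lra.
  have [y1 y2] := scaled_bbox v ler01 Sy1.
  move: qx => [/andP[q1 q2] /andP[q3 q4]].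
  have R1 := ratio_le1 i; have R2 := ratio_le2 i; rewrite ik -/rho in R1 R2.
  have [h|h] : ext2 (t i) <= A' * b \/ ext1 (t i) <= A' * a.
  - have [h|h] := leP (ext2 (t i)) (A' * b); first by left.
    right; rewrite leNgt; apply/negP => h'.
    have : A' * b * (A' * a) < ext2 (t i) * ext1 (t i).
      by apply: ltr_pM => //; rewrite mulr_ge0// ltW.
    rewrite [ext2 _ * _]mulrC (_ : A' * b * (A' * a) = A' * (A' * (a * b))); last by ring.
    rewrite ltNge; move/negP; apply.
    apply: le_trans (et si) _; rewrite ler_peMl// mulr_ge0// mulr_ge0 ?ltW//.
  - left.
    have rA : a <= rho * a by rewrite ler_peMl// ltW.
    have bA : b <= A' * b by rewrite ler_peMl// ltW.
    rewrite /W1 /cbox /=.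
    by split; [exact: interval_near e1 x1 y1 q1 q2 R1 rA|exact: interval_near e2 x2 y2 q3 q4 h bA].
  - right.
    have rA : b <= rho * b by rewrite ler_peMl// ltW.
    have bA : a <= A' * a by rewrite ler_peMl// ltW.
    rewrite /W2 /cbox /=.
    by split; [exact: interval_near e1 x1 y1 q1 q2 h bA|exact: interval_near e2 x2 y2 q3 q4 R2 rA].
have H : (\sum_(i <- s') lebp (scaled (24 / 25) (t i)) <= lebp (W1 `|` W2))%E.
  apply: sum_disjoint => //.
  - exact: filter_uniq.
  - by move=> i _; exact: measurable_scaled.
  - by move=> i j /in_s[? _ _] /in_s[? _ _]; exact: dt.
  - exact: measurableU.
have c0 : (0 <= 24 / 25 :> R) by lra.
rewrite -lee_fin -sumEFin (eq_big_seq (fun i => lebp (scaled (24 / 25) (t i)))); last first.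
  by move=> i /in_s[si _ _]; rewrite lebp_scaledE//; exact: vt.
have H2 : (lebp (W1 `|` W2) <= lebp W1 + lebp W2)%E by exact: measureU2.
apply: le_trans H _; apply: le_trans H2 _.
rewrite /W1 /W2 !lebp_cbox ?mulr_ge0 ?(ltW a0) ?(ltW b0)// -EFinD lee_fin /rho.
by rewrite le_eqVlt; apply/orP; left; apply/eqP; ring.
Qed.

(** The rectangles are grouped by the order of magnitude [16 ^+ k] of their largest
    extent relative to the box. Within a group the area inside the box is of
    the order of [16 ^- k] times the core, which compensates the growth of the total area of
    the cores. The square roots provide both the summability over [k] and the
    gain [zeta]. *)
Theorem sum_area_sqrt :
  \sum_(i <- s) m i * Num.sqrt (m i) <= 336 ^+ 2 * A' ^+ 2 * zeta * (a * b * Num.sqrt (a * b)).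
Proof.
have ab : 0 < a * b by exact: mulr_gt0.
have A0 : 0 < A' := lt_le_trans ltr01 A1.
have m0 i : 0 <= m i by exact: area_ge0.
set rt := Num.sqrt (a * b); have rt0 : 0 <= rt by exact: sqrtr_ge0.
have rt2 : rt ^+ 2 = a * b by rewrite sqr_sqrtr// ltW.
rewrite (_ : 336 ^+ 2 * _ * _ * _ = 2 * (168 * 336 * A' ^+ 2 * zeta * (a * b * rt))); last by ring.
apply: (sum_geometric_groups (k := lev)) => j.
have two0 : 0 < 2 ^+ j :> R by exact: exprn_gt0.
have e16 : 16 ^+ j = (2 ^+ j) ^+ 4 :> R by rewrite -exprM mulnC exprM; congr (_ ^+ j); ring.
(* the geometric mean of the two bounds [zeta ^+ 4] and [16 ^- j] on the relative
   area; its square root carries [zeta] and [2 ^- j] *)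
pose y := rt * zeta * (2 * A') / 2 ^+ j.
have y0 : 0 <= y by rewrite divr_ge0 ?mulr_ge0// ltW.
have sm i : i \in s -> lev i = j -> Num.sqrt (m i) <= y.
  move=> si ij; rewrite -[y]ger0_norm// -sqrtr_sqr ler_wsqrtr//.
  have p1 := small si; have p2 := area_level si; rewrite ij in p2.
  rewrite -(@ler_pXn2r _ 2) ?nnegrE ?sqr_ge0//.
  apply: le_trans (_ : (zeta ^+ 4 * (a * b)) * (4 * A' * (a * b) / 16 ^+ j) <= _).
    by rewrite expr2; apply: ler_pM.
  rewrite /y -exprM e16.
  rewrite [X in _ <= X](_ : _ = (zeta ^+ 4 * (a * b)) * (4 * A' * (a * b) / (2 ^+ j) ^+ 4) * (4 * A' ^+ 3)).
    rewrite ler_peMr//.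
      by rewrite !mulr_ge0 ?invr_ge0 ?exprn_ge0// ltW.
    have : 1 <= A' ^+ 3 by exact: exprn_ege1.
    lra.
  by rewrite -rt2; field; rewrite gt_eqF.
have -> : \sum_(i <- s | lev i == j) m i * Num.sqrt (m i) =
    \sum_(i <- s | (lev i == j) && (T i != set0)) m i * Num.sqrt (m i).
  rewrite [RHS]big_mkcondr /=; apply: eq_bigr => i _.
  by case: eqP => //= ->; rewrite /area measure0 /= mul0r.
apply: le_trans (_ : \sum_(i <- s | (lev i == j) && (T i != set0)) (18 * y / 16 ^+ j) * core (t i) <= _).
  rewrite big_seq_cond [X in _ <= X]big_seq_cond; apply: ler_sum => i /and3P[si /eqP ij _].
  have := area_core_ratio si; rewrite ij => h.
  rewrite (_ : _ * core (t i) = (18 * core (t i) / 16 ^+ j) * y); last by ring.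
  by apply: ler_pM => //; exact: sm.
rewrite -mulr_sumr.
apply: le_trans (ler_wpM2l _ (sum_core_level j)) _.
  by apply: divr_ge0; [exact: mulr_ge0|exact: exprn_ge0].
rewrite /y -rt2 e16 le_eqVlt; apply/orP; left; apply/eqP; field.
by rewrite gt_eqF.
Qed.

End group_sum.

(** * Cells of a grid that avoid the heavy rectangles *)

Section shape.
Context {R : realType} {I : choiceType}.
Local Notation lebp := (@lebp R).
Local Notation rect_data := (@rect_data R).

(** The rectangles whose double fills a non-negligible part of the box. Only these
    are dangerous: the others have a small contribution by [sum_area_sqrt]. *)
Definition heavy (t : rect_data) (eta a b : R) (q : R * R) :=
  eta * (a * b) < area (scaled 2 t `&` hbox q a b).

(** The tent with centre [p] and half-widths [r] vanishes outside this cell. *)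
Definition cell (r p : R * R) := hbox (p - r) (2 * r.1) (2 * r.2).

(** The side of the cell is a small part of both half-sides, and 51 / 25 is 2 + 1 / 25. *)
Lemma cell_enlarged (t : rect_data) (q : R * R) (w1 w2 : R) : valid t ->
  w1 + w2 <= len t / 25 -> w1 + w2 <= wid t / 25 ->
  hbox q w1 w2 `&` scaled 2 t !=set0 -> hbox q w1 w2 `<=` scaled (51 / 25) t.
Proof.
move=> [u1 l0 w0] hl hw [y [[/andP[y1 y2] /andP[y3 y4]] [Sy1 Sy2]]] x [/andP[x1 x2] /andP[x3 x4]].
have [d1 d2] : `|(x - y).1| <= w1 /\ `|(x - y).2| <= w2.
  by rewrite /= !ler_norml; split; lra.
have K (u : R * R) : dot2 u u = 1 -> `|dot2 (x - y) u| <= w1 + w2.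
  rewrite /dot2 => uu; apply: le_trans (ler_normD _ _) _; rewrite !normrM.
  have [n1 n2] : `|u.1| <= 1 /\ `|u.2| <= 1 by rewrite !ler_norml; split; nra.
  by apply: lerD; apply: le_trans (ler_piMr _ _) _.
have pu : dot2 (- (dir t).2, (dir t).1) (- (dir t).2, (dir t).1) = 1.
  by rewrite -u1 /dot2 /=; ring.
have E (u : R * R) : dot2 (x - ctr t) u = dot2 (y - ctr t) u + dot2 (x - y) u.
  by rewrite /dot2 /=; ring.
split; rewrite E; apply: le_trans (ler_normD _ _) _.
  by have := K _ u1; move: Sy1; set z1 := `|_|; set z2 := `|_|; lra.
by have := K _ pu; move: Sy2; set z1 := `|_|; set z2 := `|_|; lra.
Qed.

Lemma grid_index (w : R) (i j : nat) (x : R) : 0 < w ->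
  i%:R * w <= x < i%:R * w + w -> j%:R * w <= x < j%:R * w + w -> i = j.
Proof.
move=> w0 /andP[h1 h2] /andP[h3 h4].
have N (k l : nat) : k%:R * w <= x -> x < l%:R * w + w -> (k <= l)%N.
  move=> k1 k2; rewrite -ltnS -(ltr_nat R) -addn1 natrD -(ltr_pM2r w0) mulrDl mul1r.
  exact: le_lt_trans k2.
by apply/eqP; rewrite eqn_leq !N.
Qed.

Variables (SS : set I) (t : I -> rect_data) (eta : R) (K1 K2 n : nat).
Hypotheses (K10 : (0 < K1)%N) (K20 : (0 < K2)%N) (n0 : (0 < n)%N).
Local Notation a := (K1%:R^-1 : R).
Local Notation b := (K2%:R^-1 : R).
Local Notation w1 := ((K1 * n)%:R^-1 : R).
Local Notation w2 := ((K2 * n)%:R^-1 : R).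
Local Notation r := (w1 / 2, w2 / 2).
Hypothesis vt : forall S, SS S -> valid (t S).
Hypothesis fine_cells : forall S q, SS S -> heavy (t S) eta a b q -> hbox q a b `<=` cbox 0 1 1 ->
  w1 + w2 <= len (t S) / 25 /\ w1 + w2 <= wid (t S) / 25.

Local Notation C := ('I_K1 * 'I_K2 * ('I_n * 'I_n))%type.
Let ix1 (c : C) : nat := c.1.1 * n + c.2.1.
Let ix2 (c : C) : nat := c.1.2 * n + c.2.2.
Let corner (k : 'I_K1 * 'I_K2) : R * R := (k.1%:R * a, k.2%:R * b).
Let sq (c : C) := hbox ((ix1 c)%:R * w1, (ix2 c)%:R * w2) w1 w2.
Let bad (c : C) := `[< exists S, [/\ SS S, heavy (t S) eta a b (corner c.1) & sq c `&` scaled 2 (t S) !=set0] >].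

Let w10 : 0 < w1. Proof. by rewrite invr_gt0 ltr0n muln_gt0 K10. Qed.
Let w20 : 0 < w2. Proof. by rewrite invr_gt0 ltr0n muln_gt0 K20. Qed.

Let ix_inj c c' : ix1 c = ix1 c' -> ix2 c = ix2 c' -> c = c'.
Proof.
case: c => [[k1 k2] [c1 c2]]; case: c' => [[k1' k2'] [c1' c2']]; rewrite /ix1 /ix2 /= => e1 e2.
have D m (k k' : nat) (i i' : 'I_m) : (k * m + i = k' * m + i')%N -> k = k' /\ i = i'.
  move=> e; have m0 : (0 < m)%N by exact: leq_ltn_trans (ltn_ord i).
  have ek : k = k'.
    by have := congr1 (divn^~ m) e; rewrite !divnMDl// !divn_small ?addn0.
  split=> //; apply: val_inj => /=; move: e; rewrite ek => /eqP; rewrite eqn_add2l => /eqP//.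
have [/val_inj -> ->] := D _ _ _ _ _ e1; have [/val_inj -> ->] := D _ _ _ _ _ e2.
by [].
Qed.

Let sq_disjoint c c' : c != c' -> sq c `&` sq c' = set0.
Proof.
move=> cc; apply/seteqP; split => // x [[h1 h2] [h3 h4]].
move/eqP: cc; apply; apply: ix_inj.
  exact: grid_index w10 h1 h3.
exact: grid_index w20 h2 h4.
Qed.

Let sub_interval (k K m i : nat) (x : R) : (0 < K)%N -> (i < m)%N ->
  (k * m + i)%:R * (K * m)%:R^-1 <= x < (k * m + i)%:R * (K * m)%:R^-1 + (K * m)%:R^-1 ->
  k%:R * K%:R^-1 <= x < k%:R * K%:R^-1 + K%:R^-1.
Proof.
move=> K0 im /andP[h1 h2]; have m0 : (0 < m)%N by exact: leq_ltn_trans im.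
have [K0' m0'] : 0 < K%:R :> R /\ 0 < m%:R :> R by rewrite !ltr0n.
have E : k%:R * K%:R^-1 = (k * m)%:R * (K * m)%:R^-1 :> R.
  by rewrite !natrM; field; rewrite !gt_eqF.
have u0 : 0 < (K * m)%:R^-1 :> R by rewrite invr_gt0 natrM mulr_gt0.
have E' : K%:R^-1 = m%:R * (K * m)%:R^-1 :> R.
  by rewrite natrM; field; rewrite !gt_eqF.
rewrite E E'; apply/andP; split.
  by apply: le_trans h1; rewrite ler_pM2r// ler_nat leq_addr.
apply: lt_le_trans h2 _; rewrite -mulrDl.
rewrite -[X in _ + X <= _]mul1r -mulrDl ler_pM2r// -natrD -(natrD _ _ 1) ler_nat.
by rewrite addn1 -addnS leq_add2l.
Qed.

Let sq_box c : sq c `<=` hbox (corner c.1) a b.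
Proof.
move=> x [h1 h2]; split => /=.
  exact: (sub_interval K10 (ltn_ord c.2.1) h1).
exact: (sub_interval K20 (ltn_ord c.2.2) h2).
Qed.

Let r1E : 2 * (w1 / 2) = w1. Proof. by rewrite mulrCA divff ?mulr1. Qed.
Let r2E : 2 * (w2 / 2) = w2. Proof. by rewrite mulrCA divff ?mulr1. Qed.
Let center (c : C) : R * R := ((ix1 c)%:R * w1 + w1 / 2, (ix2 c)%:R * w2 + w2 / 2).

Let cellE c : cell r (center c) = sq c.
Proof. by rewrite /cell r1E r2E /center /sq; congr hbox; rewrite /= ; congr pair; rewrite /= addrK. Qed.

Let center_inj : injective center.
Proof.
move=> c c' [e1 e2]; apply: ix_inj.
  by move/addIr: e1 => /(mulIf (lt0r_neq0 w10)) /eqP; rewrite eqr_nat => /eqP.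
by move/addIr: e2 => /(mulIf (lt0r_neq0 w20)) /eqP; rewrite eqr_nat => /eqP.
Qed.

Let a0 : 0 < a. Proof. by rewrite invr_gt0 ltr0n. Qed.
Let b0 : 0 < b. Proof. by rewrite invr_gt0 ltr0n. Qed.

Let corner_unit k : [/\ 0 <= (corner k).1, (corner k).1 + a <= 1, 0 <= (corner k).2 & (corner k).2 + b <= 1].
Proof.
have h K (i : 'I_K) : i%:R * K%:R^-1 + K%:R^-1 <= 1 :> R.
  have K0 : (0 < K)%N by exact: leq_ltn_trans (ltn_ord i).
  by rewrite -[X in _ + X]mul1r -mulrDl -(natrD _ _ 1) ler_pdivrMr ?ltr0n// mul1r ler_nat addn1 ltn_ord.
split; rewrite /= ?mulr_ge0 ?invr_ge0//; exact: h.
Qed.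

Let corner_sub k : hbox (corner k) a b `<=` cbox 0 1 1.
Proof.
have [? ? ? ?] := corner_unit k.
by move=> x [/andP[? ?] /andP[? ?]]; split => /=; lra.
Qed.

Let good_list (k : 'I_K1 * 'I_K2) : seq C := [seq (k, d) | d <- enum {: 'I_n * 'I_n} & ~~ bad (k, d)].
Let bad_list (k : 'I_K1 * 'I_K2) : seq C := [seq (k, d) | d <- enum {: 'I_n * 'I_n} & bad (k, d)].

Let size_lists k : (size (good_list k) + size (bad_list k) = n * n)%N.
Proof.
rewrite !size_map addnC !size_filter.
transitivity (size (enum {: 'I_n * 'I_n})).
  exact: (count_predC (fun d => bad (k, d))).
by rewrite -cardT card_prod !card_ord.
Qed.

(** Either some box has one cell in twenty free of the doubled heavy rectangles,
    or at least 95 percent of all the cells in the unit square meet one of them. In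
    the second case each such cell lies in a slightly larger dilate of a
    heavy rectangle, and disjointness of the cells gives the lower bound for the sum
    of the areas of these dilates. *)
Theorem shape_dichotomy :
  (exists (q : R * R) (P : seq (R * R)),
    [/\ [/\ 0 <= q.1, q.1 + a <= 1, 0 <= q.2 & q.2 + b <= 1],
        uniq P /\ (n * n <= 20 * size P)%N,
        forall p, p \in P -> cell r p `<=` hbox q a b,
        forall p p', p \in P -> p' \in P -> p != p' -> cell r p `&` cell r p' = set0 &
        forall S p, SS S -> heavy (t S) eta a b q -> p \in P -> cell r p `&` scaled 2 (t S) = set0]) \/
  (exists X : seq I, [/\ uniq X,
     forall S, S \in X -> SS S /\ exists q, hbox q a b `<=` cbox 0 1 1 /\ heavy (t S) eta a b q &
     95 / 100 <= \sum_(S <- X) area (scaled (51 / 25) (t S))]).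
Proof.
have [[k hk]|nk] := pselect (exists k, (n * n <= 20 * size (good_list k))%N).
  left; exists (corner k), (map center (good_list k)); split.
  - exact: corner_unit.
  - rewrite size_map; split => //; rewrite map_inj_uniq; last exact: center_inj.
    rewrite map_inj_uniq; last by move=> d d' [].
    by apply: filter_uniq; exact: enum_uniq.
  - move=> p /mapP[c /mapP[d _ ->] ->]; rewrite cellE; exact: sq_box.
  - move=> p p' /mapP[c _ ->] /mapP[c' _ ->] pp; rewrite !cellE; apply: sq_disjoint.
    by apply: contraNneq pp => ->.
  - move=> S p SSS hS /mapP[c /mapP[d]]; rewrite mem_filter => /andP[/asboolPn nb _] -> ->.
    rewrite cellE; apply/eqP/negPn/negP => /set0P ne; apply: nb; exists S; split => //.
right.
pose L : seq C := [seq c <- enum {: C} | bad c].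
have uL : uniq L by apply: filter_uniq; exact: enum_uniq.
have badL c : c \in L -> bad c by rewrite mem_filter => /andP[].
have sizeL : (19 * (K1 * K2 * (n * n)) <= 20 * size L)%N.
  have -> : size L = (\sum_(k : 'I_K1 * 'I_K2) size (bad_list k))%N.
    rewrite size_filter -sum1_count big_enum_cond /= big_mkcond /=.
    rewrite (eq_bigr (fun c : C => if bad (c.1, c.2) then 1 else 0)%N); last by case.
    rewrite -(pair_bigA _ (fun k d => if bad (k, d) then 1 else 0)%N) /=; apply: eq_bigr => k _.
    by rewrite size_map size_filter -sum1_count big_enum_cond /= [RHS]big_mkcond.
  rewrite big_distrr /=; apply: leq_trans (_ : \sum_(k : 'I_K1 * 'I_K2) 19 * (n * n) <= _)%N.
    by rewrite sum_nat_const card_prod !card_ord mulnCA.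
  apply: leq_sum => k _; have /negP := (fun h => nk (ex_intro _ k h)).
  have := size_lists k; move: (size _) (size _) => g h <-; lia.
have [S0 _] : exists S0 : I, True.
  have : (0 < size L)%N.
    rewrite -(ltn_pmul2l (isT : 0 < 20)%N) muln0; apply: leq_trans sizeL.
    by rewrite !muln_gt0 K10 K20 n0.
  case: L badL {uL sizeL} => // c L' h _.
  by have /asboolP[S _] := h c (mem_head _ _); exists S.
have [wit witP] : {wit : C -> I & forall c, c \in L ->
    [/\ SS (wit c), heavy (t (wit c)) eta a b (corner c.1) & sq c `&` scaled 2 (t (wit c)) !=set0]}.
  apply: (@choice _ _ (fun c S => c \in L ->
    [/\ SS S, heavy (t S) eta a b (corner c.1) & sq c `&` scaled 2 (t S) !=set0])) => c.
  have [cL|] := boolP (c \in L); last by exists S0.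
  by have /asboolP[S ?] := badL _ cL; exists S.
exists (undup (map wit L)); split; first exact: undup_uniq.
- move=> S; rewrite mem_undup => /mapP[c /witP[? ? _] ->]; split => //.
  by exists (corner c.1); split => //; exact: corner_sub.
have H : \sum_(c <- L) w1 * w2 <= \sum_(S <- undup (map wit L)) area (scaled (51 / 25) (t S)).
  have -> : \sum_(c <- L) w1 * w2 = \sum_(S <- undup (map wit L)) \sum_(c <- L | wit c == S) w1 * w2.
    under [RHS]eq_bigr do rewrite big_mkcond.
    rewrite exchange_big /= big_seq [RHS]big_seq; apply: eq_bigr => c cL.
    rewrite (bigD1_seq (wit c)) ?undup_uniq ?mem_undup ?map_f//= eqxx big1 ?addr0// => S.
    by rewrite eq_sym => /negbTE ->.
  rewrite big_seq [X in _ <= X]big_seq; apply: ler_sum => S.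
  rewrite mem_undup => /mapP[c0 c0L ES].
  have [SSS _ _] := witP _ c0L; rewrite -ES in SSS.
  have c51 : 0 <= 51 / 25 :> R by lra.
  have vS := vt SSS; rewrite -lee_fin -lebp_scaledE//.
  rewrite -sumEFin -big_filter.
  rewrite (eq_bigr (fun c => lebp (sq c))); last by move=> c _; rewrite lebp_hbox ?ltW.
  have in_s c : c \in [seq c <- L | wit c == S] -> c \in L /\ wit c = S.
    by rewrite mem_filter => /andP[/eqP].
  apply: (@sum_disjoint _ _ _ sq).
  - exact: filter_uniq.
  - by move=> c _; exact: measurable_hbox.
  - by move=> c c' _ _; exact: sq_disjoint.
  - move=> c /in_s[cL cS]; have [_ hS meet] := witP _ cL; rewrite cS in hS meet.
    have [f1 f2] := fine_cells SSS hS (@corner_sub _).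
    exact: cell_enlarged (vt SSS) f1 f2 meet.
  - exact: measurable_scaled.
apply: le_trans H; rewrite big_const_seq count_predT iter_addr_0 -(mulr_natr (w1 * w2)).
have [k1 k2 n0'] : [/\ 0 < K1%:R :> R, 0 < K2%:R :> R & 0 < n%:R :> R] by rewrite !ltr0n.
have D : 0 < K1%:R * K2%:R * (n%:R * n%:R) :> R by rewrite !mulr_gt0.
have E : w1 * w2 * (size L)%:R = (size L)%:R / (K1%:R * K2%:R * (n%:R * n%:R)).
  by rewrite !natrM; field; rewrite !gt_eqF.
rewrite E ler_pdivlMr//.
have sizeL' : 19 * (K1%:R * K2%:R * (n%:R * n%:R)) <= 20 * (size L)%:R :> R.
  by rewrite -!natrM ler_nat.
by move: sizeL'; set Y := (size L)%:R; set Z := K1%:R * K2%:R * (n%:R * n%:R); lra.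
Qed.

End shape.

(** * Choice of the shape of the boxes *)

Lemma exponents (j : nat) : (j < 5)%N ->
  [/\ (10 + 9 * j <= 46)%N, (46 - 9 * j <= 46)%N, (4 + (42 - 9 * j) = 46 - 9 * j)%N,
      (4 + (6 + 9 * j) = 10 + 9 * j)%N & (6 + 9 * j + (42 - 9 * j) = 48)%N].
Proof. by move=> ?; split; lia. Qed.

(** The shapes are separated by a factor [N ^ 9] while the extents of a heavy
    rectangle are determined up to factors of [N ^ 4]; the spare power of [N] absorbs the
    constants. *)
Lemma exponents_apart (j j' : nat) : (j < j')%N -> (j' < 5)%N ->
  (10 + 9 * j + (46 - 9 * j') <= 47)%N.
Proof. lia. Qed.

Lemma exponents_sub (k : nat) : (k <= 46)%N -> (k <= 48)%N /\ (2 <= 48 - k)%N.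
Proof. by move=> ?; split; lia. Qed.

Lemma inv_mesh (R : realType) (x K c : nat) : (0 < x)%N -> (0 < K)%N -> (0 < c)%N ->
  (K * (x * c))%:R^-1 <= (x%:R * c%:R)^-1 :> R.
Proof.
move=> x0 K0 c0; rewrite -natrM lef_pV2 ?posrE ?ltr0n ?muln_gt0 ?x0 ?K0 ?c0//.
by rewrite ler_nat leq_pmull.
Qed.

Lemma inv_mesh_width (R : realType) (x z : R) : 0 < x -> 1 <= z * (4 * (x * 9)) ->
  (x * 1800)^-1 + (x * 1800)^-1 <= z / 25.
Proof.
move=> x0 hz; have h : 0 < x * 900 by lra.
have -> : (x * 1800)^-1 + (x * 1800)^-1 = (x * 900)^-1 by field; rewrite gt_eqF.
by rewrite -div1r (ler_pdivrMr _ _ h); lra.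
Qed.

Section selection.
Context {R : realType} {I : choiceType}.
Local Notation lebp := (@lebp R).
Local Notation rect_data := (@rect_data R).
Variables (SS : set I) (t : I -> rect_data) (A' : R) (N : nat).
Hypotheses (A1 : 1 <= A') (NA : 16 * A' <= N%:R) (N75 : (75 <= N)%N).
Local Notation e := (N%:R^-1 : R).
Hypothesis vt : forall S, SS S -> valid (t S).
Hypothesis et : forall S, SS S -> ext1 (t S) * ext2 (t S) <= A' * e ^+ 48.
Hypothesis dt : forall S S', SS S -> SS S' -> S != S' ->
  scaled (24 / 25) (t S) `&` scaled (24 / 25) (t S') = set0.

Let N0 : (0 < N)%N. Proof. by exact: leq_trans N75. Qed.
Let e0 : 0 < e. Proof. by rewrite invr_gt0 ltr0n. Qed.
Let e75 : e <= 1 / 75.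
Proof. by rewrite div1r lef_pV2 ?posrE ?ltr0n// ler_nat. Qed.
Let Ae : 16 * A' * e <= 1.
Proof. by rewrite ler_pdivrMr ?ltr0n// mul1r. Qed.
Let e1 : e <= 1. Proof. by apply: le_trans e75 _; rewrite ler_pdivrMr// mul1r ler1n. Qed.

Let powE k : (N ^ k)%:R^-1 = e ^+ k.
Proof. by rewrite natrX exprVn. Qed.

Let e_anti i j : (i <= j)%N -> e ^+ j <= e ^+ i.
Proof. by move=> ij; apply: ler_wiXn2l ij; rewrite ?e1// ltW. Qed.

Let ex0 i : 0 < e ^+ i. Proof. exact: exprn_gt0. Qed.

(** A heavy rectangle has extents at least comparable to the sides of the box of
    shape [j], up to the factor [e ^+ 4 / 4]. *)
Let cls (j : nat) S := e ^+ (10 + 9 * j) < 4 * ext1 (t S) /\ e ^+ (46 - 9 * j) < 4 * ext2 (t S).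

(** A rectangle in two classes would be long in one direction and long in the other,
    against the bound on the product of its extents. *)
Let cls_disjoint (j j' : nat) S : SS S -> (j < j')%N -> (j' < 5)%N -> cls j S -> cls j' S -> False.
Proof.
move=> SSS jj j5 [h1 _] [_ h2]; have := et SSS.
rewrite leNgt => /negP; apply.
have p : e ^+ (10 + 9 * j) * e ^+ (46 - 9 * j') < (4 * ext1 (t S)) * (4 * ext2 (t S)).
  by apply: ltr_pM => //; exact: ltW.
have q : e ^+ 47 <= e ^+ (10 + 9 * j) * e ^+ (46 - 9 * j').
  by rewrite -exprD; apply: e_anti; exact: exponents_apart.
have q' : 16 * A' * e * e ^+ 47 <= e ^+ 47 by rewrite ler_piMl// ltW.
have -> : A' * e ^+ 48 = (16 * A' * e * e ^+ 47) / 16 by rewrite (exprS e 47); field; rewrite pnatr_eq0 -lt0n.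
by move: p q q'; set z := e ^+ 47; set w := e ^+ (_ + _) * _; set u := 16 * A' * e * z; lra.
Qed.

(** As the product of the extents is at most [A' * e ^+ 48], a lower bound for one of
    them is an upper bound for the other. *)
Let cls_small (j : nat) S : SS S -> (j < 5)%N -> cls j S -> 3 * ext1 (t S) <= 1 / 100 /\ 3 * ext2 (t S) <= 1 / 100.
Proof.
move=> SSS j5 [h1 h2]; have v := vt SSS; have E := et SSS.
have [x1 x2] := (ext1_gt0 v, ext2_gt0 v).
have A0 : 0 < A' by exact: lt_le_trans A1.
have L (x y : R) k : (k <= 46)%N -> 0 < x -> e ^+ k < 4 * y -> x * y <= A' * e ^+ 48 -> 3 * x <= 1 / 100.
  move=> k46 x0 hk xy.
  have : x * e ^+ k <= 4 * A' * e ^+ 48.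
    apply: le_trans (_ : x * (4 * y) <= _); first by rewrite ler_pM2l// ltW.
    by rewrite mulrCA -mulrA ler_pM2l.
  have [k48 k2] := exponents_sub k46.
  have E48 := exprD e (48 - k) k; rewrite subnK // in E48.
  rewrite E48 mulrA (ler_pM2r (ex0 k)) => hx.
  have h2' : e ^+ (48 - k) <= e ^+ 2 by exact: e_anti.
  have : 4 * A' * e ^+ (48 - k) <= 4 * A' * e ^+ 2 by rewrite ler_pM2l// mulr_gt0.
  have : 4 * A' * e ^+ 2 <= e / 4.
    rewrite (_ : 4 * A' * e ^+ 2 = 16 * A' * e * (e / 4)); last by field; rewrite pnatr_eq0 -lt0n.
    by rewrite ler_piMl// divr_ge0// ltW.
  by move: e75 hx; set z := 4 * A' * e ^+ 2; set w := 4 * A' * _; set u := e; lra.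
have [E1 E2 _ _ _] := exponents j5.
split; first exact: (L _ (ext2 (t S)) (46 - 9 * j)%N).
by apply: (L _ (ext1 (t S)) (10 + 9 * j)%N) => //; rewrite mulrC.
Qed.

Let K1 j := (N ^ (6 + 9 * j))%N.
Let K2 j := (N ^ (42 - 9 * j))%N.
Let n := (N ^ 52 * 1800)%N.

Let mbox (S : I) q a b : measurable (scaled 2 (t S) `&` hbox q a b).
Proof. by apply: measurableI; [exact: measurable_scaled|exact: measurable_hbox]. Qed.

(** The part of the doubled rectangle inside the box has area at most four times an
    extent times the opposite side of the box. *)
Let heavy_cls (j : nat) S q : SS S -> (j < 5)%N ->
  heavy (t S) (e ^+ 4) (K1 j)%:R^-1 (K2 j)%:R^-1 q -> cls j S.
Proof.
move=> SSS j5; rewrite /heavy !powE => h; have v := vt SSS.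
have [_ _ E3 E4 _] := exponents j5.
have [b1 b2] := (ex0 (6 + 9 * j), ex0 (42 - 9 * j)).
have s1 := area_le_ext1 v (mbox S q _ _) (@subIsetl _ _ _) (@subIsetr _ _ _) (ltW b2).
have s2 := area_le_ext2 v (mbox S q _ _) (@subIsetl _ _ _) (@subIsetr _ _ _) (ltW b1).
split.
  have := lt_le_trans h (s1 _); rewrite mulrA ltr_pM2r// -exprD.
  by rewrite E4.
have := lt_le_trans h (s2 _); rewrite mulrCA mulrC ltr_pM2r// -exprD.
by rewrite E3.
Qed.

(** A rectangle whose width is comparable to the mesh would not be heavy, by [area_thin]. *)
Let fine_cells (j : nat) S q : SS S -> (j < 5)%N ->
  heavy (t S) (e ^+ 4) (K1 j)%:R^-1 (K2 j)%:R^-1 q ->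
  hbox q (K1 j)%:R^-1 (K2 j)%:R^-1 `<=` cbox 0 1 1 ->
  (K1 j * n)%:R^-1 + (K2 j * n)%:R^-1 <= len (t S) / 25 /\
  (K1 j * n)%:R^-1 + (K2 j * n)%:R^-1 <= wid (t S) / 25.
Proof.
move=> SSS j5 h qb; have v := vt SSS.
have [_ _ _ _ E5] := exponents j5.
have x0 : 0 < (N ^ 52)%:R :> R by rewrite ltr0n expn_gt0 N0.
have W K : (0 < K)%N -> (K * n)%:R^-1 <= ((N ^ 52)%:R * 1800)^-1 :> R.
  by move=> K0; apply: inv_mesh K0 _ => //; rewrite expn_gt0 N0.
have W1 := W (K1 j) _; have W2 := W (K2 j) _.
have B (z : R) : ~ (z * (4 * (N ^ 52 * 9)%:R) < 1) ->
    (K1 j * n)%:R^-1 + (K2 j * n)%:R^-1 <= z / 25.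
  move=> /negP; rewrite -leNgt => hz.
  have p1 : (0 < K1 j)%N by rewrite expn_gt0 N0.
  have p2 : (0 < K2 j)%N by rewrite expn_gt0 N0.
  apply: le_trans (lerD (W1 p1) (W2 p2)) _.
  rewrite natrM in hz; exact: inv_mesh_width.
have T (P : Prop) : P -> (P -> (N ^ 52 * 9)%:R * area (scaled 2 (t S) `&` hbox q (K1 j)%:R^-1 (K2 j)%:R^-1) <= 9) -> False.
  move=> p /(_ p); move: h; rewrite /heavy; set m := area _ => h.
  rewrite leNgt => /negP; apply.
  apply: le_lt_trans (_ : (N ^ 52 * 9)%:R * (e ^+ 4 * ((K1 j)%:R^-1 / (K2 j)%:R)) < _); last first.
    by rewrite ltr_pM2l// natrM mulr_gt0.
  rewrite !powE -!exprD E5.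
  have -> : e ^+ (4 + 48) = (N ^ 52)%:R^-1 by rewrite natrX exprVn.
  by rewrite natrM mulrAC mulfV ?mul1r// gt_eqF.
have TT := area_thin v (mbox S q (K1 j)%:R^-1 (K2 j)%:R^-1) (@subIsetl _ _ _) (subset_trans (@subIsetr _ _ _) qb) (n := (N ^ 52 * 9)%N).
have n9 : (0 < N ^ 52 * 9)%N by rewrite muln_gt0 expn_gt0 N0.
by split; apply: B => hz; [apply: (T _ (or_introl hz))|apply: (T _ (or_intror hz))]; exact: TT.
Qed.

(** The classes for the five shapes are disjoint, so all these cores are disjoint
    parts of a slight enlargement of the unit square. *)
Let core_disjoint_sum (X : 'I_5 -> seq I) :
  (forall j, uniq (X j)) ->
  (forall j S, S \in X j -> SS S /\ exists q, hbox q (K1 j)%:R^-1 (K2 j)%:R^-1 `<=` cbox 0 1 1 /\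
     heavy (t S) (e ^+ 4) (K1 j)%:R^-1 (K2 j)%:R^-1 q) ->
  \sum_(j < 5) \sum_(S <- X j) core (t S) <= (51 / 50) ^+ 2.
Proof.
move=> uX hX.
have c0 : 0 <= 24 / 25 :> R by lra.
pose L := [seq (j, s) | j <- enum 'I_5, s <- X j].
have inL p : p \in L -> p.2 \in X p.1 by case/allpairsPdep => j [S [_ SX ->]].
have -> : \sum_(j < 5) \sum_(S <- X j) core (t S) = \sum_(p <- L) core (t p.2).
  by rewrite big_allpairs_dep /= big_enum.
have w0 : 0 <= 51 / 50 :> R by lra.
rewrite expr2 -lee_fin -(lebp_cbox (- 1 / 100, - 1 / 100) w0 w0) -sumEFin.
rewrite (eq_big_seq (fun p => lebp (scaled (24 / 25) (t p.2)))); last first.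
  by move=> p /inL/hX[pS _]; rewrite lebp_scaledE//; exact: vt.
apply: (@sum_disjoint _ _ _ (fun p => scaled (24 / 25) (t p.2))).
- by apply: allpairs_uniq_dep; [exact: enum_uniq|move=> j _; exact: uX|move=> [j S] [j' S'] _ _ /= [-> ->]].
- by move=> p _; exact: measurable_scaled.
- move=> [j S] [j' S'] /inL /= Sj /inL /= S'j' ne.
  have [[SSS [q [_ hq]]] [SSS' [q' [_ hq']]]] := (hX _ _ Sj, hX _ _ S'j').
  have C := heavy_cls SSS (ltn_ord j) hq; have C' := heavy_cls SSS' (ltn_ord j') hq'.
  have [SE|/dt ->//] := eqVneq S S'.
  rewrite -SE in C'; exfalso.
  have [jj|jj|jj] := ltngtP j j'.
  + exact: cls_disjoint SSS jj (ltn_ord j') C C'.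
  + exact: cls_disjoint SSS jj (ltn_ord j) C' C.
  + by move/eqP: ne; apply; rewrite SE; congr pair; exact: val_inj.
- move=> [j S] /inL /= Sj; have [SSS [q [qb hq]]] := hX _ _ Sj.
  have [x1 x2] := cls_small SSS (ltn_ord j) (heavy_cls SSS (ltn_ord j) hq).
  have v := vt SSS.
  have [z [Tz qz]] : scaled 2 (t S) `&` hbox q (K1 j)%:R^-1 (K2 j)%:R^-1 !=set0.
    apply/set0P/eqP => z; move: hq; rewrite /heavy z /area measure0 /= !powE.
    by rewrite ltNge => /negP; apply; apply: mulr_ge0; [|apply: mulr_ge0]; exact: ltW.
  have [/= /andP[z1 z2] /andP[z3 z4]] := qb _ qz.
  have [y1 y2] := scaled_bbox v (ler0n _ 2) Tz.
  move=> y Sy.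
  have Sy1 : scaled 1 (t S) y by apply: scaled_mono Sy => //; lra.
  have [y3 y4] := scaled_bbox v ler01 Sy1.
  have Q (c ex zz yy : R) : 3 * ex <= 1 / 100 -> `|zz - c| <= 2 * ex -> `|yy - c| <= 1 * ex ->
      0 <= zz -> zz <= 0 + 1 -> - 1 / 100 <= yy <= - 1 / 100 + 51 / 50.
    by rewrite !ler_norml => ? /andP[? ?] /andP[? ?] ? ?; apply/andP; split; lra.
  by split; [exact: Q x1 y1 y3 z1 z2|exact: Q x2 y2 y4 z3 z4].
- exact: measurable_cbox.
Qed.

(** If no shape admitted a good box, each of the five families of heavy rectangles
    would have enlargements of total area at least .95. The ratio of an enlargement
    to its core is (17 / 8)^2 = 289 / 64 in area, so the disjoint cores would have
    total area more than 1.05, too much for the unit square and a margin of .01. *)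
Theorem selection : exists (a b : R) (q r : R * R) (P : seq (R * R)),
  [/\ [/\ 0 < a, 0 < b, a <= 1, b <= 1 & a * b = e ^+ 48],
      [/\ 0 < r.1, 0 < r.2, r.1 <= e ^+ 48 / 4 & r.2 <= e ^+ 48 / 4],
      [/\ 0 <= q.1, q.1 + a <= 1, 0 <= q.2 & q.2 + b <= 1],
      uniq P /\ a * b / 80 <= (size P)%:R * (r.1 * r.2) &
      [/\ forall p, p \in P -> cell r p `<=` hbox q a b,
        forall p p', p \in P -> p' \in P -> p != p' -> cell r p `&` cell r p' = set0 &
        forall S p, SS S -> heavy (t S) (e ^+ 4) a b q -> p \in P -> cell r p `&` scaled 2 (t S) = set0]].
Proof.
have n0 : (0 < n)%N by rewrite /n muln_gt0 expn_gt0 N0.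
have k1 j : (0 < K1 j)%N by rewrite expn_gt0 N0.
have k2 j : (0 < K2 j)%N by rewrite expn_gt0 N0.
have D (j : 'I_5) := @shape_dichotomy R I SS t (e ^+ 4) (K1 j) (K2 j) n (k1 j) (k2 j) n0 vt
  (fun S q SSS h qb => fine_cells SSS (ltn_ord j) h qb).
have [[j [q [P [h1 [h2 h3] h4 h5 h6]]]]|no] := pselect (exists j : 'I_5, exists (q : R * R) (P : seq (R * R)),
    [/\ [/\ 0 <= q.1, q.1 + (K1 j)%:R^-1 <= 1, 0 <= q.2 & q.2 + (K2 j)%:R^-1 <= 1],
        uniq P /\ (n * n <= 20 * size P)%N,
        forall p, p \in P -> cell ((K1 j * n)%:R^-1 / 2, (K2 j * n)%:R^-1 / 2) p `<=` hbox q (K1 j)%:R^-1 (K2 j)%:R^-1,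
        forall p p', p \in P -> p' \in P -> p != p' ->
          cell ((K1 j * n)%:R^-1 / 2, (K2 j * n)%:R^-1 / 2) p `&`
          cell ((K1 j * n)%:R^-1 / 2, (K2 j * n)%:R^-1 / 2) p' = set0 &
        forall S p, SS S -> heavy (t S) (e ^+ 4) (K1 j)%:R^-1 (K2 j)%:R^-1 q -> p \in P ->
          cell ((K1 j * n)%:R^-1 / 2, (K2 j * n)%:R^-1 / 2) p `&` scaled 2 (t S) = set0]).
  exists (K1 j)%:R^-1, (K2 j)%:R^-1, q, ((K1 j * n)%:R^-1 / 2, (K2 j * n)%:R^-1 / 2), P.
  have [_ _ _ _ E5] := exponents (ltn_ord j).
  have E0 : (K1 j)%:R^-1 * (K2 j)%:R^-1 = e ^+ 48 by rewrite !powE -exprD E5.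
  have Kp K : (0 < K)%N -> (0 < K%:R^-1 :> R) /\ (K%:R^-1 <= 1 :> R).
    by move=> K0; rewrite invr_gt0 ltr0n K0 invf_le1 ?ltr0n// ler1n.
  have small K : (0 < K)%N -> (K * n)%:R^-1 / 2 <= e ^+ 48 / 4.
    move=> K0; have x0 : (0 < N ^ 52)%N by rewrite expn_gt0 N0.
    have h := @inv_mesh R (N ^ 52) K 1800 x0 K0 isT.
    apply: le_trans (_ : ((N ^ 52)%:R * 1800)^-1 / 2 <= _); first by rewrite ler_pM2r ?invr_gt0.
    have e52 : (N ^ 52)%:R^-1 <= e ^+ 48 by rewrite natrX -exprVn; exact: e_anti.
    by rewrite invfM; move: e52 (ex0 48); set y := e ^+ 48; set z := (N ^ 52)%:R^-1; lra.
  have [[a0 a1] [b0 b1]] := (Kp _ (k1 j), Kp _ (k2 j)).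
  have m1 : (0 < K1 j * n)%N by rewrite muln_gt0 k1.
  have m2 : (0 < K2 j * n)%N by rewrite muln_gt0 k2.
  split => //.
  - by split; [rewrite divr_gt0 ?invr_gt0 ?ltr0n|rewrite divr_gt0 ?invr_gt0 ?ltr0n|exact: small|exact: small].
  - split => //=.
    have [y1 [y2 y3]] : 0 < (K1 j)%:R :> R /\ 0 < (K2 j)%:R :> R /\ 0 < n%:R :> R by rewrite !ltr0n k1 k2.
    have -> : (K1 j * n)%:R^-1 / 2 * ((K2 j * n)%:R^-1 / 2) =
        (K1 j)%:R^-1 * (K2 j)%:R^-1 / 4 / (n%:R * n%:R) :> R.
      rewrite (natrM _ (K1 j) n) (natrM _ (K2 j) n).
      by move: y1 y2 y3; set k := (K1 j)%:R; set l := (K2 j)%:R; set m := n%:R => *; field; rewrite !gt_eqF.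
    rewrite [_ * (_ / (n%:R * n%:R))]mulrA ler_pdivlMr ?mulr_gt0//.
    have h : n%:R * n%:R <= 20 * (size P)%:R :> R by rewrite -!natrM ler_nat.
    rewrite E0; have := ler_wpM2l (ltW (ex0 48)) h.
    by set y := e ^+ 48; set z := (size P)%:R; rewrite -[y / 80 * _]mulrA; lra.
have hX (j : 'I_5) : exists X : seq I, [/\ uniq X,
     forall S, S \in X -> SS S /\ exists q, hbox q (K1 j)%:R^-1 (K2 j)%:R^-1 `<=` cbox 0 1 1 /\
       heavy (t S) (e ^+ 4) (K1 j)%:R^-1 (K2 j)%:R^-1 q &
     95 / 100 <= \sum_(S <- X) area (scaled (51 / 25) (t S))].
  by case: (D j) => // h; exfalso; apply: no; exists j.
have [X XP] := choice hX.
have := core_disjoint_sum (fun j => let: And3 u _ _ := XP j in u) (fun j => let: And3 _ h _ := XP j in h).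
have : \sum_(j < 5) 95 / 100 <= \sum_(j < 5) (289 / 64 * \sum_(S <- X j) core (t S)).
  apply: ler_sum => j _; have [_ hS h] := XP j; apply: le_trans h _.
  rewrite mulr_sumr big_seq [X in _ <= X]big_seq; apply: ler_sum => S SX.
  have v := vt (hS S SX).1; rewrite /core (@area_scaled _ (51 / 25) _ v); last by lra.
  rewrite (@area_scaled _ (24 / 25) _ v); last by lra.
  by rewrite le_eqVlt; apply/orP; left; apply/eqP; field.
have -> : \sum_(j < 5) 95 / 100 = 475 / 100 :> R by rewrite !big_ord_recr big_ord0 /=; field.
rewrite -mulr_sumr; set s := \sum_(j < 5) _; lra.
Qed.

End selection.

(** * Norms of the rectangle projections *)

Section adapted_facts.
Context {R : realType}.
Local Notation mR := (measurableTypeR R).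
Local Notation lebp := (@lebp R).
Local Notation rect_data := (@rect_data R).

(** Differentiability of the function itself is the instance for the empty list of
    directions. *)
Lemma smooth_continuous (g : R * R -> R) : smooth g -> continuous g.
Proof. by move=> sg x; apply: differentiable_continuous; exact: (sg [::] x). Qed.

Lemma CLnorm1_integrable (f : mR * mR -> R[i]) (c : R) : Cmeas f ->
  (CLnorm (@leb2 R) 1 f <= c%:E)%E -> Cintegrable lebp f.
Proof.
move=> mf fc; apply: (@CI_le _ _ _ lebp f (fun x => cabs (f x))) => //.
have mc : measurable_fun setT (fun x : mR * mR => (cabs (f x))%:E).
  by apply/measurable_EFinP; exact: measurable_cabs.
apply/integrableP; split => //.
apply: le_lt_trans (ltry c); move: fc; rewrite /CLnorm Lnorm1.
by [].
Qed.

Variables (t : rect_data) (Xi : R * R -> R[i]).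
Hypothesis aXi : adapted (ctr t) (scaled 1 t) Xi.

Lemma adapted_integrable : Cintegrable lebp Xi.
Proof.
have [[s1 s2] _ _ _ nXi] := aXi; apply: CLnorm1_integrable nXi.
by split; apply: continuous_measurable_plane; exact: smooth_continuous.
Qed.

Lemma adapted_cabs_le1 s : cabs (fourier2 Xi s) <= 1.
Proof.
have [_ _ /(_ s) + _ _] := aXi; set z := fourier2 Xi s; case: z => x y.
rewrite !lecE /= => /andP[/andP[/eqP -> x0] /andP[_ x1]].
by rewrite cabsE /= expr0n addr0 sqrtr_sqr ger0_norm.
Qed.

Lemma adapted_vanish s : ~ scaled 2 t s -> fourier2 Xi s = 0.
Proof.
have [_ sup _ _ _] := aXi => ns; apply/eqP; apply: contrapT => /negP nz; apply: ns.
have [y Sy <-] := sup s ((@subset_closure _ [set x : R * R | fourier2 Xi x != 0]) s nz).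
case: Sy => h1 h2; rewrite !mul1r in h1 h2.
have E u : dot2 (ctr t + 2 *: (y - ctr t) - ctr t) u = 2 * dot2 (y - ctr t) u.
  by rewrite /dot2 /= /GRing.scale /=; ring.
by split; rewrite E normrM ger0_norm// ler_pM2l.
Qed.

End adapted_facts.

Section fourth_power.
Context {R : realType} {d : measure_display} {T : measurableType d}.
Variable mu : {measure set T -> \bar R}.
Local Open Scope ereal_scope.

Lemma CLnorm_ge0 p (f : T -> R[i]) : 0 <= CLnorm mu p f.
Proof. exact: Lnorm_ge0. Qed.

Lemma CLnorm4E (f : T -> R[i]) :
  CLnorm mu 4 f `^ 4 = \int[mu]_x ((cabs (f x) ^+ 4)%R)%:E.
Proof.
rewrite /CLnorm poweR_Lnorm//; apply: eq_integral => x _.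
by rewrite abse_EFin poweR_EFin powR_mulrn// ger0_norm// cabs_ge0.
Qed.

Lemma CLnorm4_le (f : T -> R[i]) (y : R) : (0 <= y)%R ->
  \int[mu]_x ((cabs (f x) ^+ 4)%R)%:E <= ((y ^+ 2)%R)%:E -> CLnorm mu 4 f ^+ 2 <= y%:E.
Proof.
move=> y0; rewrite -CLnorm4E; have := CLnorm_ge0 4 f; case: (CLnorm mu 4 f) => [s| |]//=.
  rewrite lee_fin => s0; rewrite powR_mulrn// lee_fin => h.
  rewrite -EFinM lee_fin -expr2.
  by rewrite -(@ler_pXn2r _ 2) ?nnegrE ?sqr_ge0// -exprM.
by rewrite pnatr_eq0 /= leye_eq.
Qed.

Lemma CLnorm4_ge (f : T -> R[i]) (x : R) : (0 <= x)%R -> CLnorm mu 4 f <= x%:E ->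
  \int[mu]_x ((cabs (f x) ^+ 4)%R)%:E <= ((x ^+ 4)%R)%:E.
Proof.
move=> x0; rewrite -CLnorm4E; have := CLnorm_ge0 4 f; case: (CLnorm mu 4 f) => [s| |]//=.
rewrite !lee_fin => s0 sx; rewrite powR_mulrn//.
by rewrite ler_pXn2r ?nnegrE.
Qed.

End fourth_power.

Section disjoint_cells.
Context {R : realType}.
Local Notation mR := (measurableTypeR R).
Local Notation lebp := (@lebp R).
Variables (P : seq (R * R)) (r : R * R) (Xi : mR * mR -> R[i]) (D E : set (mR * mR)).
Hypotheses (r1 : 0 < r.1) (r2 : 0 < r.2) (uP : uniq P).
Hypothesis dP : forall p p', p \in P -> p' \in P -> p != p' -> cell r p `&` cell r p' = set0.
Hypothesis XiD : forall s, ~ D s -> fourier2 Xi s = 0.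
Hypothesis Xi1 : forall s, cabs (fourier2 Xi s) <= 1.
Hypothesis cellE : forall p, p \in P -> cell r p `&` D `<=` E.

Lemma tent2_out (p s : R * R) : ~ cell r p s -> tent2 r p s = 0.
Proof.
move=> ns; rewrite /tent2; have [h1|h1] := leP r.1 `|s.1 - p.1|; first by rewrite tent_out// mul0r.
have [h2|h2] := leP r.2 `|s.2 - p.2|; first by rewrite [X in _ * X]tent_out// mulr0.
exfalso; apply: ns; move: h1 h2; rewrite !ltr_norml => /andP[? ?] /andP[? ?].
by split; rewrite /=; apply/andP; split; lra.
Qed.

Lemma tent2_le1 (p s : R * R) : tent2 r p s <= 1.
Proof. by rewrite /tent2 mulr_ile1 ?tent_ge0 ?tent_le1. Qed.

Lemma sum_tent2_le1 (s : R * R) : \sum_(p <- P) tent2 r p s <= 1.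
Proof.
have [[p [pP sp]]|no] := pselect (exists p, p \in P /\ cell r p s).
  rewrite (bigD1_seq p)//= big_seq_cond big1 ?addr0 ?tent2_le1// => p' /andP[p'P ne].
  by apply: tent2_out => sp'; have : (cell r p' `&` cell r p) s by []; rewrite dP.
rewrite big_seq big1// => p pP; apply: tent2_out => sp; apply: no; by exists p.
Qed.

(** At most one tent is nonzero at a given point, and the Fourier transform of [Xi]
    vanishes outside [D]. *)
Lemma slice_le (tt : R) (s : R * R) : cabs (slice P r Xi tt s) <= \1_E s.
Proof.
have key : cabs (slice P r Xi tt s) <= (\sum_(p <- P) tent2 r p s) * cabs (fourier2 Xi s).
  apply: le_trans (cabs_sum _ _ _) _; rewrite mulr_suml; apply: ler_sum => p _.
  by rewrite cabsM cabs_e2pi mul1r /piece cabsM cabs_real ger0_norm ?tent2_ge0.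
rewrite indicE; have [Es|sE] := pselect (E s).
  rewrite mem_set//.
  by apply: le_trans key _; rewrite mulr_ile1 ?cabs_ge0 ?sum_tent2_le1// sumr_ge0// => p _; exact: tent2_ge0.
rewrite memNset//; apply: le_trans key _.
have [Ds|/XiD ->] := pselect (D s); last by rewrite cabs0 mulr0.
rewrite big_seq big1 ?mul0r// => p pP; apply: tent2_out => sp; apply: sE.
exact: (cellE pP).
Qed.

Lemma rect_proj_cells (r3 : R) : 0 < r3 -> Cintegrable lebp Xi -> measurable E ->
  (exists q a b, [/\ 0 <= a, 0 <= b & E `<=` cbox q a b]) ->
  (\int[leb3 R]_x (cabs (rect_proj Xi (wave P r r3) x) ^+ 4)%:E <=
    (4 * gconst R ^+ 3 * (r3 * area E) ^+ 3)%:E)%E.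
Proof.
move=> r30 iXi mE [q [a [b [a0 b0 Eq]]]].
have fE := areaE a0 b0 mE Eq.
have iE : lebp.-integrable setT (fun s => (\1_E s)%:E).
  apply/integrableP; split; first by apply/measurable_EFinP; exact: measurable_indic.
  rewrite (eq_integral (fun s => (\1_E s)%:E)); last by move=> s _; rewrite gee0_abs// lee_fin.
  by rewrite integral_indic// setIT -[X in (X < _)%E]/(lebp E) fE; exact: ltry.
have -> : area E = \int[lebp]_s \1_E s.
  by rewrite /Rintegral integral_indic// setIT.
apply: rect_proj_L4 => //; first exact: slice_le.
Qed.

End disjoint_cells.

(** * The decoupling inequality at a single scale *)

Section scales.
Context {R : realType}.
Local Notation mR := (measurableTypeR R).
Local Notation rect_data := (@rect_data R).

(** In the supremum norm, a ball of radius a fiftieth of the short half-side moves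
    both coordinates along the axes by at most a twenty-fifth of it. *)
Lemma scaled_interior (t : rect_data) : valid t -> scaled (24 / 25) t `<=` interior (scaled 1 t : set (R * R)).
Proof.
move=> vt x Sx; have [u1 l0 w0] := vt.
pose m := Num.min (len t) (wid t); have m0 : 0 < m by rewrite lt_min l0.
apply/nbhs_ballP; exists (m / 50) => /=; first by rewrite divr_gt0.
move=> y [h1 h2].
have {}h1 : `|y.1 - x.1| <= m / 50 by rewrite distrC; exact: ltW.
have {}h2 : `|y.2 - x.2| <= m / 50 by rewrite distrC; exact: ltW.
have [ml mw] : m <= len t /\ m <= wid t by rewrite !ge_min !lexx orbT.
have K (u : R * R) : dot2 u u = 1 -> `|dot2 (y - x) u| <= m / 25.
  rewrite /dot2 => uu; apply: le_trans (ler_normD _ _) _; rewrite !normrM.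
  have [n1 n2] : `|u.1| <= 1 /\ `|u.2| <= 1 by rewrite !ler_norml; split; nra.
  rewrite (_ : m / 25 = m / 50 + m / 50); last by field.
  by apply: lerD; apply: le_trans (ler_piMr _ _) _.
have pu : dot2 (- (dir t).2, (dir t).1) (- (dir t).2, (dir t).1) = 1.
  by rewrite -u1 /dot2 /=; ring.
have E (u : R * R) : dot2 (y - ctr t) u = dot2 (x - ctr t) u + dot2 (y - x) u.
  by rewrite /dot2 /=; ring.
have [Sx1 Sx2] := Sx; split; rewrite E; apply: le_trans (ler_normD _ _) _.
  by have := K _ u1; move: Sx1; set z1 := `|_|; set z2 := `|_|; lra.
by have := K _ pu; move: Sx2; set z1 := `|_|; set z2 := `|_|; lra.
Qed.

Lemma esum_le (I : choiceType) (SS : set I) (F : I -> \bar R) (Y : \bar R) :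
  (forall s : seq I, uniq s -> (forall i, i \in s -> SS i) -> (\sum_(i <- s) F i <= Y)%E) ->
  (\esum_(i in SS) F i <= Y)%E.
Proof.
move=> H; apply: ge_ereal_sup => _ [X [fX XS] <-].
rewrite fsbig_finite//; apply: H; first exact: finmap.fset_uniq.
by move=> i; rewrite in_fset_set// inE => /XS.
Qed.

Lemma quarter_le (y u : R) : 0 < y -> u <= y / 4 -> u <= y.
Proof. lra. Qed.

Lemma half_le (y : R) : 0 < y -> y / 2 <= y.
Proof. lra. Qed.

Lemma packet_mass (s u v y : R) : 0 < y -> y / 80 <= s * (u * v) ->
  y ^+ 2 / 2560 <= s * (u * v * (y / 2) / 16).
Proof. by move=> y0 h; have := ler_wpM2r (ltW y0) h; lra. Qed.

Section scale.
Variables (Xi : set (R * R) -> R * R -> R[i]).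
Hypothesis hXi : forall (c u : R * R) (a b : R), rectangle_params u a b ->
  adapted c (rectangle c u a b) (Xi (rectangle c u a b)).
Variables (A K : R) (N : nat) (SS : set (set (R * R))).
Hypotheses (A1 : 1 <= A) (NA : 20 * A <= N%:R) (N75 : (75 <= N)%N).
Local Notation e := (N%:R^-1 : R).
Local Notation delta := (e ^+ 48).
Hypothesis rectSS : forall S, SS S -> is_rectangle S.
Hypothesis disjSS : forall S1 S2, SS S1 -> SS S2 -> S1 <> S2 -> interior S1 `&` interior S2 = set0.
Hypothesis flatSS : forall S, SS S -> flat (@hyperbolic R) (A * delta) S.
Hypothesis dec : l2L4_decoupling Xi (@hyperbolic R) delta K SS.

(** Test the inequality on the wave whose frequencies are the centres of the cells
    given by [selection]. The projections to heavy rectangles vanish, and those to the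
    others have fourth powers of norms bounded by [m ^+ 3], for [m] the area of the
    doubled rectangle inside the box; [sum_area_sqrt] with [zeta = e] sums the
    [m ^ (3 / 2)]. Both sides scale like [delta ^+ 6], which cancels. *)
Lemma decoupling_scale :
  8 * 48^-1 ^+ 3 * 2560^-1 ^+ 4 <=
  K ^+ 4 * (gconst R ^+ 3 / 2 * (336 ^+ 2 * (5 / 4 * A) ^+ 2) ^+ 2) * e ^+ 2.
Proof.
have e0 : 0 < e by rewrite invr_gt0 ltr0n (leq_trans _ N75).
have d0 : 0 < delta by exact: exprn_gt0.
have [t tP] : {t : set (R * R) -> rect_data & forall S, SS S -> valid (t S) /\ S = scaled 1 (t S)}.
  apply: (@choice _ _ (fun S t => SS S -> valid t /\ S = scaled 1 t)) => S.
  have [SSS|nS] := pselect (SS S); last by exists (RectData 0 0 0 0).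
  have [c [u [a [b [p ->]]]]] := rectSS SSS.
  by exists (RectData c u a b) => _; split => //; rewrite /scaled !mul1r.
pose A' := 5 / 4 * A.
have A'1 : 1 <= A' by rewrite /A'; move: A1; lra.
have NA' : 16 * A' <= N%:R by rewrite /A'; move: NA; lra.
have vt S : SS S -> valid (t S) by move=> /tP[].
have et S : SS S -> ext1 (t S) * ext2 (t S) <= A' * delta.
  move=> SSS; have [v SE] := tP S SSS; rewrite /A' -mulrA; apply: ext_flat => //.
  by rewrite -SE; exact: flatSS.
have dt S S' : SS S -> SS S' -> S != S' ->
    scaled (24 / 25) (t S) `&` scaled (24 / 25) (t S') = set0.
  move=> SSS SSS' /eqP ne; apply/seteqP; split => // x [x1 x2].
  have [v SE] := tP S SSS; have [v' SE'] := tP S' SSS'.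
  rewrite -(disjSS SSS SSS' ne); split; [rewrite SE|rewrite SE']; exact: scaled_interior.
have [a [b [q [r [P [[a0 b0 a1 b1 ab] [r1 r2 r1d r2d] [q1 q1a q2 q2b] [uP sP] [Pq Pd Ph]]]]]]] :=
  selection A'1 NA' N75 vt et dt.
have r30 : 0 < delta / 2 by rewrite divr_gt0.
pose f := wave P r (delta / 2).
have PQ p : p \in P -> (q.1 <= p.1 <= q.1 + a) /\ (q.2 <= p.2 <= q.2 + b).
  move=> pP; have : cell r p p by split => /=; apply/andP; split; lra.
  by move=> /(Pq p pP)[/andP[-> /ltW ->] /andP[-> /ltW ->]].
have P01 p : p \in P -> (0 <= p.1 <= 1) /\ (0 <= p.2 <= 1).
  by move=> /PQ[/andP[? ?] /andP[? ?]]; split; apply/andP; split; lra.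
have sup : support_of (fourier3 f) `<=` neighborhood delta (graph01 (@hyperbolic R)).
  apply: support_wave => //.
  apply: le_lt_trans (_ : (delta / 4) ^+ 2 + (delta / 4) ^+ 2 + (delta / 2) ^+ 2 < _).
    by apply: lerD => //; apply: lerD; rewrite ler_pXn2r ?nnegrE// ?ltW// divr_ge0 ?ltW.
  by have := exprn_gt0 2 d0; move: delta => y; lra.
have := dec (CI_wave P r1 r2 r30) sup; rewrite -/f => H.
have dE : a * b = delta by [].
pose hv S := `[< heavy (t S) (e ^+ 4) a b q >].
(* the tents avoid the doubled heavy rectangles altogether *)
pose E S : set (mR * mR) := if hv S then set0 else scaled 2 (t S) `&` hbox q a b.
pose D0 := Num.sqrt (4 * gconst R ^+ 3 * (delta / 2) ^+ 3).
have G0 : 0 <= gconst R := gconst_ge0.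
have D00 : 0 <= D0 by exact: sqrtr_ge0.
have D02 : D0 ^+ 2 = 4 * gconst R ^+ 3 * (delta / 2) ^+ 3.
  by rewrite sqr_sqrtr// (mulr_ge0 (mulr_ge0 (ler0n _ 4) (exprn_ge0 3 G0)) (exprn_ge0 3 (ltW r30))).
have mE S : measurable (E S).
  rewrite /E; case: ifP => _; first exact: measurable0.
  by apply: measurableI; [exact: measurable_scaled|exact: measurable_hbox].
have Eq S : E S `<=` cbox q a b.
  rewrite /E; case: ifP => _ x //= [_ [/andP[h1 /ltW h2] /andP[h3 /ltW h4]]].
  by split; [rewrite h1 h2|rewrite h3 h4].
have bnd S : SS S -> (CLnorm (@leb3 R) 4 (rect_proj (Xi S) f) ^+ 2 <=
    (D0 * (area (E S) * Num.sqrt (area (E S))))%:E)%E.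
  move=> SSS; have [v SE] := tP S SSS; have m0 : 0 <= area (E S) by exact: area_ge0.
  have aXi : adapted (ctr (t S)) (scaled 1 (t S)) (Xi S).
    by rewrite (congr1 Xi SE); apply: hXi; have [? ? ?] := v; split => //; rewrite mul1r.
  apply: CLnorm4_le; first by rewrite !mulr_ge0 ?sqrtr_ge0.
  have iXi := adapted_integrable aXi.
  have cE p : p \in P -> cell r p `&` scaled 2 (t S) `<=` E S.
    move=> pP; rewrite /E; case: ifPn => [/asboolP h|_]; first by rewrite (Ph _ _ SSS h pP).
    by move=> x [x1 x2]; split => //; exact: Pq pP _ x1.
  apply: le_trans (rect_proj_cells r1 r2 uP Pd (adapted_vanish aXi) (adapted_cabs_le1 aXi) cE r30 iXi (mE S) _) _.
    by exists q, a, b; split => //; exact: ltW.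
  set m := area (E S) in m0 *.
  have -> : (D0 * (m * Num.sqrt m)) ^+ 2 = D0 ^+ 2 * (m ^+ 2 * Num.sqrt m ^+ 2) by ring.
  rewrite lee_fin D02 sqr_sqrtr// le_eqVlt; apply/orP; left; apply/eqP; ring.
pose Y := D0 * (336 ^+ 2 * A' ^+ 2 * e * (delta * Num.sqrt delta)).
have Y0 : 0 <= Y.
  apply: mulr_ge0 D00 (mulr_ge0 (mulr_ge0 (mulr_ge0 (sqr_ge0 _) (sqr_ge0 _)) (ltW e0)) _).
  exact: mulr_ge0 (ltW d0) (sqrtr_ge0 _).
have sumY : (\esum_(S in SS) CLnorm (@leb3 R) 4 (rect_proj (Xi S) f) ^+ 2 <= Y%:E)%E.
  apply: esum_le => s us sSS.
  apply: le_trans (_ : \sum_(S <- s) (D0 * (area (E S) * Num.sqrt (area (E S))))%:E <= _)%E.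
    by rewrite big_seq [X in (_ <= X)%E]big_seq; apply: lee_sum => S /sSS; exact: bnd.
  rewrite sumEFin lee_fin -mulr_sumr ler_wpM2l//.
  rewrite (bigID hv) /= big1 ?add0r; last first.
    by move=> S hS; rewrite /E hS /area measure0 mul0r.
  rewrite -big_filter; set s' := [seq _ <- _ | _].
  have in_s S : S \in s' -> SS S /\ ~ heavy (t S) (e ^+ 4) a b q.
    by rewrite mem_filter => /andP[/asboolPn h /sSS].
  rewrite (eq_big_seq (fun S => area (scaled 2 (t S) `&` hbox q a b) * Num.sqrt (area (scaled 2 (t S) `&` hbox q a b)))); last first.
    by move=> S /in_s[_ h]; rewrite /E /hv asboolF.
  rewrite -dE; apply: sum_area_sqrt => //.
  - exact: filter_uniq.
  - by move=> S /in_s[? _]; exact: vt.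
  - by move=> S /in_s[? _]; rewrite dE; exact: et.
  - by move=> S S' /in_s[? _] /in_s[? _]; exact: dt.
  - by move=> S /in_s[_ h]; rewrite leNgt; apply/negP.
pose x := `|K| * Num.sqrt Y.
have x0 : 0 <= x by rewrite mulr_ge0 ?sqrtr_ge0.
have fx : (CLnorm (@leb3 R) 4 f <= x%:E)%E.
  apply: le_trans H _; apply: le_trans (_ : `|K|%:E * sqrte Y%:E <= _)%E; last by rewrite /= -EFinM.
  apply: le_trans (_ : `|K|%:E * sqrte (\esum_(S in SS) CLnorm (@leb3 R) 4 (rect_proj (Xi S) f) ^+ 2) <= _)%E.
    by apply: lee_wpmul2r; rewrite ?sqrte_ge0// lee_fin ler_norm.
  by apply: lee_wpmul2l; rewrite ?lee_fin// lee_sqrt ?lee_fin.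
have low := wave_lower a0 b0 a1 b1 _ _ r1 r2 r30 _ _ _ PQ.
have := CLnorm4_ge x0 fx.
have : ((8 * 48^-1 ^+ 3 / (a * b) ^+ 2 * ((size P)%:R * (r.1 * r.2 * (delta / 2) / 16)) ^+ 4)%:E <=
   \int[leb3 R]_x (cabs (f x) ^+ 4)%:E)%E.
  apply: low; rewrite ?dE.
  - by rewrite q1 (le_trans _ q1a)// lerDl ltW.
  - by rewrite q2 (le_trans _ q2b)// lerDl ltW.
  - exact: quarter_le r1d.
  - exact: quarter_le r2d.
  - exact: half_le.
move=> /le_trans h /h {h low}; rewrite lee_fin dE => h.
have {}h : 8 * 48^-1 ^+ 3 * 2560^-1 ^+ 4 * delta ^+ 6 <= x ^+ 4.
  apply: le_trans h; rewrite -[_ * delta ^+ 6]mulrA -[X in _ <= X]mulrA; apply: ler_wpM2l.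
    by rewrite mulr_ge0// exprn_ge0// invr_ge0.
  have -> : 2560^-1 ^+ 4 * delta ^+ 6 = (delta ^+ 2)^-1 * (delta ^+ 2 / 2560) ^+ 4.
    by move: d0; move: delta => y y0; field; rewrite gt_eqF.
  apply: ler_wpM2l; first by rewrite invr_ge0 sqr_ge0.
  have u0 : 0 <= delta ^+ 2 / 2560 by exact: divr_ge0 (sqr_ge0 _) (ler0n _ _).
  have uv : delta ^+ 2 / 2560 <= (size P)%:R * (r.1 * r.2 * (delta / 2) / 16).
    by move: sP; rewrite dE; exact: packet_mass.
  by rewrite ler_pXn2r// nnegrE// (le_trans u0).
have d6 : 0 < delta ^+ 6 by exact: exprn_gt0.
rewrite -(ler_pM2r d6); apply: le_trans h _.
have K4 : `|K| ^+ 4 = K ^+ 4 by rewrite (exprM _ 2 2) real_normK ?num_real// -exprM.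
have Y2 : Y ^+ 2 = gconst R ^+ 3 / 2 * (336 ^+ 2 * A' ^+ 2) ^+ 2 * e ^+ 2 * delta ^+ 6.
  rewrite /Y exprMn D02 !exprMn sqr_sqrtr ?ltW//; move: delta e => y z; by field.
have sY : Num.sqrt Y ^+ 4 = Y ^+ 2 by rewrite (exprM _ 2 2) sqr_sqrtr.
rewrite /x exprMn K4 sY Y2 -/A' le_eqVlt; apply/orP; left; apply/eqP.
ring.
Qed.
End scale.

Lemma square_exceeds (B : R) (lo : nat) : exists M : nat, (lo <= M)%N /\ B < M%:R ^+ 2.
Proof.
exists (lo + (Num.truncn `|B|).+1)%N; split; first exact: leq_addr.
have h : B < (lo + (Num.truncn `|B|).+1)%:R.
  apply: le_lt_trans (ler_norm B) _; have /andP[_ /lt_le_trans] := truncn_itv (normr_ge0 B).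
  by apply; rewrite ler_nat leq_addl.
apply: lt_le_trans h _; rewrite expr2 ler_peMl// ler1n addnS//.
Qed.

(** With [delta = M ^- 1200] and [eps < 1 / 100] the loss is at most [M ^+ 12]. *)
Lemma powR_loss (M : nat) (eps : R) : (0 < M)%N -> 0 < eps < 100^-1 ->
  0 <= (((M ^ 25)%:R^-1 : R) ^+ 48) `^ (- eps) <= M%:R ^+ 12.
Proof.
move=> M0 /andP[eps0 eps1]; rewrite powR_ge0 /=.
have M1 : 1 <= M%:R :> R by rewrite ler1n.
have -> : (M ^ 25)%:R^-1 ^+ 48 = M%:R `^ (- (1200%:R)) :> R.
  by rewrite powRN powR_mulrn ?ler0n// natrX -exprVn -exprM -exprVn.
rewrite -powRrM -powR_mulrn ?ler0n//; apply: ler_powR => //.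
rewrite mulrNN; apply: le_trans (_ : 1200%:R * 100^-1 <= _).
  by rewrite ler_pM2l ?ltr0n//; exact: ltW.
rewrite le_eqVlt; apply/orP; left; apply/eqP; by field.
Qed.

End scales.

Theorem theorem5p1 (R : realType) (Xi : set (R * R) -> R * R -> R[i])
  (hXi : forall (c u : R * R) (a b : R), rectangle_params u a b ->
    adapted c (rectangle c u a b) (Xi (rectangle c u a b)))
  (eps A : R) (heps : 0 < eps < 100^-1) (hA : 1 <= A) :
  ~ exists C : R, forall delta : R, 0 < delta < 1 ->
    exists SS : set (set (R * R)),
      [/\ forall S, SS S -> is_rectangle S,
          forall S1 S2, SS S1 -> SS S2 -> S1 <> S2 ->
            interior S1 `&` interior S2 = set0,
          forall S, SS S -> flat (@hyperbolic R) (A * delta) S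
        & l2L4_decoupling Xi (@hyperbolic R) delta (C * delta `^ (- eps)) SS].
Proof.
move=> [C HC].
pose c1 := gconst R ^+ 3 / 2 * (336 ^+ 2 * (5 / 4 * A) ^+ 2) ^+ 2.
have c10 : 0 <= c1.
  by apply: mulr_ge0 (divr_ge0 (exprn_ge0 3 gconst_ge0) (ler0n _ 2)) (sqr_ge0 _).
pose L : R := 8 * 48^-1 ^+ 3 * 2560^-1 ^+ 4.
have L0 : 0 < L.
  by apply: mulr_gt0 (mulr_gt0 _ _) _; rewrite ?exprn_gt0 ?invr_gt0 ?ltr0n.
have [M [loM BM]] := square_exceeds (C ^+ 4 * c1 / L) (75 + (Num.truncn (20 * A)).+1).
have M75 : (75 <= M)%N by exact: leq_trans (leq_addr _ _) loM.
have M0 : (0 < M)%N by exact: leq_trans M75.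
have MN : (M <= M ^ 25)%N by rewrite -[X in (X <= _)%N]expn1 leq_pexp2l.
have NA : 20 * A <= (M ^ 25)%:R.
  have A20 : 0 <= 20 * A by rewrite mulr_ge0// (le_trans _ hA).
  have /andP[_ /ltW h] := truncn_itv A20; apply: le_trans h _.
  by rewrite ler_nat (leq_trans _ MN)// (leq_trans _ loM)// leq_addl.
set e := ((M ^ 25)%:R^-1 : R).
have e0 : 0 < e by rewrite invr_gt0 ltr0n expn_gt0 M0.
have e1 : e < 1.
  by rewrite invf_lt1 ?ltr0n ?expn_gt0 ?M0// ltr1n (leq_trans _ MN)// (leq_trans _ M75).
have d01 : 0 < e ^+ 48 < 1 by rewrite exprn_gt0// exprn_ilt1// ltW.
have [SS [rS dS fS dec]] := HC _ d01.
have := decoupling_scale hXi hA NA (leq_trans M75 MN) rS dS fS dec.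
rewrite -/L -/c1 -/e; apply/negP; rewrite -ltNge.
have /andP[K0 KM] := powR_loss M0 heps; rewrite -/e in K0 KM.
set k := (e ^+ 48) `^ (- eps) in K0 KM *.
have k4 : k ^+ 4 <= M%:R ^+ 48.
  by rewrite (exprM _ 12 4) ler_pXn2r// nnegrE ?exprn_ge0.
have e2 : e ^+ 2 = (M%:R ^+ 50)^-1 by rewrite /e natrX -exprVn -exprM -exprVn.
have M0' : 0 < M%:R :> R by rewrite ltr0n.
apply: le_lt_trans (_ : C ^+ 4 * c1 / M%:R ^+ 2 < _).
  rewrite exprMn e2 (_ : C ^+ 4 * c1 / M%:R ^+ 2 = C ^+ 4 * M%:R ^+ 48 * c1 / M%:R ^+ 50); last first.
    rewrite (exprD _ 2 48); by field; rewrite gt_eqF.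
  rewrite ler_pM2r ?invr_gt0 ?exprn_gt0//; apply: ler_wpM2r => //.
  by apply: ler_wpM2l k4; rewrite (exprM _ 2 2) sqr_ge0.
by rewrite ltr_pdivrMr ?exprn_gt0// [L * _]mulrC -ltr_pdivrMr.
Qed.
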